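(* Let $P(x)$ be a complex polynomial and $a,b\in\mathbb C$ with $P(a)=P(b)=z_0$. Assume that there exists a path $\Gamma\subset\mathbb C$ joining $a$ and $b$ such that $z_0$ is a simple point of $\gamma=P(\Gamma)$ and $z_0$ is on the boundary of the exterior (unbounded) component $D_0$ of $\mathbb C\setminus\gamma$. Then for any polynomial $Q$ the moments $m_k(P,Q)=\int_\Gamma P^k(x)Q(x)P'(x)\,dx$, $k\ge0$, all vanish if and only if the polynomial Composition condition is satisfied, i.e. there are polynomials $\tilde P,\tilde Q,W$ with $P(x)=\tilde P(W(x))$, $Q(x)=\tilde Q(W(x))$, $W(a)=W(b)$; hence $P$ is definite on $[a,b]$.
   Context: Paths are piecewise-smooth, and $\gamma=P(\Gamma)$ is assumed to have only transversal self-intersections. $\gamma$ is a closed curve starting and ending at $z_0$; $z_0$ is a simple point of $\gamma$ if $\gamma$ passes through $z_0$ only at its beginning and end. A polynomial $P$ is called definite on $[a,b]$ if for every polynomial $Q$ the vanishing of all the moments $m_k(P,Q)=\int_a^bP^kQP'\,dx$, $k\ge 0$, implies the polynomial Composition condition. *)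

(* Defs.v *)
From HB Require Import structures.
From mathcomp Require Import all_boot all_order all_algebra.
From mathcomp Require Import complex.
From mathcomp Require Import all_classical all_reals all_analysis.

Set Implicit Arguments.
Unset Strict Implicit.
Unset Printing Implicit Defensive.

Import Order.TTheory GRing.Theory Num.Theory.
Import numFieldNormedType.Exports.

Local Open Scope classical_set_scope.
Local Open Scope ring_scope.
Local Open Scope complex_scope.

(* Complex numbers over R, seen as a numClosedFieldType: this is what gives
   them the topology of the complex modulus (R[i] itself has none). *)
Definition cplx (R : realType) : numClosedFieldType := R[i].

Section Paths.
Variable R : realType.
Local Notation C := (cplx R).

(* f' is a continuous function on the closed interval, so the one-sided
   derivatives of f at the two ends exist as well once f is continuous. *)
Definition C1_on (f : R -> R) (s t : R) : Prop :=
  exists2 f' : R -> R, {within `[s, t], continuous f'} &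
    {in `]s, t[, forall x, is_derive x (1 : R) f (f' x)}.

(* Paths are parametrised by `[0, 1]; values outside are irrelevant. The
   velocity may vanish. *)
Definition piecewise_smooth (c : R -> C) : Prop :=
  {within `[0, 1], continuous c} /\
  exists2 s : seq R, itv_partition 0 1 s &
    forall i, (i < size s)%N ->
      let u := nth 0 (0 :: s) i in let v := nth 0 s i in
      C1_on (fun t => complex.Re (c t)) u v /\
      C1_on (fun t => complex.Im (c t)) u v.

Definition path_joining (c : R -> C) (a b : C) : Prop :=
  [/\ piecewise_smooth c, c 0 = a & c 1 = b].

Definition trace (c : R -> C) : set C := [set c t | t in `[0, 1]].

Definition image_path (P : {poly C}) (c : R -> C) (t : R) : C := P.[c t].

(* Linear independence over R, not over C. *)
Definition lin_independent (u v : C) : Prop :=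
  forall x y : R, x%:C * u + y%:C * v = 0 :> C -> x = 0 /\ y = 0.

(* u is the limit of the unit secants of c at s, from the right if
   [right], from the left otherwise. At a point where c has a nonzero velocity
   v, the two half-tangents are v/|v| and -v/|v|; half-tangents also make sense
   at corners, and where a path goes through a critical point of P. Where c is
   locally constant, u = 0 (as 0 / 0 = 0), which is independent of nothing. *)
Definition half_tangent (right : bool) (c : R -> C) (s : R) (u : C) : Prop :=
  (c t - c s) / `|c t - c s| @[t --> if right then s^'+ else s^'-] --> u.

Definition inside (right : bool) (s : R) : bool :=
  if right then s < 1 else 0 < s.

Definition transversal_at (c : R -> C) (s t : R) : Prop :=
  forall d e : bool, inside d s -> inside e t ->
    exists u v : C,
      [/\ half_tangent d c s u, half_tangent e c t v & lin_independent u v].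

(* The closing up of c at its two ends is not a self-intersection. *)
Definition transversal_self_intersections (c : R -> C) : Prop :=
  forall s t : R, 0 <= s -> s < t -> t <= 1 -> ~ (s = 0 /\ t = 1) ->
    c s = c t -> transversal_at c s t.

Definition simple_endpoint (c : R -> C) (z : C) : Prop :=
  [/\ c 0 = z, c 1 = z & forall t, 0 < t -> t < 1 -> c t <> z].

Definition unbounded_component (A D : set C) : Prop :=
  (exists2 z, A z & D = connected_component A z) /\ ~ bounded_set D.

Definition boundary (D : set C) : set C := closure D `\` interior D.

Definition velocity (c : R -> C) (t : R) : C :=
  derive1 (fun x => complex.Re (c x)) t +i* derive1 (fun x => complex.Im (c x)) t.

Definition path_integral (c : R -> C) (f : C -> C) : C :=
  let g t : C := f (c t) * velocity c t in
  (\int[lebesgue_measure]_(t in `[0, 1]) complex.Re (g t)) +i*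
  (\int[lebesgue_measure]_(t in `[0, 1]) complex.Im (g t)).

Definition segment (a b : C) (t : R) : C := a + (t%:C : C) * (b - a).

Definition moment (c : R -> C) (P Q : {poly C}) (k : nat) : C :=
  path_integral c (fun x => P.[x] ^+ k * Q.[x] * (P^`()).[x]).

Definition composition_condition (P Q : {poly C}) (a b : C) : Prop :=
  exists Pt Qt W : {poly C}, [/\ P = Pt \Po W, Q = Qt \Po W & W.[a] = W.[b]].

(* The integrand is a polynomial, so the integral from a to b does not depend
   on the path; it is taken here along the straight segment. *)
Definition definite (P : {poly C}) (a b : C) : Prop :=
  forall Q : {poly C},
    (forall k : nat, moment (segment a b) P Q k = 0) ->
    composition_condition P Q a b.

End Paths.

(* Main.v *)
Require Import Defs.
From HB Require Import structures.
From mathcomp Require Import all_boot all_order all_algebra.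
From mathcomp Require Import complex polyXY.
From mathcomp Require Import all_classical all_reals all_analysis.
From mathcomp Require Import measurable_realfun.
From mathcomp Require Import zify ring lra.

(* Write g = P o Gamma and let A be the uniform closure on [0, 1] of the
   polynomials in g. Vanishing of the moments means that the functional
   f |-> int f Q(Gamma) dg kills A. Pushing poles along D0 (Runge) shows that A
   contains 1 / (g - t) and all roots of g - t for t in D0; letting t tend to z0
   inside D0 produces om in A with om^N = g - z0, and then square roots of
   1 / (om - tau) for arbitrarily small tau with tau^N + z0 in D0.
   If N is divisible by the multiplicities of P at a and at b, then near its two
   ends Gamma is a power series X(om), respectively Y(om). Suppose that Q(Y) - Q(X)
   starts with c w^n0, c <> 0, and put n = n0 + N - 1. Testing the functional
   against (om - tau)^(-n-3/2), a half-integer power so that no logarithm ever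
   occurs, all boundary terms stay bounded as tau -> 0 except the one at om = 0,
   which grows like |tau|^(-1/2): a contradiction. Hence Q(X) = Q(Y).
   The polynomials f with f(X) = f(Y) form a subalgebra closed under exact
   division; by a Lueroth-type argument it is C[W] for some W in it. It contains
   P and Q, and W(a) = W(b) is the equality of the constant terms of W(X) and
   W(Y). *)

Set Implicit Arguments.
Unset Strict Implicit.
Unset Printing Implicit Defensive.

Import Order.TTheory GRing.Theory Num.Theory.
Import numFieldNormedType.Exports.

Local Open Scope classical_set_scope.
Local Open Scope ring_scope.

(** * Subalgebras of polynomials closed under division *)

(** Near z0 neither the curve nor D0 has a controlled shape, so no contour is ever deformed: every
    branch of a root is a uniform limit of polynomials in g. This is where the exterior position of
    z0 acts. Such a limit takes the same value at both ends of the path, so the half-integer powers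
    return to their own branch, and X and Y are expansions in one and the same parameter om. The
    exponent n + 3/2 is matched to the order of vanishing: since dg = N om^(N-1) d om, the form
    (Q(Y) - Q(X)) dg starts at om^n, and its primitive at om = 0 has size |tau|^n |tau|^(-n-1/2).
    Power series never occur as objects. X and Y are sequences of polynomials coming from Newton
    iteration; they converge X-adically, which serves the algebra, and at a geometric rate when
    evaluated along the path, which serves the estimates. *)

Lemma size_quotient_le1 (m q w : nat) :
  (m + q).-1 = w -> (w <= m)%N -> (1 < w)%N -> (q <= 1)%N.
Proof. lia. Qed.

Lemma size_quotient_lt (f h w n : nat) :
  f = (w + h).-1 -> (1 < w)%N -> (f < n.+1)%N -> (h < n)%N.
Proof. lia. Qed.

Section Luroth.
Variable F : closedFieldType.
Implicit Types (f g h P W : {poly F}) (u M q G : {poly {poly F}}).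

Definition evx (x : F) u : {poly F} := map_poly (horner_eval x) u.

Lemma evx_eq0 (x : F) q : evx x q = 0 -> exists q1, q = ('X - x%:P) *: q1.
Proof.
move=> q0; exists (map_poly (fun c => c %/ ('X - x%:P)) q).
apply/polyP => i; rewrite coefZ coef_map_id0 ?div0p // mulrC divpK //.
rewrite dvdp_XsubCl rootE.
by have := congr1 (fun p : {poly F} => p`_i) q0;
  rewrite coef_map /= coef0 /horner_eval => ->.
Qed.

(** Over an algebraically closed field the coefficients of [M] are coprime exactly when no point
    kills all of them, so content can be handled by evaluation. *)
Definition primitive_x M := forall x : F, evx x M != 0.

Lemma primitive_part u : u != 0 -> exists c M,
  [/\ c != 0, primitive_x M & u = c *: M].
Proof.
have [n] := ubnP (size (lead_coef u)); elim: n u => // n IH u sz u0.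
have [pr|] := pselect (primitive_x u).
  by exists 1, u; split=> //; rewrite ?oner_eq0 ?scale1r.
move=> /existsNP[x /negP]; rewrite negbK => /eqP /evx_eq0[q1 q1E].
have q10 : q1 != 0 by apply: contraNneq u0 => q10; rewrite q1E q10 scaler0.
have [|//|c [M [c0 Mp E]]] := IH q1.
  move: sz; rewrite q1E lead_coefZ mulrC size_Mmonic ?monicXsubC ?lead_coef_eq0 //.
  by rewrite size_XsubC addn2 /= => /ltnSE.
exists (('X - x%:P) * c), M; split => //.
  by rewrite mulf_neq0 ?polyXsubC_eq0.
by rewrite q1E E scalerA.
Qed.

(** Gauss's lemma, one linear factor of [c] at a time: at a root of [c] the product of the
    specialisations of [M] and [q] vanishes, and only that of [q] can be zero. *)
Lemma primitive_dvd M q G (c : {poly F}) : primitive_x M -> c != 0 ->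
  M * q = c *: G -> exists q', M * q' = G.
Proof.
move=> Mp; have [n] := ubnP (size c); elim: n c q => // n IH c q sz c0 E.
have [/size_poly1P[d d0 cE]|] := boolP (size c == 1).
  exists (d^-1%:P *: q); rewrite -scalerAr E cE scalerA -polyCM mulVf //.
  by rewrite scale1r.
move=> /closed_rootP[x xr].
have : evx x (M * q) = 0.
  rewrite E /evx -mul_polyC rmorphM /= map_polyC /= /horner_eval (rootP xr).
  by rewrite mul0r.
rewrite /evx rmorphM /= => /eqP; rewrite mulf_eq0 (negPf (Mp x)) /= => /eqP.
move=> /evx_eq0[q1 q1E]; have [c1 c1E] := factor_theorem _ _ xr.
have X0 : ('X - x%:P : {poly F}) != 0 by rewrite polyXsubC_eq0.
have c10 : c1 != 0 by apply: contraNneq c0 => c10; rewrite c1E c10 mul0r.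
apply: (IH c1 q1 _ c10).
  move: sz; rewrite c1E size_Mmonic ?monicXsubC // size_XsubC addn2 /=.
  by move=> /ltnSE.
move: E; rewrite q1E c1E [c1 * _]mulrC -scalerA -scalerAr.
by rewrite -!mul_polyC => /mulfI; apply; rewrite polyC_eq0.
Qed.

Variable RR : {poly F} -> Prop.
Hypothesis RRC : forall c, RR c%:P.
Hypothesis RRB : forall f g, RR f -> RR g -> RR (f - g).
Hypothesis RRM : forall f g, RR f -> RR g -> RR (f * g).
Hypothesis RRV : forall f g, f != 0 -> RR f -> RR (f * g) -> RR g.

(** The outer variable is a second unknown Y, and these are the relations over [RR] satisfied by Y =
    x. A nonzero one of least degree stands in for the minimal polynomial of x over the fractions of
    [RR]. *)
Let RRY u := (forall i, RR u`_i) /\ u.['X] = 0.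

Let size_lt f : (1 < size f)%N -> (size (- f%:P : {poly {poly F}}) < size f^:P)%N.
Proof.
move=> sf; rewrite size_polyN size_map_polyC; apply: leq_ltn_trans sf.
by rewrite size_polyC leq_b1.
Qed.

Let RR_diff f : RR f -> RRY (f^:P - f%:P).
Proof.
move=> Rf; split=> [i|].
  rewrite coefB coef_map /= coefC; case: eqP => _; apply: RRB => //.
  exact: RRC 0.
rewrite hornerD hornerN hornerC.
have -> : f^:P.['X] = f \Po 'X by [].
by rewrite comp_polyXr subrr.
Qed.

(** Pseudo-division: [RR] is not a field, so each step multiplies by the leading coefficient of [u].
    Remainders are again relations, and minimality of [u] forces the last one to vanish. *)
Let RR_pseudo u G : u != 0 -> RRY u ->
  (forall G', RRY G' -> G' != 0 -> (size u <= size G')%N) ->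
  RRY G -> exists c q, [/\ c != 0 & u * q = c *: G].
Proof.
move=> u0 [Ru ux] umin; have [n] := ubnP (size G).
elim: n G => // n IH G sz RG; have [->|G0] := eqVneq G 0.
  by exists 1, 0; rewrite oner_eq0 mulr0 scaler0.
have szG := umin _ RG G0; have lu : lead_coef u != 0 by rewrite lead_coef_eq0.
set d := (size G - size u)%N.
set G' := lead_coef u *: G - lead_coef G *: ('X^d * u).
have [||c' [q' [c0 E]]] := IH G'.
- apply: leq_trans (_ : (size G <= n)%N); last by rewrite -ltnS.
  have sG : (0 < size G)%N by rewrite size_poly_gt0.
  rewrite -[X in (_ < X)%N](prednK sG) ltnS; apply/leq_sizeP => j hj.
  rewrite /G' coefB !coefZ coefXnM.
  have su : (0 < size u)%N by rewrite size_poly_gt0.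
  have [->|ne] := eqVneq j (size G).-1.
    have -> : ((size G).-1 < d)%N = false by apply/negbTE; rewrite -leqNgt /d; lia.
    have -> : ((size G).-1 - d = (size u).-1)%N by rewrite /d; lia.
    by rewrite -!lead_coefE mulrC subrr.
  have hj' : (size G <= j)%N by lia.
  rewrite (nth_default _ hj') mulr0; case: ifP => _; first by rewrite mulr0 subrr.
  by rewrite [u`__]nth_default ?mulr0 ?subrr // leq_subRL ?(leq_trans (leq_subr
    _ _)) // subnK.
- case: RG => RG1 RG2; split=> [i|].
    rewrite /G' coefB !coefZ coefXnM; apply: RRB; apply: RRM; rewrite ?lead_coefE //.
    by case: ifP => _; [exact: (RRC 0) | exact: Ru].
  rewrite /G' hornerD hornerN !hornerZ RG2 hornerM ux !mulr0.
  by rewrite subrr.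
exists (c' * lead_coef u), (q' + (c' * lead_coef G) *: 'X^d).
split; first exact: mulf_neq0.
rewrite mulrDr E /G' scalerBr !scalerA -scalerAr [u * _]mulrC.
by rewrite subrK.
Qed.

(** The primitive part [M] of a minimal relation divides f(Y) - f(x) for every f in [RR]. Its
    coefficients lie in [RR], and for a nonconstant one, [W], comparison of degrees in x shows that
    W(Y) - W(x) is a constant multiple of [M]. Dividing f(Y) - f(x) by it expresses f through [W],
    by induction on the degree. *)
Theorem polynomial_luroth P : RR P -> (1 < size P)%N ->
  exists2 W, RR W & forall f, RR f -> exists ft, f = ft \Po W.
Proof.
move=> RP sP.
pose ok n := `[< exists u, [/\ u != 0, RRY u & size u = n] >].
have P0 : P^:P - P%:P != 0.
  by rewrite -size_poly_gt0 size_polyDl ?size_lt // size_map_polyC ltnW.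
have okP : ok (size (P^:P - P%:P)).
  by apply/asboolP; exists (P^:P - P%:P); split=> //; exact: RR_diff.
have exok : exists n, ok n by exists (size (P^:P - P%:P)).
case: (ex_minnP exok) => n /asboolP[u [u0 Ru szu]] nmin.
have umin G : RRY G -> G != 0 -> (size u <= size G)%N.
  by move=> RG G0; rewrite szu; apply: nmin; apply/asboolP; exists G.
have [e [M [e0 Mp uE]]] := primitive_part u0.
have Mdiv G : RRY G -> exists q, M * q = G.
  move=> RG; have [c [q [c0 E]]] := RR_pseudo u0 Ru umin RG.
  apply: (@primitive_dvd M (e *: q) G c) => //.
  by rewrite -E uE -scalerAr scalerAl.
have [qP qPE] := Mdiv _ (RR_diff RP).
have lP : lead_coef (P^:P - P%:P) = (lead_coef P)%:P.
  rewrite lead_coefDl ?size_lt // lead_coef_map_inj //; exact: polyC_inj.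
have lP0 : lead_coef P != 0 by rewrite lead_coef_eq0 -size_poly_gt0;
  apply: ltn_trans sP.
(* The leading coefficient of [M] divides that of P(Y) - P(x), a nonzero constant. Hence [e] is, up
   to a constant, the leading coefficient of [u] and so belongs to [RR]. *)
have /size_poly1P[k k0 lM] : size (lead_coef M) == 1.
  have := congr1 (fun p : {poly {poly F}} => size (lead_coef p)) qPE;
    rewrite lead_coefM lP size_polyC lP0 /=.
  by move=> /eqP; rewrite size_mul_eq1 => /andP[].
have Re : RR e.
  have := Ru.1 (size u).-1; rewrite -lead_coefE uE lead_coefZ lM => H.
  by apply: (RRV (f := k%:P)); rewrite ?polyC_eq0 // mulrC.
have RM i : RR M`_i.
  by apply: (RRV e0 Re); have := Ru.1 i; rewrite uE coefZ.
have Mx : M.['X] = 0.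
  have := Ru.2; rewrite uE hornerZ => /eqP; rewrite mulf_eq0 (negPf e0) /=.
  by move=> /eqP.
have M0 : M != 0 by apply: contraNneq u0 => M0; rewrite uE M0 scaler0.
(* With constant coefficients only, [M] would be an algebraic equation over [F] satisfied by the
   indeterminate x. *)
have [i szi] : exists i, (1 < size (M`_i)%R)%N.
  apply: contrapT => /forallNP H.
  have ME : M = (map_poly (fun c : {poly F} => c`_0) M)^:P.
    apply/polyP => i; rewrite coef_map /= coef_map_id0 ?coef0 //.
    by apply: size1_polyC; rewrite leqNgt; apply/negP/H.
  move: M0; rewrite ME; have -> : map_poly (fun c : {poly F} => c`_0) M = 0; last first.
    by rewrite rmorph0 eqxx.
  by rewrite -[LHS]comp_polyXr -Mx [in RHS]ME.
exists M`_i => //; set W := M`_i in szi *.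
have [q qE] := Mdiv _ (RR_diff (RM i)).
have W0 : W != 0 by rewrite -size_poly_gt0; apply: ltn_trans szi.
have WW0 : W^:P - W%:P != 0.
  by rewrite -size_poly_gt0 size_polyDl ?size_lt // size_map_polyC ltnW.
have [q0 qM0] : q != 0 /\ M != 0.
  by move: WW0; rewrite -qE mulf_eq0 negb_or => /andP[-> ->].
have swE : swapXY M * swapXY q = W%:P - W^:P.
  by rewrite -rmorphM qE rmorphB /= swapXY_map_polyC swapXY_polyC.
have szE : size (W%:P - W^:P) = size W.
  by rewrite -size_polyN opprB size_polyDl ?size_lt // size_map_polyC.
(* [W] is a coefficient of [M], so [M] already has the full x-degree of W(Y) - W(x), and the
   quotient is free of x. *)
have sM : (size W <= size (swapXY M))%N by rewrite -sizeYE max_size_coefXY.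
have [k' k'E] : exists k' : {poly F}, swapXY q = k'%:P.
  exists (swapXY q)`_0; apply: size1_polyC.
  have := congr1 (fun p : {poly {poly F}} => size p) swE.
  rewrite size_mul ?swapXY_eq0 // szE => /size_quotient_le1; exact.
have /size_poly1P[kq kq0 kqE] : size k' == 1.
  have := congr1 (fun p : {poly {poly F}} => p`_(size W).-1) swE.
  rewrite k'E coefMC coefB coef_map /= coefC.
  have -> : ((size W).-1 == 0)%N = false by case: (size W) szi => [|[]].
  rewrite sub0r -lead_coefE => E.
  have : size ((swapXY M)`_(size W).-1 * k') == 1.
    by rewrite E size_polyN size_polyC lead_coef_eq0 W0.
  by rewrite size_mul_eq1 => /andP[].
have ME : kq%:P *: M = W^:P - W%:P.
  rewrite -qE -[q]swapXYK k'E swapXY_polyC kqE map_polyC /=.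
  by rewrite mulrC mul_polyC.
move=> f; have [n'] := ubnP (size f); elim: n' f => // n' IH f szf Rf.
have [sf|sf] := leqP (size f) 1.
  by exists f; rewrite [in LHS](size1_polyC sf) [in RHS](size1_polyC sf) comp_polyC.
have [h hE] := Mdiv _ (RR_diff Rf).
(* Specialising x to 0 leaves a factorisation of f - f(0) by W - W(0) in one variable; the cofactor
   is in [RR] by division and has smaller degree. *)
have /(congr1 (evx 0)) : kq%:P *: (f^:P - f%:P) = (W^:P - W%:P) * h.
  by rewrite -hE scalerAl ME.
rewrite /evx -mul_polyC !rmorphM /= !rmorphB /= !map_polyC /= /horner_eval.
rewrite hornerC.
have idp (g : {poly F}) : map_poly (horner_eval 0) g^:P = g.
  by apply/polyP => j; rewrite !coef_map /= /horner_eval hornerC.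
rewrite !idp; set h0 := map_poly _ h => E.
have f0E : kq%:P * (f - (f.[0])%:P) != 0.
  rewrite mulf_neq0 ?polyC_eq0 // subr_eq0; apply: contraTneq sf => ->.
  by rewrite size_polyC -leqNgt leq_b1.
have Rh0 : RR h0.
  apply: (RRV (f := W - (W.[0])%:P)).
  - by apply: contraNneq f0E => WE; rewrite E WE mul0r.
  - by apply: RRB => //; exact: RM.
  - by rewrite -E; apply: RRM => //; apply: RRB.
have szW : size (W - (W.[0])%:P) = size W.
  rewrite size_polyDl // size_polyN; apply: leq_ltn_trans szi.
  by rewrite size_polyC leq_b1.
have szf0 : size (f - (f.[0])%:P) = size f.
  rewrite size_polyDl // size_polyN; apply: leq_ltn_trans sf.
  by rewrite size_polyC leq_b1.
have [|h1 h1E] := IH h0 _ Rh0.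
  have := congr1 (fun p : {poly F} => size p) E.
  rewrite mul_polyC size_scale // szf0 size_mul ?szW.
  - by move=> /size_quotient_lt; apply.
  - by rewrite -size_poly_gt0 szW size_poly_gt0.
  - by apply: contraNneq f0E => h00; rewrite E h00 mulr0.
exists (kq^-1 *: (('X - (W.[0])%:P) * h1) + (f.[0])%:P).
rewrite comp_polyD comp_polyC comp_polyZ comp_polyM comp_polyB comp_polyX.
rewrite comp_polyC -h1E -E -mul_polyC mulrA -polyCM mulVf // mul1r.
by rewrite subrK.
Qed.
End Luroth.

(** * The real modulus and weighted norms of polynomials *)

Section Modulus.
Variable R : realType.
Local Notation C := (cplx R).
Implicit Types (x y z : C) (f g p : {poly C}).

(** The norm of [C] takes its values in [C]; here the modulus is a real number, open to real
    arithmetic. *)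
Definition cm (z : C) : R := Normc.normc (z : R[i]).

Definition rc (t : R) : C := (t%:C)%C.

Lemma cmE z : `|z| = rc (cm z). Proof. by []. Qed.
Lemma cm_ge0 z : 0 <= cm z.
Proof. by case: z => a b; rewrite /cm /= sqrtr_ge0. Qed.
Lemma cm0 : cm 0 = 0. Proof. exact: Normc.normc0. Qed.
Lemma cm1 : cm 1 = 1. Proof. exact: Normc.normc1. Qed.
Lemma cmM x y : cm (x * y) = cm x * cm y. Proof. exact: Normc.normcM. Qed.
Lemma cmV x : cm x^-1 = (cm x)^-1. Proof. exact: Normc.normcV. Qed.
Lemma cmD x y : cm (x + y) <= cm x + cm y. Proof. exact: le_normcD. Qed.
Lemma cmN x : cm (- x) = cm x. Proof. exact: normcN. Qed.
Lemma cmB x y : cm (x - y) <= cm x + cm y. Proof. by rewrite -(cmN y) cmD. Qed.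
Lemma cmBC x y : cm (x - y) = cm (y - x). Proof. by rewrite -cmN opprB. Qed.
Lemma cm_eq0 x : (cm x == 0) = (x == 0).
Proof. by apply/eqP/eqP => [/Normc.eq0_normc//|->]; rewrite cm0. Qed.
Lemma cm_gt0 x : (0 < cm x) = (x != 0).
Proof. by rewrite lt_neqAle cm_ge0 andbT eq_sym cm_eq0. Qed.
Lemma cmX x n : cm (x ^+ n) = cm x ^+ n.
Proof. by elim: n => [|n IH]; rewrite ?expr0 ?cm1 // !exprS cmM IH. Qed.
Lemma cm_tri x y z : cm (x - z) <= cm (x - y) + cm (y - z).
Proof. by rewrite -[x - z](subrKA y) cmD. Qed.
Lemma cm_rtri x y : cm x - cm y <= cm (x - y).
Proof. by rewrite lerBlDr; apply: le_trans (cmD _ _); rewrite subrK. Qed.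
Lemma cm_rc (t : R) : cm (rc t) = `|t|.
Proof. by rewrite /cm /= expr0n /= addr0 sqrtr_sqr. Qed.
Lemma rcB s t : rc (s - t) = rc s - rc t. Proof. exact: rmorphB. Qed.
Lemma rc0 : rc 0 = 0. Proof. by []. Qed.
Lemma rc_eq0 t : (rc t == 0) = (t == 0).
Proof. by rewrite -cm_eq0 cm_rc normr_eq0. Qed.
Lemma cm_nat n : cm n%:R = n%:R.
Proof.
have -> : (n%:R : C) = rc n%:R by rewrite /rc rmorph_nat.
by rewrite cm_rc normr_nat.
Qed.
Lemma cm_Re z : `|complex.Re z| <= cm z.
Proof.
case: z => a b; rewrite /cm /= -[leLHS]ger0_norm // -sqrtr_sqr ler_wsqrtr //.
by rewrite real_normK ?num_real // lerDl sqr_ge0.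
Qed.
Lemma cm_Im z : `|complex.Im z| <= cm z.
Proof.
case: z => a b; rewrite /cm /= -[leLHS]ger0_norm // -sqrtr_sqr ler_wsqrtr //.
by rewrite real_normK ?num_real // lerDr sqr_ge0.
Qed.
Lemma cm_ReIm z : cm z <= `|complex.Re z| + `|complex.Im z|.
Proof.
case: z => a b; have E : Complex a b = rc a + rc b * 'i%C :> R[i] by simpc.
rewrite {1}E; apply: le_trans (cmD _ _) _.
rewrite cmM !cm_rc [cm 'i%C]/cm /= expr0n add0r.
by rewrite expr1n sqrtr1 mulr1.
Qed.

Lemma cm_sum (I : Type) (s : seq I) (F : I -> C) :
  cm (\sum_(i <- s) F i) <= \sum_(i <- s) cm (F i).
Proof.
elim: s => [|i s IH]; first by rewrite !big_nil cm0.
by rewrite !big_cons; apply: le_trans (cmD _ _) _; rewrite lerD2l.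
Qed.

(** The l1 norm of the coefficients with weights rho^i. It is submultiplicative and dominates the
    modulus on the disc of radius [rho]. *)
Definition pn (rho : R) p : R := (map_poly cm p).[rho].

Let map_cmMXC p (c : C) :
  map_poly cm (p * 'X + c%:P) = map_poly cm p * 'X + (cm c)%:P.
Proof.
apply/polyP => i; rewrite coef_map_id0 ?cm0 // !coefD !coefMX !coefC.
by case: i => [|i] /=; rewrite ?add0r // !addr0 coef_map_id0 ?cm0.
Qed.

Lemma pnMXC rho p (c : C) : pn rho (p * 'X + c%:P) = pn rho p * rho + cm c.
Proof. by rewrite /pn map_cmMXC hornerMXaddC. Qed.

Lemma pn0 rho : pn rho 0 = 0.
Proof. by rewrite /pn map_poly0 horner0. Qed.

Lemma pnC rho c : pn rho c%:P = cm c.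
Proof. by have := pnMXC rho 0 c; rewrite pn0 !mul0r !add0r. Qed.

Lemma pnMX rho p : pn rho (p * 'X) = pn rho p * rho.
Proof. by have := pnMXC rho p 0; rewrite cm0 !addr0. Qed.

Variable rho : R.
Hypothesis rho0 : 0 <= rho.

Lemma pn_ge0 p : 0 <= pn rho p.
Proof.
elim/poly_ind: p => [|p c IH]; first by rewrite pn0.
by rewrite pnMXC addr_ge0 ?mulr_ge0 // cm_ge0.
Qed.

Lemma pnN p : pn rho (- p) = pn rho p.
Proof.
elim/poly_ind: p => [|p c IH]; first by rewrite oppr0.
by rewrite opprD -mulNr -polyCN !pnMXC cmN IH.
Qed.

Lemma pnD p q : pn rho (p + q) <= pn rho p + pn rho q.
Proof.
elim/poly_ind: p q => [|p c IH] q; first by rewrite pn0 !add0r.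
have [q' [d ->]] : exists q' d, q = q' * 'X + d%:P.
  elim/poly_ind: q {IH} => [|q' d _]; last by exists q', d.
  by exists 0, 0; rewrite mul0r addr0.
have -> : p * 'X + c%:P + (q' * 'X + d%:P) = (p + q') * 'X + (c + d)%:P.
  by rewrite polyCD mulrDl addrACA.
rewrite !pnMXC; have := IH q'; have := cmD c d.
move=> h1 h2; apply: le_trans (_ : (pn rho p + pn rho q') * rho + (cm c + cm d) <= _).
  by rewrite lerD // ler_wpM2r.
by rewrite mulrDl addrACA.
Qed.

Lemma pnZ c p : pn rho (c *: p) = cm c * pn rho p.
Proof.
elim/poly_ind: p => [|p d IH]; first by rewrite scaler0 pn0 mulr0.
rewrite scalerDr scalerAl -[c *: d%:P]mul_polyC -polyCM !pnMXC IH cmM.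
by rewrite mulrDr mulrA.
Qed.

Lemma pnM p q : pn rho (p * q) <= pn rho p * pn rho q.
Proof.
elim/poly_ind: p => [|p c IH]; first by rewrite mul0r pn0 mul0r.
rewrite mulrDl mulrAC mul_polyC; apply: le_trans (pnD _ _) _.
rewrite pnMX pnZ pnMXC mulrDl lerD2r mulrAC.
by rewrite ler_wpM2r.
Qed.

Lemma cm_horner_le p w : cm w <= rho -> cm p.[w] <= pn rho p.
Proof.
move=> wr; elim/poly_ind: p => [|p c IH]; first by rewrite horner0 cm0 pn0.
rewrite hornerMXaddC pnMXC; apply: le_trans (cmD _ _) _.
by rewrite lerD2r cmM ler_pM // cm_ge0.
Qed.

Lemma pnE p n : (size p <= n)%N -> pn rho p = \sum_(i < n) cm p`_i * rho ^+ i.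
Proof.
move=> sp; rewrite /pn (horner_coef_wide _ (leq_trans (size_poly _ _) sp)).
by apply: eq_bigr => i _; rewrite coef_map_id0 // cm0.
Qed.

Lemma pn_comp p q : pn rho (p \Po q) <= pn (pn rho q) p.
Proof.
elim/poly_ind: p => [|p c IH]; first by rewrite comp_poly0 !pn0.
rewrite comp_poly_MXaddC pnMXC; apply: le_trans (pnD _ _) _.
rewrite pnC lerD2r; apply: le_trans (pnM _ _) _.
by rewrite ler_wpM2r // pn_ge0.
Qed.

End Modulus.

Lemma pn_le (R : realType) (r1 r2 : R) (p : {poly cplx R}) :
  0 <= r1 -> r1 <= r2 -> pn r1 p <= pn r2 p.
Proof.
move=> r10 r12; have r20 := le_trans r10 r12.
elim/poly_ind: p => [|p c IH]; first by rewrite !pn0.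
by rewrite !pnMXC lerD2r ler_pM // pn_ge0.
Qed.

(** * Primitives of polynomials *)

Section Antiderivative.
Variable R : realType.
Local Notation C := (cplx R).

Lemma antiderivative_exists (f : {poly C}) : exists T : {poly C}, T^`() = f.
Proof.
exists (\poly_(i < (size f).+1) (f`_i.-1 / i%:R)); apply/polyP => i.
rewrite coef_deriv coef_poly ltnS; case: ltnP => h.
  by rewrite /= -[LHS]mulr_natr divfK // pnatr_eq0.
by rewrite mul0rn nth_default.
Qed.

Lemma deriv_inj_at (f h : {poly C}) (x y : C) :
  f^`() = h^`() -> f.[x] - f.[y] = h.[x] - h.[y].
Proof.
move=> fh; have D0 : (f - h)^`() = 0 by rewrite derivB fh subrr.
have [d dE] : exists d, f - h = d%:P.
  exists (f - h)`_0; apply/polyP => -[|i]; rewrite coefC //=.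
  have := congr1 (fun p : {poly C} => p`_i) D0; rewrite coef_deriv coef0 => /eqP.
  by rewrite -mulr_natr mulf_eq0 pnatr_eq0 orbF => /eqP.
have E z : f.[z] = h.[z] + d.
  by rewrite -[f](subrK h) dE hornerD hornerC addrC.
rewrite !E; ring.
Qed.

End Antiderivative.

(** * Newton iteration over polynomials *)

Section Lipschitz.
Variables (R : realType) (A : comNzRingType) (N : A -> R).
Hypothesis N0 : N 0 = 0.
Hypothesis Nge0 : forall x, 0 <= N x.
Hypothesis ND : forall x y, N (x + y) <= N x + N y.
Hypothesis NM : forall x y, N (x * y) <= N x * N y.
Implicit Types (F : {poly A}) (x y : A).

Lemma map_polyMXC F (c : A) :
  map_poly N (F * 'X + c%:P) = map_poly N F * 'X + (N c)%:P.
Proof.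
apply/polyP => i; rewrite coef_map_id0 // !coefD !coefMX !coefC.
by case: i => [|i] /=; rewrite ?add0r // !addr0 coef_map_id0.
Qed.

Variable delta : R.
Hypothesis delta0 : 0 <= delta.

Lemma horner_map_ge0 F : 0 <= (map_poly N F).[delta].
Proof.
elim/poly_ind: F => [|F c IH]; first by rewrite map_poly0 horner0.
by rewrite map_polyMXC hornerMXaddC addr_ge0 ?mulr_ge0.
Qed.

Lemma horner_bound F x : N x <= delta -> N F.[x] <= (map_poly N F).[delta].
Proof.
move=> xd; elim/poly_ind: F => [|F c IH].
  by rewrite map_poly0 !horner0 N0.
rewrite map_polyMXC !hornerMXaddC; apply: le_trans (ND _ _) _; rewrite lerD2r.
by apply: le_trans (NM _ _) _; rewrite ler_pM.
Qed.

Lemma horner_deriv_map_ge0 F : 0 <= ((map_poly N F)^`()).[delta].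
Proof.
elim/poly_ind: F => [|F c IH]; first by rewrite map_poly0 deriv0 horner0.
rewrite map_polyMXC derivD derivC addr0 derivM derivX mulr1 hornerD hornerMX.
by rewrite addr_ge0 ?mulr_ge0 // horner_map_ge0.
Qed.

(** Majorant method: the derivative of the majorant [map_poly N F] at [delta] is a Lipschitz
    constant on the ball. The ring is left abstract because this serves both polynomials with the
    norm [pn rho] and complex numbers with [cm]. *)
Lemma horner_lipschitz F x y : N x <= delta -> N y <= delta ->
  N (F.[x] - F.[y]) <= ((map_poly N F)^`()).[delta] * N (x - y).
Proof.
move=> xd yd; elim/poly_ind: F => [|F c IH].
  by rewrite map_poly0 deriv0 !horner0 subrr N0 mul0r.
rewrite !hornerMXaddC map_polyMXC derivD derivC addr0 derivM derivX mulr1.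
rewrite [(_ + _).[delta]]hornerD hornerMX.
have -> : F.[x] * x + c - (F.[y] * y + c) =
    (F.[x] - F.[y]) * x + F.[y] * (x - y) by ring.
apply: le_trans (ND _ _) _; rewrite [leRHS]mulrDl lerD //.
  apply: le_trans (NM _ _) _; rewrite mulrAC ler_pM //.
apply: le_trans (NM _ _) _; rewrite ler_wpM2r //; exact: horner_bound.
Qed.

(** A contraction of factor 1/2 that moves 0 by at most delta/2 maps the ball of radius [delta] to
    itself. *)
Lemma picard_bound F : N F`_0 <= delta / 2 ->
  ((map_poly N F)^`()).[delta] <= 1 / 2 ->
  forall m, N (iter m (horner F) 0) <= delta.
Proof.
move=> F0 FL; elim=> [|m IH]; first by rewrite /= N0.
rewrite iterS; set e := iter m _ _ in IH *.
have -> : F.[e] = (F.[e] - F.[0]) + F`_0 by rewrite horner_coef0 subrK.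
apply: le_trans (ND _ _) _; have -> : delta = delta / 2 + delta / 2 by field.
apply: lerD F0; apply: le_trans (horner_lipschitz _ IH _) _; first by rewrite N0.
rewrite subr0; apply: le_trans (_ : 1 / 2 * delta <= _); last by lra.
by rewrite ler_pM // horner_deriv_map_ge0.
Qed.

Lemma picard_cvg F z : N F`_0 <= delta / 2 ->
  ((map_poly N F)^`()).[delta] <= 1 / 2 -> N z <= delta -> F.[z] = z ->
  N (- z) = N z ->
  forall m, N (iter m (horner F) 0 - z) <= delta / 2 ^+ m.
Proof.
move=> F0 FL zd Fz Nz; elim=> [|m IH].
  by rewrite /= sub0r Nz expr0 divr1.
rewrite iterS; set e := iter m _ _ in IH *.
rewrite -{1}Fz; apply: le_trans (horner_lipschitz _ _ zd) _.
  exact: picard_bound.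
rewrite exprS invfM mulrCA -[2^-1]mul1r ler_pM //.
exact: horner_deriv_map_ge0.
Qed.
End Lipschitz.

Lemma horner_le_coef (R : realType) (p q : {poly R}) (d : R) : 0 <= d ->
  (forall i, p`_i <= q`_i) -> p.[d] <= q.[d].
Proof.
move=> d0 pq; rewrite (@horner_coef_wide _ (maxn (size p) (size q)) p) ?leq_maxl //.
rewrite (@horner_coef_wide _ (maxn (size p) (size q)) q) ?leq_maxr //.
by apply: ler_sum => i _; rewrite ler_wpM2r ?exprn_ge0.
Qed.

Lemma horner_deriv_le_coef (R : realType) (p q : {poly R}) (d : R) : 0 <= d ->
  (forall i, p`_i <= q`_i) -> (p^`()).[d] <= (q^`()).[d].
Proof.
by move=> d0 pq; apply: horner_le_coef => // i; rewrite !coef_deriv lerMn2r pq orbT.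
Qed.

Section Shift.
Variable A : comNzRingType.
Implicit Types (H : {poly A}) (x c : A).

Lemma newton_map H c : exists F : {poly A},
  [/\ forall x, F.[x] = x - c * H.[1 + x], F`_0 = - (c * H.[1]) &
    F`_1 = 1 - c * H^`().[1]].
Proof.
exists ('X - c *: (H \Po ('X + 1%:P))); split=> [x||].
  by rewrite hornerD hornerN hornerX hornerZ horner_comp hornerD hornerX
    hornerC addrC [x + 1]addrC addrC.
  rewrite -horner_coef0 hornerD hornerN hornerX hornerZ horner_comp hornerD.
  by rewrite hornerX hornerC !add0r.
have := coef_deriv ('X - c *: (H \Po ('X + 1%:P))) 0; rewrite mulr1n => <-.
rewrite -horner_coef0 derivB derivX derivZ deriv_comp derivD derivX derivC.
rewrite addr0 mulr1 hornerD hornerN hornerZ horner_comp hornerD hornerX.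
by rewrite !hornerC add0r.
Qed.
End Shift.

Section Hensel.
Variable R : realType.
Local Notation C := (cplx R).
Implicit Types (F H : {poly {poly C}}).

(** Write F(y) = G(y) y^2 + f1 X y + f0 X. The radius [delta] makes the quadratic part a contraction
    of factor 1/4; then [rho] makes the two terms carrying X small, the linear one of factor 1/4 and
    the constant one below delta/2. Both radii are at most 1, so norms taken at radius 1 serve as
    bounds. *)
Lemma picard_constants F : (F`_0).[0] = 0 -> (F`_1).[0] = 0 ->
  exists delta rho : R, [/\ 0 < delta, 0 < rho, pn rho F`_0 <= delta / 2 &
    ((map_poly (pn rho) F)^`()).[delta] <= 1 / 2].
Proof.
have divX (p : {poly C}) : p.[0] = 0 -> exists q, p = q * 'X.
  by move=> /rootP/factor_theorem[q ->]; exists q; rewrite subr0.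
move=> /divX[f0 f0E] /divX[f1 f1E].
pose G := \poly_(i < size F) F`_i.+2.
have FE : F = (G * 'X + (f1 * 'X)%:P) * 'X + (f0 * 'X)%:P.
  apply/polyP => -[|[|i]]; rewrite !(coefD, coefMX, coefC) /= ?add0r ?addr0 //.
  rewrite coef_poly; case: ltnP => // h.
  by rewrite nth_default // (leq_trans h) // -addn2 leq_addr.
pose n1 := map_poly (pn 1) G.
pose K := (n1^`()).[1] + 2 * n1.[1].
have K1_ge0 : 0 <= (n1^`()).[1].
  apply: (@horner_deriv_map_ge0 _ _ (pn 1)) => //.
  - exact: pn0.
  - by move=> x; exact: pn_ge0.
have K2_ge0 : 0 <= n1.[1].
  apply: (@horner_map_ge0 _ _ (pn 1)) => //.
  - exact: pn0.
  - by move=> x; exact: pn_ge0.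
have K_ge0 : 0 <= K by rewrite /K; lra.
pose delta : R := (4 * (K + 1))^-1.
have d0 : 0 < delta by rewrite invr_gt0; lra.
have dK : delta * K <= 1 / 4.
  rewrite /delta mulrC ler_pdivrMr; last by lra.
  by lra.
have d1 : delta <= 1 by rewrite invf_le1; lra.
pose K0 := pn 1 f0; pose K1 := pn 1 f1.
have K00 : 0 <= K0 by exact: pn_ge0.
have K10 : 0 <= K1 by exact: pn_ge0.
pose M := 4 * (K0 + K1 + 1) / delta.
have M0 : 0 < M by rewrite divr_gt0 //; lra.
pose rho := M^-1.
have rho0 : 0 < rho by rewrite invr_gt0.
have Md : 4 * (K0 + K1 + 1) <= M.
  by rewrite ler_pdivlMr // ler_piMr //; lra.
have rho1 : rho <= 1 by rewrite invf_le1 //; lra.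
have r0 := ltW rho0.
exists delta, rho; split=> //.
  rewrite f0E pnMX; apply: le_trans (_ : K0 * rho <= _).
    by rewrite ler_wpM2r // pn_le.
  rewrite /rho /M invf_div mulrCA ler_wpM2l ?(ltW d0) //.
  rewrite ler_pdivrMr; last by lra.
  by lra.
rewrite FE !map_polyMXC ?pn0 // !(derivD, derivM, derivC, derivX).
rewrite !mulr1 !addr0 !(hornerD, hornerM, hornerC, hornerX) pnMX.
set g := (map_poly (pn rho) G).[delta].
set g' := ((map_poly (pn rho) G)^`()).[delta].
have coef_le i : (map_poly (pn rho) G)`_i <= n1`_i.
  by rewrite !coef_map_id0 ?pn0 // pn_le.
have mono (p : {poly R}) : (forall i, 0 <= p`_i) -> p.[delta] <= p.[1].
  move=> p0; rewrite !horner_coef; apply: ler_sum => i _.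
  by rewrite ler_wpM2l // expr1n exprn_ile1 // ltW.
have n1_ge0 i : 0 <= n1`_i by rewrite coef_map_id0 ?pn0 // pn_ge0.
have gle : g <= n1.[1].
  by apply: le_trans (mono _ n1_ge0); apply: horner_le_coef => //; exact: ltW.
have g'le : g' <= (n1^`()).[1].
  apply: le_trans (mono _ _); first by apply: horner_deriv_le_coef => //; exact: ltW.
  by move=> i; rewrite coef_deriv mulrn_wge0.
have g0 : 0 <= g.
  apply: horner_map_ge0 => //; [exact: pn0|by move=> x; exact: pn_ge0|exact: ltW].
have g'0 : 0 <= g'.
  apply: horner_deriv_map_ge0 => //; [exact: pn0|by move=> x; exact: pn_ge0|exact: ltW].
have -> : (g' * delta + g) * delta + (g * delta + pn rho f1 * rho) =
   delta * (g' * delta + 2 * g) + pn rho f1 * rho by ring.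
have h1 : pn rho f1 * rho <= 1 / 4.
  apply: le_trans (_ : K1 * rho <= _).
    by rewrite ler_wpM2r // pn_le.
  rewrite /rho ler_pdivrMr //; lra.
have h2 : delta * (g' * delta + 2 * g) <= delta * K.
  have h3 : g' * delta <= (n1^`()).[1] by apply: le_trans g'le; rewrite ler_piMr.
  by rewrite ler_pM2l // /K lerD // ler_pM2l.
by lra.
Qed.

Lemma dvdpX0 (p : {poly C}) : ('X %| p) = (p.[0] == 0).
Proof. by rewrite -['X]subr0 dvdp_XsubCl rootE. Qed.

Lemma dvdp_horner_sub (F : {poly {poly C}}) (x y : {poly C}) :
  x - y %| F.[x] - F.[y].
Proof.
elim/poly_ind: F => [|F c IH]; first by rewrite !horner0 subrr dvdp0.
rewrite !hornerMXaddC.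
have -> : F.[x] * x + c - (F.[y] * y + c) =
    (F.[x] - F.[y]) * x + F.[y] * (x - y) by ring.
by apply: dvdp_add; [exact: dvdp_mulr | exact: dvdp_mull].
Qed.

(** On multiples of X the map is also an X-adic contraction: in F(x) - F(y) every cofactor of x - y
    is divisible by X. *)
Lemma picard_adic F : (F`_0).[0] = 0 -> (F`_1).[0] = 0 ->
  forall m, 'X %| iter m (horner F) 0 /\
    'X^(m.+1) %| iter m.+1 (horner F) 0 - iter m (horner F) 0.
Proof.
move=> F0 F1; pose G := \poly_(i < size F) F`_i.+2.
have FE y : F.[y] = (G.[y] * y + F`_1) * y + F`_0.
  rewrite -!hornerMXaddC; congr horner; apply/polyP => -[|[|i]].
  - by rewrite coefD coefMX coefC /= add0r.
  - by rewrite !(coefD, coefMX, coefC) /= add0r addr0.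
  rewrite !(coefD, coefMX, coefC) /= !addr0 coef_poly; case: ltnP => // h.
  by rewrite nth_default // (leq_trans h) // -addn2 leq_addr.
have F0X : 'X %| F`_0 by rewrite dvdpX0 F0.
have F1X : 'X %| F`_1 by rewrite dvdpX0 F1.
have hX m : 'X %| iter m (horner F) 0.
  elim: m => [|m IH]; first exact: dvdp0.
  by rewrite iterS FE; apply: dvdp_add => //; exact: dvdp_mull.
have step x y : 'X %| x -> 'X %| y -> 'X * (x - y) %| F.[x] - F.[y].
  move=> xX yX; rewrite !FE.
  have -> : (G.[x] * x + F`_1) * x + F`_0 - ((G.[y] * y + F`_1) * y + F`_0) =
      x * x * (G.[x] - G.[y]) + (G.[y] * (x + y) + F`_1) * (x - y) by ring.
  apply: dvdp_add; first by apply: dvdp_mul;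
    [exact: dvdp_mulr | exact: dvdp_horner_sub].
  apply: dvdp_mul => //; apply: dvdp_add => //; apply: dvdp_mull.
  exact: dvdp_add.
elim=> [|m [_ IH]]; split=> //.
  by rewrite /= subr0 expr1 horner_coef0.
rewrite [X in X - _]iterS [X in _ - X]iterS; apply: dvdp_trans (step _ _ (hX _) (hX _)).
by rewrite exprS dvdp_mul.
Qed.

(* Newton's iteration with frozen derivative, started at the simple root 1 of
   [H(0, -)]; it stays inside the polynomials in [v]. *)
Lemma hensel H : (H.[1]).[0] = 0 -> (H^`().[1]).[0] != 0 ->
  exists delta rho : R, exists e : nat -> {poly C},
  [/\ 0 < delta /\ 0 < rho,
   (forall m, pn rho (e m) <= delta),
   (forall m, 'X %| e m /\ 'X^(m.+1) %| e m.+1 - e m),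
   (forall m, 'X^(m.+1) %| H.[1 + e m]) &
   (forall v z, cm v <= rho -> cm z <= delta -> H.[(1 + z)%:P].[v] = 0 ->
     forall m, cm ((e m).[v] - z) <= delta / 2 ^+ m)].
Proof.
move=> H0; set mu := _.[0] => mu0.
have [F [FE F0E F1E]] := newton_map H (mu^-1)%:P.
have F0 : (F`_0).[0] = 0 by rewrite F0E hornerN hornerM H0 mulr0 oppr0.
have F1 : (F`_1).[0] = 0.
  by rewrite F1E hornerD hornerN hornerM !hornerC -/mu mulVf // subrr.
have [delta [rho [d0 r0 c0 cL]]] := picard_constants F0 F1.
have r0' := ltW r0; have d0' := ltW d0.
exists delta, rho, (fun m => iter m (horner F) 0); split=> //.
- apply: picard_bound => //.
  + exact: pn0.
  + by move=> x; exact: pn_ge0.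
  + by move=> x y; exact: pnD.
  + by move=> x y; exact: pnM.
- exact: picard_adic.
- move=> m; have [_] := picard_adic F0 F1 m.
  rewrite iterS FE addrAC subrr sub0r dvdpNr mul_polyC dvdpZr //.
  by rewrite invr_eq0.
- move=> v z vr zd Hz m.
  (* Evaluation at [v] turns the iteration over polynomials into one over the complex numbers, whose
     majorant is bounded coefficientwise by the one already estimated. *)
  pose Fv := map_poly (horner_eval v) F.
  have FvE (x : {poly C}) :
    Fv.[x.[v]] = F.[x].[v] by rewrite -[RHS](horner_map (horner_eval v)).
  have -> : (iter m (horner F) 0).[v] = iter m (horner Fv) 0.
    by elim: m => [|m IH] /=; rewrite ?horner0 // -FvE IH.
  have le i : (map_poly (@cm R) Fv)`_i <= (map_poly (pn rho) F)`_i.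
    rewrite !coef_map_id0 ?pn0 ?cm0 //; first exact: cm_horner_le.
    by rewrite /horner_eval horner0.
  apply: picard_cvg => //.
  + exact: cm0.
  + exact: cm_ge0.
  + exact: cmD.
  + by move=> x y; rewrite cmM.
  + by apply: le_trans c0; rewrite coef_map; exact: cm_horner_le.
  + by apply: le_trans cL; apply: horner_deriv_le_coef.
  + rewrite -{2}[z](hornerC z v) -{1}[z](hornerC z v) FvE FE hornerD hornerN
    hornerM -polyCD.
    by rewrite Hz mulr0 subr0.
  + exact: cmN.
Qed.
End Hensel.

(** * Continuity and roots of complex numbers *)

Lemma locally_constant_connected (T : topologicalType) (A : set T) (P : T -> Prop) :
  connected A ->
  (forall x, A x -> \forall y \near x, A y -> (P x <-> P y)) ->
  forall x y, A x -> A y -> P x -> P y.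
Proof.
move=> cA lP x y Ax Ay Px.
have E : A `&` [set z | P z] = A.
  apply: cA; first by exists x.
  - exists (interior [set z | A z -> P z]); first exact: open_interior.
    apply/seteqP; split=> z [Az].
      move=> Pz; split=> //; have := lP z Az; rewrite /interior /=.
      by apply: filterS => w H /H[h _]; exact: h.
    by move=> /interior_subset H; split=> //; exact: H.
  - exists (~` interior [set z | A z -> ~ P z]).
      by apply: open_closedC; exact: open_interior.
    apply/seteqP; split=> z [Az].
      by move=> Pz; split=> // /interior_subset; exact.
    move=> nH; split=> //=; apply: contrapT => nPz; apply: nH.
    have := lP z Az; rewrite /interior /=.
    by apply: filterS => w H /H[_ h] /h.
by have [] : (A `&` [set z | P z]) y by rewrite E.
Qed.

Section Topology.
Variable R : realType.
Local Notation C := (cplx R).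

Lemma nbhs_cm (z : C) (P : set C) : nbhs z P <->
  exists2 e : R, 0 < e & forall w, cm (w - z) < e -> P w.
Proof.
split.
  move=> /nbhs_ballP[e /= e0 eP]; have eE : e = rc (complex.Re e).
    by have := RRe_real (gtr0_real e0) => /= {1}<-.
  exists (complex.Re e); first by move: e0; rewrite eE ltcR.
  move=> w wz; apply: eP; rewrite -ball_normE /= cmE cmBC eE.
  by rewrite /rc ltcR.
move=> [e e0 eP]; apply/nbhs_ballP; exists (rc e); first by rewrite /= /rc ltcR.
move=> w; rewrite -ball_normE /= cmE cmBC /rc ltcR; exact: eP.
Qed.

Lemma nbhs_dist (x : R) (P : set R) : nbhs x P <->
  exists2 e : R, 0 < e & forall y, `|y - x| < e -> P y.
Proof.
split.
  move=> /nbhs_ballP[e /= e0 eP]; exists e => // y yx; apply: eP.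
  by rewrite -ball_normE /= distrC.
move=> [e e0 eP]; apply/nbhs_ballP; exists e => // y.
by rewrite -ball_normE /= distrC; exact: eP.
Qed.

Definition cont_on (a b : R) (f : R -> C) : Prop :=
  forall s, a <= s <= b -> forall e : R, 0 < e -> exists2 d : R, 0 < d &
    forall t, a <= t <= b -> `|t - s| < d -> cm (f t - f s) < e.

Lemma within_cont_on a b (f : R -> C) :
  {within `[a, b], continuous f} -> cont_on a b f.
Proof.
move=> /subspace_continuousP cf s sab e e0.
have /cf : [set` `[a, b]] s by rewrite /= in_itv.
move=> /(_ [set w | cm (w - f s) < e]) /=.
have /[swap]/[apply] : nbhs (f s) [set w | cm (w - f s) < e] by apply/nbhs_cm; exists e.
move=> /nbhs_dist[d d0 dP]; exists d => // t tab ts.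
by apply: dP => //=; rewrite in_itv.
Qed.

Lemma cont_on_cm a b (f : R -> C) : cont_on a b f ->
  {within `[a, b], continuous (fun t => cm (f t))}.
Proof.
move=> cf; apply/subspace_continuousP => s; rewrite /= in_itv /= => sab.
apply/cvgrPdist_lt => e e0; have [d d0 dP] := cf s sab e e0.
apply/nbhs_dist; exists d => // t ts; rewrite /= in_itv /= => tab.
apply: le_lt_trans _ (dP t tab ts); rewrite ler_norml.
have := cm_rtri (f t) (f s); have := cm_rtri (f s) (f t).
rewrite (cmBC (f s)) => h1 h2; rewrite /from_subspace; apply/andP; split; lra.
Qed.

Lemma cont_on_min a b (f : R -> C) : a <= b -> cont_on a b f ->
  (forall s, a <= s <= b -> f s != 0) ->
  exists2 m : R, 0 < m & forall s, a <= s <= b -> m <= cm (f s).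
Proof.
move=> ab /cont_on_cm cf f0; have [c cab cP] := EVT_min ab cf.
move: cab; rewrite in_itv /= => cab; exists (cm (f c)).
  by rewrite cm_gt0 f0.
by move=> s sab; apply: cP; rewrite in_itv.
Qed.

Lemma cont_on_max a b (f : R -> C) : a <= b -> cont_on a b f ->
  exists2 m : R, 0 < m & forall s, a <= s <= b -> cm (f s) <= m.
Proof.
move=> ab /cont_on_cm cf; have [c cab cP] := EVT_max ab cf.
exists (cm (f c) + 1); first by have := cm_ge0 (f c); lra.
by move=> s sab; have := cP s; rewrite in_itv => /(_ sab); lra.
Qed.

Lemma cont_on_sub a b c d (f : R -> C) : a <= c -> d <= b ->
  cont_on a b f -> cont_on c d f.
Proof.
move=> ac db cf s scd e e0; have [|r r0 rP] := cf s _ e e0; first by lra.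
by exists r => // t tcd; apply: rP; lra.
Qed.

Lemma cont_on_cst a b (c : C) : cont_on a b (fun=> c).
Proof. by move=> s _ e e0; exists 1 => // t _ _; rewrite subrr cm0. Qed.

Lemma cont_onD a b (f g : R -> C) : cont_on a b f -> cont_on a b g ->
  cont_on a b (fun t => f t + g t).
Proof.
move=> cf cg s sab e e0; have e2 : 0 < e / 2 by lra.
have [d1 d10 d1P] := cf s sab _ e2; have [d2 d20 d2P] := cg s sab _ e2.
exists (Num.min d1 d2); first by rewrite lt_min d10.
move=> t tab; rewrite lt_min => /andP[t1 t2].
have -> : f t + g t - (f s + g s) = (f t - f s) + (g t - g s) by ring.
by have := cmD (f t - f s) (g t - g s); have := d1P t tab t1; have := d2P t tab t2; lra.
Qed.

Lemma cont_onM a b (f g : R -> C) : cont_on a b f -> cont_on a b g ->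
  cont_on a b (fun t => f t * g t).
Proof.
move=> cf cg s sab e e0; pose K := cm (f s) + cm (g s) + 1.
have K0 : 0 < K by rewrite /K; have := cm_ge0 (f s); have := cm_ge0 (g s); lra.
have e1 : 0 < Num.min 1 (e / (2 * K)) by rewrite lt_min ltr01 divr_gt0 // mulr_gt0.
have [d1 d10 d1P] := cf s sab _ e1; have [d2 d20 d2P] := cg s sab _ e1.
exists (Num.min d1 d2); first by rewrite lt_min d10.
move=> t tab; rewrite lt_min => /andP[/(d1P _ tab) + /(d2P _ tab)].
rewrite !lt_min => /andP[_ h1] /andP[h3 h2].
have -> : f t * g t - f s * g s = (f t - f s) * g t + f s * (g t - g s) by ring.
have gt : cm (g t) <= cm (g s) + 1 by have := cm_rtri (g t) (g s); lra.
apply: le_lt_trans (cmD _ _) _; rewrite !cmM.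
have H1 : cm (f t - f s) * cm (g t) <= e / (2 * K) * (cm (g s) + 1).
  by rewrite ler_pM ?cm_ge0 // ltW.
have H2 : cm (f s) * cm (g t - g s) <= cm (f s) * (e / (2 * K)).
  by rewrite ler_wpM2l ?cm_ge0 // ltW.
apply: le_lt_trans (lerD H1 H2) _.
have -> : e / (2 * K) * (cm (g s) + 1) + cm (f s) * (e / (2 * K)) = e / 2.
  rewrite [cm (f s) * _]mulrC -mulrDr (_ : _ + cm (f s) = K); last by rewrite /K; ring.
  by field; rewrite gt_eqF.
by lra.
Qed.

Lemma cont_on_poly a b (f : R -> C) (p : {poly C}) : cont_on a b f ->
  cont_on a b (fun t => p.[f t]).
Proof.
move=> cf; elim/poly_ind: p => [|p c IH].
  by move=> s _ e e0; exists 1 => // t _ _; rewrite !horner0 subrr cm0.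
have := cont_onD (cont_onM IH cf) (@cont_on_cst a b c).
move=> H s sab e e0; have [d d0 dP] := H s sab e e0; exists d => // t tab td.
by rewrite !hornerMXaddC; exact: dP.
Qed.

Lemma small_near_ends (f : R -> C) (r h : R) : cont_on 0 1 f -> f 0 = 0 -> f 1 = 0 ->
  0 < r -> 0 < h -> exists eta : R, [/\ 0 < eta, eta <= h, eta + eta < 1 &
    forall s, 0 <= s <= 1 -> (s <= eta) || (1 - eta <= s) -> cm (f s) <= r].
Proof.
move=> cf f0 f1 r0 h0.
have [|a a0 aP] := cf 0 _ r r0; first by lra.
have [|b b0 bP] := cf 1 _ r r0; first by lra.
rewrite f0 in aP; rewrite f1 in bP.
pose m := Num.min (Num.min a b) (Num.min h 1).
have m0 : 0 < m by rewrite !lt_min a0 b0 h0 ltr01.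
have ma : m <= a by rewrite !ge_min lexx.
have mb : m <= b by rewrite !ge_min lexx orbT.
have mh : m <= h by rewrite !ge_min lexx !orbT.
have m1 : m <= 1 by rewrite !ge_min lexx !orbT.
exists (m / 3); split; [lra | lra | lra |].
move=> s s01 /orP[sm|sm]; apply: ltW; rewrite -[f s]subr0.
  by apply: aP => //; rewrite subr0 ger0_norm; lra.
by apply: bP => //; rewrite distrC ger0_norm; lra.
Qed.

Lemma interval_locally_constant (a b : R) (P : R -> Prop) :
  (forall s, a <= s <= b -> exists2 d : R, 0 < d &
     forall t, a <= t <= b -> `|t - s| < d -> (P s <-> P t)) ->
  forall s t, a <= s <= b -> a <= t <= b -> P s -> P t.
Proof.
move=> lP s t sab tab; have := @locally_constant_connected R `[a, b]%classic P.
move=> /(_ (@segment_connected R a b)) H; apply: H; rewrite /= ?in_itv //.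
move=> x; rewrite /= in_itv /= => xab; have [d d0 dP] := lP x xab.
apply/nbhs_dist; exists d => // y yx; rewrite /= in_itv /= => yab.
exact: dP.
Qed.

End Topology.

(** * Nearby roots and continuous branches of roots *)

Section Roots.
Variable R : realType.
Local Notation C := (cplx R).
Implicit Types (x y z c w : C).

Lemma root_exists n c : (0 < n)%N -> exists w, w ^+ n = c.
Proof.
move=> n0; have sz : size ('X^n - c%:P) = n.+1 by rewrite size_XnsubC.
have /closed_rootP[w] : size ('X^n - c%:P) != 1 by rewrite sz; case: n n0 {sz}.
by move=> /rootP; rewrite hornerD hornerN hornerXn hornerC => /subr0_eq; exists w.
Qed.

(** |x^n - c| is the product of the n distances from x to the roots, so the smallest distance,
    raised to the power n, does not exceed it. *)
Lemma close_root n c x : (0 < n)%N ->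
  exists2 w, w ^+ n = c & cm (x - w) ^+ n <= cm (x ^+ n - c).
Proof.
move=> n0; have [r rE] := closed_field_poly_normal ('X^n - c%:P).
move: rE; have /monicP-> := monicXnsubC c n0; rewrite scale1r => rE.
have sr : size r = n.
  have := congr1 (fun p : {poly C} => size p) rE.
  by rewrite size_XnsubC // size_prod_XsubC => -[].
have rootr z : z \in r -> z ^+ n = c.
  rewrite -root_prod_XsubC -rE => /rootP.
  by rewrite hornerD hornerN hornerXn hornerC => /subr0_eq.
apply: contrapT => H.
have lt z : z \in r -> cm (x ^+ n - c) < cm (x - z) ^+ n.
  by move=> zr; rewrite ltNge; apply/negP => le; apply: H; exists z => //; exact: rootr.
have E : cm (x ^+ n - c) = \prod_(z <- r) cm (x - z).
  have -> : x ^+ n - c = \prod_(z <- r) (x - z).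
    have := congr1 (fun p : {poly C} => p.[x]) rE.
    rewrite hornerD hornerN hornerXn hornerC => ->; rewrite horner_prod.
    by apply: eq_bigr => z _; rewrite hornerXsubC.
  by elim: (r) => [|z r' IH]; rewrite ?big_nil ?cm1 // !big_cons cmM IH.
have : \prod_(z <- r) cm (x ^+ n - c) < \prod_(z <- r) (cm (x - z) ^+ n).
  rewrite big_seq [X in _ < X]big_seq; apply: ltr_prod.
    by case: (r) sr n0 => [<-//|z r' _ _]; rewrite /= inE eqxx.
  by move=> z zr; rewrite cm_ge0 lt.
by rewrite big_const_seq count_predT sr iter_mulr_1 prodrXl -E ltxx.
Qed.

Lemma root_separation n c : (0 < n)%N -> exists2 d : R, 0 < d &
  forall w w', w ^+ n = c -> w' ^+ n = c -> cm (w - w') < d -> w = w'.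
Proof.
move=> n0; have [r rE] := closed_field_poly_normal ('X^n - c%:P).
move: rE; have /monicP-> := monicXnsubC c n0; rewrite scale1r => rE.
have rootr w : w ^+ n = c -> w \in r.
  move=> wc; rewrite -root_prod_XsubC -rE; apply/rootP.
  by rewrite hornerD hornerN hornerXn hornerC wc subrr.
have sep1 w (s : seq C) : exists2 d :
  R, 0 < d & forall w', w' \in s -> cm (w - w') < d -> w = w'.
  elim: s => [|z s [d d0 IH]]; first by exists 1.
  have [wz|wz] := eqVneq w z.
    by subst z; exists d => // w'; rewrite inE => /orP[/eqP->//|]; exact: IH.
  exists (Num.min d (cm (w - z))); first by rewrite lt_min d0 cm_gt0 subr_eq0.
  move=> w'; rewrite inE lt_min => /orP[/eqP->|w's] /andP[h1 h2].
    by rewrite ltxx in h2.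
  exact: IH.
have sep (s : seq C) : exists2 d :
  R, 0 < d & forall w w', w \in s -> w' \in r -> cm (w - w') < d -> w = w'.
  elim: s => [|z s [d d0 IH]]; first by exists 1.
  have [d' d'0 d'P] := sep1 z r.
  exists (Num.min d d'); first by rewrite lt_min d0.
  move=> w w'; rewrite inE lt_min => /orP[/eqP->|ws] w'r /andP[h1 h2].
    exact: d'P.
  exact: IH.
have [d d0 dP] := sep r; exists d => // w w' /rootr wr /rootr w'r.
exact: dP.
Qed.

(** Each value of [f] stays within a third of the root separation of some n-th root of [c]; by
    continuity that root cannot change along the interval. *)
Lemma root_follow n c (e : R) : (0 < n)%N -> 0 < e ->
  exists2 d : R, 0 < d & forall (a b : R) (f : R -> C), cont_on a b f ->
    (forall s, a <= s <= b -> cm (f s ^+ n - c) <= d) ->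
    forall s t, a <= s <= b -> a <= t <= b -> cm (f s - f t) <= e.
Proof.
move=> n0 e0; have [d0 d00 sep] := root_separation c n0.
pose h := Num.min (e / 2) (d0 / 3).
have h0 : 0 < h by rewrite lt_min !divr_gt0.
have he : h <= e / 2 by rewrite ge_min lexx.
have hd : h <= d0 / 3 by rewrite ge_min lexx orbT.
exists (h ^+ n); first exact: exprn_gt0.
move=> a b f cf fc s t sab tab.
have near s' : a <= s' <= b -> exists2 w, w ^+ n = c & cm (f s' - w) <= h.
  move=> /fc; have [w wc le] := close_root c (f s') n0.
  move=> /(le_trans le); rewrite ler_pXn2r ?nnegrE ?cm_ge0 ?(ltW h0) //.
  by exists w.
have [w wc sw] := near s sab.
have : cm (f t - w) <= h.
  apply: (interval_locally_constant (P := fun s => cm (f s - w) <= h) _ sab tab sw).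
  move=> x xab; have [//|d d_gt0 dP] := cf x xab (d0 / 3); first by rewrite divr_gt0.
  exists d => // y yab yx; have fyx := dP y yab yx.
  have [v vc xv] := near x xab; have [u uc yu] := near y yab.
  have uv : u = v.
    apply: sep => //; have := cm_tri u (f y) v; have := cm_tri (f y) (f x) v.
    rewrite (cmBC u (f y)); lra.
  subst u; split=> le.
    have -> // : w = v; apply: sep => //; have := cm_tri w (f x) v.
    by rewrite (cmBC w (f x)); lra.
  have -> // : w = v; apply: sep => //; have := cm_tri w (f y) v.
  by rewrite (cmBC w (f y)); lra.
by have := cm_tri (f s) w (f t); rewrite (cmBC w); lra.
Qed.

End Roots.

(** * Uniform algebra generated by a path *)

Lemma half_pow_small (R : realType) (d e : R) : 0 < e -> exists m, d / 2 ^+ m <= e.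
Proof.
move=> e0; have [m mP] : exists m, d / e < m%:R.
  exists (Num.bound `|d / e|); apply: le_lt_trans (ler_norm _) _.
  exact: archi_boundP.
exists m; rewrite ler_pdivrMr ?exprn_gt0 //.
move: mP; rewrite ltr_pdivrMr // => /ltW h; apply: le_trans h _.
rewrite mulrC ler_wpM2l ?(ltW e0) // -natrX ler_nat ltnW //.
exact: ltn_expl.
Qed.

Section UniformAlgebra.
Variable R : realType.
Local Notation C := (cplx R).
Variable g : R -> C.
Hypothesis g_cont : cont_on 0 1 g.
Implicit Types (f h r v : R -> C).

Definition Afun f := forall e : R, 0 < e ->
  exists p : {poly C}, forall s, 0 <= s <= 1 -> cm (f s - p.[g s]) <= e.

Lemma Afun_lim f : (forall e : R, 0 < e -> exists2 h, Afun h &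
  forall s, 0 <= s <= 1 -> cm (f s - h s) <= e) -> Afun f.
Proof.
move=> H e e0; have e2 : 0 < e / 2 by lra.
have [h Ah fh] := H _ e2; have [p ph] := Ah _ e2; exists p => s s01.
by have := cm_tri (f s) (h s) p.[g s]; have := fh s s01; have := ph s s01; lra.
Qed.

Lemma Afun_ext f h : (forall s, 0 <= s <= 1 -> f s = h s) -> Afun f -> Afun h.
Proof.
move=> fh Af; apply: Afun_lim => e e0; exists f => // s s01.
by rewrite fh // subrr cm0 ltW.
Qed.

Lemma Afun_bounded f : Afun f ->
  exists2 B : R, 0 < B & forall s, 0 <= s <= 1 -> cm (f s) <= B.
Proof.
move=> /(_ 1 ltr01)[p pf].
have [m m0 mP] := cont_on_max ler01 (cont_on_poly p g_cont).
exists (m + 1) => [|s s01]; first by lra.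
have := pf s s01; have := cm_rtri (f s) p.[g s]; have := mP s s01; lra.
Qed.

Lemma Afun_cst (c : C) : Afun (fun=> c).
Proof. by move=> e e0; exists c%:P => s _; rewrite hornerC subrr cm0 ltW. Qed.

Lemma Afun_id : Afun g.
Proof. by move=> e e0; exists 'X => s _; rewrite hornerX subrr cm0 ltW. Qed.

Lemma AfunD f h : Afun f -> Afun h -> Afun (fun s => f s + h s).
Proof.
move=> Af Ah e e0; have e2 : 0 < e / 2 by lra.
have [p pf] := Af _ e2; have [q qh] := Ah _ e2; exists (p + q) => s s01.
rewrite hornerD (_ : _ - _ = (f s - p.[g s]) + (h s - q.[g s])); last by ring.
by have := cmD (f s - p.[g s]) (h s - q.[g s]); have := pf s s01; have := qh s s01; lra.
Qed.

Lemma AfunM f h : Afun f -> Afun h -> Afun (fun s => f s * h s).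
Proof.
move=> Af Ah e e0.
have [Bh Bh0 BhP] := Afun_bounded Ah.
have e1 : 0 < e / (2 * Bh) by rewrite divr_gt0 // mulr_gt0.
have [p pf] := Af _ e1.
have [Bp Bp0 BpP] := cont_on_max ler01 (cont_on_poly p g_cont).
have e2 : 0 < e / (2 * Bp) by rewrite divr_gt0 // mulr_gt0.
have [q qh] := Ah _ e2; exists (p * q) => s s01.
rewrite hornerM.
have -> : f s * h s - p.[g s] * q.[g s] =
  (f s - p.[g s]) * h s + p.[g s] * (h s - q.[g s]) by ring.
apply: le_trans (cmD _ _) _; rewrite !cmM.
have H1 : cm (f s - p.[g s]) * cm (h s) <= e / (2 * Bh) * Bh.
  by rewrite ler_pM ?cm_ge0 ?pf ?BhP.
have H2 : cm p.[g s] * cm (h s - q.[g s]) <= Bp * (e / (2 * Bp)).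
  by rewrite ler_pM ?cm_ge0 ?qh ?BpP.
apply: le_trans (lerD H1 H2) _.
have -> : e / (2 * Bh) * Bh + Bp * (e / (2 * Bp)) = e; last by [].
by field; rewrite !gt_eqF.
Qed.

Lemma AfunX f n : Afun f -> Afun (fun s => f s ^+ n).
Proof.
move=> Af; elim: n => [|n IH].
  by apply: Afun_ext (Afun_cst 1) => s _; rewrite expr0.
by apply: Afun_ext (AfunM Af IH) => s _; rewrite exprS.
Qed.

Lemma AfunB f h : Afun f -> Afun h -> Afun (fun s => f s - h s).
Proof.
move=> Af Ah; apply: Afun_ext (AfunD Af (AfunM (Afun_cst (-1)) Ah)) => s _.
by rewrite mulN1r.
Qed.

Lemma Afun_poly f (p : {poly C}) : Afun f -> Afun (fun s => p.[f s]).
Proof.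
move=> Af; elim/poly_ind: p => [|p c IH].
  by apply: Afun_ext (Afun_cst 0) => s _; rewrite horner0.
apply: Afun_ext (AfunD (AfunM IH Af) (Afun_cst c)) => s _.
by rewrite hornerMXaddC.
Qed.

(** Polynomials in [g] close up with the curve, and uniform limits inherit this. In particular a
    root found in the algebra returns to its initial branch. *)
Lemma Afun_ends f : g 0 = g 1 -> Afun f -> f 0 = f 1.
Proof.
move=> g01 Af; apply/eqP; rewrite -subr_eq0 -cm_eq0; apply/negP => /negP h.
have e0 : 0 < cm (f 0 - f 1) / 3 by rewrite divr_gt0 // lt_neqAle cm_ge0 eq_sym h.
have [p pf] := Af _ e0.
have := pf 0; have := pf 1; rewrite !lexx ler01 g01 => /(_ isT) h1 /(_ isT) h0.
have := cm_tri (f 0) p.[g 1] (f 1); rewrite (cmBC p.[g 1]); lra.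
Qed.

Lemma Afun_cont f : Afun f -> cont_on 0 1 f.
Proof.
move=> Af s s01 e e0; have e4 : 0 < e / 4 by lra.
have [p pf] := Af _ e4.
have [d d0 dP] := cont_on_poly p g_cont s01 e4; exists d => // t t01 ts.
have := cm_tri (f t) p.[g t] (f s); have := cm_tri p.[g t] p.[g s] (f s).
have := pf t t01; have := pf s s01; have := dP t t01 ts.
rewrite (cmBC p.[g s] (f s)); lra.
Qed.

(** Hensel's lemma for (1 + u) w^M = 1 at w = 1: the iterates are polynomials in u, so substituting
    a small [v] from the algebra stays in the algebra. *)
Lemma inverse_root_near1 M : (0 < M)%N -> exists2 rho : R, 0 < rho &
  forall v, Afun v -> (forall s, 0 <= s <= 1 -> cm (v s) <= rho) ->
  exists2 z, Afun z & forall s, 0 <= s <= 1 -> z s ^+ M * (1 + v s) = 1.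
Proof.
move=> M0; pose H : {poly {poly C}} := (1 + 'X) *: 'X^M - 1%:P.
have HE (w u : C) : H.[w%:P].[u] = (1 + u) * w ^+ M - 1.
  rewrite /H hornerD hornerN hornerZ hornerXn hornerC hornerD hornerN hornerM.
  by rewrite hornerD hornerX !hornerC -polyC_exp hornerC.
have H1 : (H.[1]).[0] = 0 by rewrite HE addr0 mul1r expr1n subrr.
have dH : H^`().[1] = (1 + 'X) * M%:R.
  rewrite /H derivB derivC subr0 derivZ derivXn hornerZ hornerMn hornerXn expr1n.
  by [].
have H'1 : (H^`().[1]).[0] != 0.
  rewrite dH hornerM hornerD hornerX hornerC addr0 mul1r.
  by rewrite -polyC_natr hornerC pnatr_eq0 -lt0n.
have [delta [rho [e [[d0 r0] _ _ _ cvg]]]] := hensel H1 H'1.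
(* The bounds keep [v] in the range of Hensel's lemma, |1 + v| at least 1/2, and the inverse of 1 +
   v within delta^M of 1, so that it has an M-th root within [delta] of 1. *)
pose rho' := Num.min (Num.min rho (1 / 2)) (delta ^+ M / 2).
have rho'0 : 0 < rho' by rewrite !lt_min r0 !divr_gt0 ?exprn_gt0.
exists rho' => // v Av vle.
have zex s : exists z, 0 <= s <= 1 -> [/\ cm z <= delta & (1 + z) ^+ M * (1 + v s) = 1].
  have [s01|ns] := pselect (0 <= s <= 1); last by exists 0.
  have := vle s s01; rewrite !le_min => /andP[/andP[v1 v2] v3].
  have w1 : 1 / 2 <= cm (1 + v s).
    by have := cm_rtri 1 (- v s); rewrite opprK cmN cm1; lra.
  have w0 : 1 + v s != 0 by rewrite -cm_gt0; lra.
  have [w wE wle] := close_root (1 + v s)^-1 1 M0.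
  exists (w - 1) => _; split; last by rewrite addrC subrK wE mulVf.
  rewrite cmBC -(ler_pXn2r M0) ?nnegrE ?cm_ge0 ?(ltW d0) //.
  apply: le_trans wle _; rewrite expr1n.
  have -> : 1 - (1 + v s)^-1 = v s / (1 + v s) by field; rewrite w0.
  rewrite cmM cmV ler_pdivrMr; last by lra.
  apply: le_trans v3 _; rewrite ler_wpM2l ?exprn_ge0 ?(ltW d0) //; lra.
pose z s := sval (cid (zex s)).
have zP s : 0 <= s <= 1 -> [/\ cm (z s) <= delta & (1 + z s) ^+ M * (1 + v s) = 1].
  exact: (svalP (cid (zex s))).
exists (fun s => 1 + z s); last by move=> s /zP[].
apply: Afun_lim => eps eps0.
have [m mP] := half_pow_small delta eps0.
exists (fun s => 1 + (e m).[v s]); first exact: AfunD (Afun_cst 1) (Afun_poly _ Av).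
move=> s s01; have [zd zE] := zP s s01.
rewrite opprD addrACA subrr add0r cmBC; apply: le_trans mP.
apply: cvg => //; last by rewrite HE mulrC zE subrr.
by have := vle s s01; rewrite !le_min => /andP[/andP[]].
Qed.

(** For M = 1 this is invertibility of [f] in the algebra. In general f r^(M-1) is then an M-th root
    of [f], itself invertible with inverse [r]. *)
Definition has_inverse_root M f :=
  exists2 r, Afun r & forall s, 0 <= s <= 1 -> r s ^+ M * f s = 1.

Section Shifts.
Variables (om : R -> C) (M : nat).
Hypothesis Aom : Afun om.
Hypothesis M0 : (0 < M)%N.
Let V (tau : C) := has_inverse_root M (fun s => om s - tau).

(** Runge's pole pushing: om - tau' = (om - tau)(1 + (tau - tau') r^M), where r^M = 1/(om - tau),
    and the last factor is close to 1. *)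
Lemma inverse_root_step : exists2 rho : R, 0 < rho & forall tau tau' (d : R), 0 < d ->
  (forall s, 0 <= s <= 1 -> d <= cm (om s - tau)) -> cm (tau - tau') <= rho * d ->
  V tau -> V tau'.
Proof.
have [rho r0 rP] := inverse_root_near1 M0;
  exists rho => // tau tau' d d0 dist tt [r Ar rE].
pose v s := (tau - tau') * r s ^+ M.
have Av : Afun v by apply: AfunM; [exact: Afun_cst | exact: AfunX].
have [s s01|z Az zE] := rP v Av.
  have omd := dist s s01; have om0 : 0 < cm (om s - tau) by lra.
  have rM : r s ^+ M = (om s - tau)^-1.
    by apply: (mulIf (x := om s - tau)); rewrite -?cm_gt0 // rE // mulVf -?cm_gt0.
  rewrite /v cmM rM cmV ler_pdivrMr //; apply: le_trans tt _.
  by rewrite ler_pM2l.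
exists (fun s => r s * z s); first exact: AfunM.
move=> s s01; rewrite exprMn.
have -> : om s - tau' = (om s - tau) * (1 + v s).
  rewrite /v mulrDr mulr1 mulrCA [_ * r s ^+ M]mulrC rE //; ring.
by rewrite mulrACA rE // zE // mul1r.
Qed.

(** Starting point of the pole pushing: om - tau = -tau (1 - om/tau), with om/tau small. *)
Lemma inverse_root_far : exists2 K : R, 0 < K & forall tau, K <= cm tau -> V tau.
Proof.
have [rho r0 rP] := inverse_root_near1 M0; have [B B0 BP] := Afun_bounded Aom.
exists (B / rho); first by rewrite divr_gt0.
move=> tau Kt; have t0 : 0 < cm tau by apply: lt_le_trans Kt; rewrite divr_gt0.
have tau0 : tau != 0 by rewrite -cm_gt0.
pose v s := - tau^-1 * om s.
have [s s01|z Az zE] := rP v (AfunM (Afun_cst _) Aom).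
  rewrite /v cmM cmN cmV mulrC ler_pdivrMr // mulrC.
  by apply: le_trans (BP s s01) _; rewrite -ler_pdivrMr.
have [k kE] := root_exists (- tau^-1) M0.
exists (fun s => k * z s); first exact: AfunM (Afun_cst k) Az.
move=> s s01; rewrite exprMn kE -(zE s s01).
rewrite /v mulrAC mulrC; congr (_ * _); field; exact: tau0.
Qed.

Variables (N : nat) (z0 : C).
Hypothesis N0 : (0 < N)%N.
Hypothesis omN : forall s, 0 <= s <= 1 -> om s ^+ N = g s - z0.

(** g - t = om^N - tau^N is om - tau times a bounded cofactor. The factor 2 leaves room for moving
    [tau] by up to [d'] afterwards. *)
Lemma dist_shift (t : C) (d : R) : 0 < d ->
  (forall s, 0 <= s <= 1 -> d <= cm (g s - t)) ->
  exists2 d' : R, 0 < d' & forall tau s, tau ^+ N = t - z0 -> 0 <= s <= 1 ->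
    2 * d' <= cm (om s - tau).
Proof.
move=> d0 dist; have [B B0 BP] := Afun_bounded Aom.
pose B1 := B + 1 + cm (t - z0); have B11 : 1 <= B1 by rewrite /B1;
  have := cm_ge0 (t - z0); lra.
have B10 : 0 < B1 by lra.
have K0 : 0 < N%:R * B1 ^+ N.-1 by rewrite mulr_gt0 ?ltr0n ?exprn_gt0.
exists (d / (2 * (N%:R * B1 ^+ N.-1))); first by rewrite divr_gt0 // mulr_gt0.
move=> tau s tauE s01.
have tauB : cm tau <= B1.
  have [le1|lt1] := leP (cm tau) 1; first by lra.
  apply: le_trans (_ : cm tau ^+ N <= _); first by rewrite ler_eXnr ?ltW.
  by rewrite -cmX tauE /B1; lra.
have E : cm (g s - t) = cm (om s - tau) * cm (\sum_(i < N) om s ^+ (N.-1 - i) *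
  tau ^+ i).
  rewrite -cmM -subrXX omN // tauE; congr cm; ring.
have S : cm (\sum_(i < N) om s ^+ (N.-1 - i) * tau ^+ i) <= N%:R * B1 ^+ N.-1.
  apply: le_trans (cm_sum _ _) _.
  have -> : N%:R * B1 ^+ N.-1 = \sum_(i < N) B1 ^+ N.-1.
    by rewrite sumr_const card_ord mulr_natl.
  apply: ler_sum => i _; have iN : (i <= N.-1)%N by rewrite -ltnS prednK.
  rewrite -{2}(subnK iN) exprD cmM !cmX ler_pM ?exprn_ge0 ?cm_ge0 //.
    apply: lerXn2r; rewrite ?nnegrE ?cm_ge0 ?(ltW B10) //.
    by have := BP s s01; have := cm_ge0 (t - z0); rewrite /B1; lra.
  by apply: lerXn2r; rewrite ?nnegrE ?cm_ge0 ?(ltW B10).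
have := dist s s01; rewrite E => h.
have -> : 2 * (d / (2 * (N%:R * B1 ^+ N.-1))) = d / (N%:R * B1 ^+ N.-1).
  by field; rewrite !gt_eqF ?ltr0n ?exprn_gt0.
rewrite ler_pdivrMr //; apply: le_trans h _.
by rewrite ler_wpM2l ?cm_ge0.
Qed.

(** Poles can be pushed both from x to a nearby y and from y back to x, with a radius depending on x
    alone; so the property is locally constant on D0, and it holds far away. *)
Lemma inverse_root_component (D0 : set C) : connected D0 ->
  (forall t, D0 t -> exists2 d : R, 0 < d &
     forall s, 0 <= s <= 1 -> d <= cm (g s - t)) ->
  (forall K : R, exists2 t, D0 t & K <= cm t) ->
  forall t tau, D0 t -> tau ^+ N = t - z0 -> V tau.
Proof.
move=> cD dD uD t tau Dt tauE.
(* All N roots are treated together: moving t only guarantees that some root of the new equation is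
   near a given one. *)
pose P (t : C) := forall tau, tau ^+ N = t - z0 -> V tau.
have [K K0 KP] := inverse_root_far.
have [t1 Dt1 t1K] := uD (K ^+ N + cm z0).
suff : P t by apply.
apply: (locally_constant_connected (P := P) cD _ Dt1 Dt); last first.
  move=> sg sgE; apply: KP; rewrite -(ler_pXn2r N0) ?nnegrE ?cm_ge0 ?(ltW K0) //.
  by rewrite -cmX sgE; have := cm_rtri t1 z0; lra.
move=> x Dx; have [d d0 dist] := dD x Dx.
have [d' d'0 dist'] := dist_shift d0 dist.
have [rho r0 step] := inverse_root_step.
pose c := Num.min rho 1; have c0 : 0 < c by rewrite lt_min r0 ltr01.
apply/nbhs_cm; exists ((c * d') ^+ N); first by rewrite exprn_gt0 // mulr_gt0.
move=> y yx Dy.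
have cd'0 : 0 < c * d' by rewrite mulr_gt0.
have cr : c * d' <= rho * d' by rewrite ler_pM2r // ge_min lexx.
have c1 : c * d' <= d' by rewrite -[leRHS]mul1r ler_pM2r // ge_min lexx orbT.
split=> Px sg sgE.
  have [w wE wle] := close_root (x - z0) sg N0.
  have {}wle : cm (sg - w) <= c * d'.
    rewrite -(ler_pXn2r N0) ?nnegrE ?cm_ge0 ?(ltW cd'0) //; apply: le_trans wle _.
    by rewrite sgE (_ : _ - _ = y - x) ?ltW //; ring.
  apply: (step w sg d') => //; last exact: Px.
    by move=> s s01; have := dist' w s wE s01; lra.
  by rewrite cmBC; lra.
have [w wE wle] := close_root (y - z0) sg N0.
have {}wle : cm (sg - w) <= c * d'.
  rewrite -(ler_pXn2r N0) ?nnegrE ?cm_ge0 ?(ltW cd'0) //; apply: le_trans wle _.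
  have -> : sg ^+ N - (y - z0) = - (y - x) by rewrite sgE; ring.
  by rewrite cmN ltW.
apply: (step w sg d') => //; last exact: Px.
  move=> s s01; have := dist' sg s sgE s01.
  by have := cm_tri (om s) w sg; rewrite (cmBC w); lra.
by rewrite cmBC; lra.
Qed.
End Shifts.

End UniformAlgebra.

(** * The N-th root of g - z0 as a limit of branches *)

Section RootFunction.
Variable R : realType.
Local Notation C := (cplx R).
Variables (g : R -> C) (z0 : C) (N : nat) (D : set C).
Hypothesis g_cont : cont_on 0 1 g.
Hypothesis g0 : g 0 = z0.
Hypothesis g1 : g 1 = z0.
Hypothesis g_neq : forall s, 0 < s < 1 -> g s != z0.
Hypothesis N0 : (0 < N)%N.
Hypothesis Dcl : forall e : R, 0 < e -> exists2 t, D t & cm (t - z0) < e.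
Hypothesis Droot : forall t, D t -> has_inverse_root g N (fun s => g s - t).

Let half01 : 0 < (1 / 2 : R) < 1. Proof. lra. Qed.
Let half01' : 0 <= (1 / 2 : R) <= 1. Proof. lra. Qed.

(* The last clause selects, for [t] near [z0], always the same one of the N
   branches of the root. *)
Definition root_branch (c : C) (t : C) (f : R -> C) :=
  [/\ Afun g f, exists2 r, Afun g r & forall s, 0 <= s <= 1 -> f s * r s = 1,
    forall s, 0 <= s <= 1 -> f s ^+ N = g s - t &
    cm (f (1 / 2) - c) ^+ N <= cm (t - z0)].

(** From an inverse root [r] comes the root (g - t) r^(N-1). Multiplying it by the root of unity c/w
    moves the root [w] closest to its value at 1/2 onto [c]. *)
Lemma root_branch_exists c t : c ^+ N = g (1 / 2) - z0 -> D t ->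
  exists f, root_branch c t f.
Proof.
move=> cN Dt; have [r Ar rE] := Droot Dt.
have c0 : c != 0.
  by have := g_neq half01; rewrite -subr_eq0 -cN expf_eq0 N0.
pose f s := (g s - t) * r s ^+ N.-1.
have fr s : 0 <= s <= 1 -> f s * r s = 1.
  by move=> s01; rewrite /f -mulrA -exprSr prednK // mulrC rE.
have Af : Afun g f.
  by apply: AfunM => //; [apply: AfunB => //;
    [exact: Afun_id | exact: Afun_cst] | exact: AfunX].
have fN s : 0 <= s <= 1 -> f s ^+ N = g s - t.
  move=> s01; have rN0 : r s ^+ N != 0.
    by apply/eqP => E; have := rE s s01; rewrite E mul0r => /esym/eqP; rewrite oner_eq0.
  apply: (mulfI rN0); rewrite rE // -exprMn mulrC fr //.
  by rewrite expr1n.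
have [w wN wle] := close_root (g (1 / 2) - z0) (f (1 / 2)) N0.
have w0 : w != 0.
  by have := g_neq half01; rewrite -subr_eq0 -wN expf_eq0 N0.
have cwN : (c / w) ^+ N = 1.
  by rewrite expr_div_n cN wN divff // -wN expf_eq0 N0.
exists (fun s => c / w * f s); split.
- by apply: AfunM => //; exact: Afun_cst.
- exists (fun s => w / c * r s); first by apply: AfunM => //; exact: Afun_cst.
  move=> s s01; rewrite mulrACA fr // mulr1 mulrA divfK // divff //.
- by move=> s s01; rewrite exprMn cwN mul1r fN.
- have -> : c / w * f (1 / 2) - c = c / w * (f (1 / 2) - w) by field; rewrite w0.
  rewrite -cmX exprMn cwN (mul1r (_ ^+ _)) cmX; apply: le_trans wle _.
  by rewrite fN // (_ : _ - _ = - (t - z0)) ?cmN //; ring.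
Qed.

(** Near the two ends both branches are small, because g - t and g - t' are. In between their ratio
    has N-th power close to 1, hence barely varies, and the normalisation at 1/2 makes it close to
    1. *)
Lemma root_branch_cauchy c e : c ^+ N = g (1 / 2) - z0 -> 0 < e ->
  exists2 d : R, 0 < d & forall t t' f f',
    cm (t - z0) <= d -> cm (t' - z0) <= d ->
    root_branch c t f -> root_branch c t' f' ->
    forall s, 0 <= s <= 1 -> cm (f s - f' s) <= e.
Proof.
move=> cN e0.
have c0 : 0 < cm c.
  by rewrite cm_gt0; have := g_neq half01; rewrite -subr_eq0 -cN expf_eq0 N0.
have [B B0 BP] := cont_on_max ler01 g_cont.
pose B1 := B + cm z0 + 2.
have B1_ge1 : 1 <= B1 by rewrite /B1; have := cm_ge0 z0; lra.
have B1_gt0 : 0 < B1 by lra.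
pose k := (e / 2) ^+ N / 2;
  have k0 : 0 < k by rewrite divr_gt0 // exprn_gt0 // divr_gt0.
have [d1 [d1_gt0 _ d1_half d1P]] : exists eta :
  R, [/\ 0 < eta, eta <= 1, eta + eta < 1 &
    forall s, 0 <= s <= 1 -> (s <= eta) || (1 - eta <= s) -> cm (g s - z0) <= k].
  apply: small_near_ends => //; rewrite ?g0 ?g1 ?subrr //.
  by apply: cont_onD => //; exact: cont_on_cst.
have [m m0 mP] : exists2 m :
  R, 0 < m & forall s, d1 <= s <= 1 - d1 -> m <= cm (g s - z0).
  apply: cont_on_min; first by lra.
    apply: cont_on_sub (cont_onD g_cont (@cont_on_cst _ 0 1 (- z0))); lra.
  by move=> s sd; rewrite subr_eq0; apply: g_neq; lra.
have e20 : 0 < e / (3 * B1) by rewrite divr_gt0 // mulr_gt0.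
have [d2 d20 follow] := root_follow 1 N0 e20.
pose h := Num.min (e * cm c / (12 * B1)) (cm c / 2).
have h0 : 0 < h by rewrite lt_min !divr_gt0 // ?mulr_gt0.
pose d := Num.min (Num.min (Num.min k 1) (m / 2)) (Num.min (d2 * m / 4) (h ^+ N)).
have d0 : 0 < d by rewrite !lt_min k0 ltr01 exprn_gt0 // !divr_gt0 // mulr_gt0.
have dk : d <= k by rewrite /d !ge_min lexx.
have d_1 : d <= 1 by rewrite /d !ge_min lexx !orbT.
have dm : d <= m / 2 by rewrite /d !ge_min lexx !orbT.
have dd : d <= d2 * m / 4 by rewrite /d !ge_min lexx !orbT.
have dh : d <= h ^+ N by rewrite /d !ge_min lexx !orbT.
exists d => // t t' f f' td t'd [Af [r Ar fr] fN fc] [Af' [r' Ar' fr'] f'N f'c] s s01.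
have fbound (u : C) (F : R -> C) x : cm (u - z0) <= d -> 0 <= x <= 1 ->
    F x ^+ N = g x - u -> cm (F x) <= B1.
  move=> ud x01 FN; have [le1|lt1] := leP (cm (F x)) 1; first by lra.
  apply: le_trans (_ : cm (F x) ^+ N <= _); first by rewrite ler_eXnr // ltW.
  rewrite -cmX FN /B1; have := BP x x01; have := cm_tri (g x) z0 u.
  have := cmD (g x) (- z0); rewrite cmN (cmBC z0); lra.
have fsmall (u : C) (F : R -> C) x : cm (u - z0) <= d -> cm (g x - z0) <= k ->
    F x ^+ N = g x - u -> cm (F x) <= e / 2.
  move=> ud gk FN; rewrite -(ler_pXn2r N0) ?nnegrE ?cm_ge0 ?divr_ge0 ?(ltW e0) //.
  rewrite -cmX FN; have := cm_tri (g x) z0 u; rewrite (cmBC z0).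
  have -> : (e / 2) ^+ N = k + k by rewrite /k; field.
  by lra.
have [sout|sin] := boolP ((s <= d1) || (1 - d1 <= s)).
  have gk := d1P s s01 sout; have F := fsmall t f s td gk (fN s s01).
  have F' := fsmall t' f' s t'd gk (f'N s s01).
  by have := cmB (f s) (f' s); lra.
move: sin; rewrite negb_or -!ltNge => sin.
(* [r'] inverts [f'], so [q] is the ratio of the branches, with N-th power (g - t)/(g - t'). *)
pose q s := f s * r' s.
have qc : cont_on d1 (1 - d1) q.
  apply: (@cont_on_sub _ 0 1); [lra|lra|].
  by apply: Afun_cont g_cont _ _; apply: AfunM.
have qN x : d1 <= x <= 1 - d1 -> cm (q x ^+ N - 1) <= d2.
  move=> xd; have x01 : 0 <= x <= 1 by lra.
  have gt' : m / 2 <= cm (g x - t').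
    have := mP x xd; have := cm_tri (g x) t' z0; lra.
  have gt'0 : g x - t' != 0 by rewrite -cm_gt0; lra.
  have rN : r' x ^+ N = (g x - t')^-1.
    apply: (mulfI gt'0); rewrite divff // -f'N // -exprMn fr' //.
    by rewrite expr1n.
  rewrite /q exprMn fN // rN.
  have -> : (g x - t) / (g x - t') - 1 = (t' - t) / (g x - t') by field.
  rewrite cmM cmV ler_pdivrMr; last by lra.
  have tt : cm (t' - t) <= 2 * d.
    by have := cm_tri t' z0 t; rewrite (cmBC z0); lra.
  apply: le_trans tt _; apply: le_trans (_ : d2 * (m / 2) <= _); first by lra.
  by rewrite ler_pM2l.
have sh : d1 <= (1 / 2 : R) <= 1 - d1 by lra.
have ssd : d1 <= s <= 1 - d1 by lra.
have q1 := follow _ _ q qc qN _ _ ssd sh.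
have near_c (u : C) (F : R -> C) : cm (u - z0) <= d ->
    cm (F (1 / 2) - c) ^+ N <= cm (u - z0) -> cm (F (1 / 2) - c) <= h.
  move=> ud Fc; rewrite -(ler_pXn2r N0) ?nnegrE ?cm_ge0 ?(ltW h0) //; lra.
have fh := near_c _ _ td fc; have f'h := near_c _ _ t'd f'c.
have hh1 : h <= e * cm c / (12 * B1) by rewrite ge_min lexx.
have hh2 : h <= cm c / 2 by rewrite ge_min lexx orbT.
have q2 : cm (q (1 / 2) - 1) <= e / (3 * B1).
  have f'2 : cm c / 2 <= cm (f' (1 / 2)).
    by have := cm_rtri c (f' (1 / 2)); rewrite (cmBC c); lra.
  have E : q (1 / 2) - 1 = (f (1 / 2) - f' (1 / 2)) * r' (1 / 2).
    by rewrite mulrBl fr'.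
  have rE : cm (r' (1 / 2)) = (cm (f' (1 / 2)))^-1.
    have f'0 : cm (f' (1 / 2)) != 0 by rewrite gt_eqF //; lra.
    by apply: (mulfI f'0); rewrite -cmM fr' // divff // cm1.
  rewrite E cmM rE ler_pdivrMr; last by lra.
  have tt : cm (f (1 / 2) - f' (1 / 2)) <= 2 * h.
    by have := cm_tri (f (1 / 2)) c (f' (1 / 2)); rewrite (cmBC c); lra.
  apply: le_trans tt _; apply: le_trans (_ : e / (3 * B1) * (cm c / 2) <= _).
    have -> : e / (3 * B1) * (cm c / 2) = 2 * (e * cm c / (12 * B1)).
      by field; rewrite gt_eqF.
    by lra.
  by rewrite ler_pM2l.
have -> : f s - f' s = (q s - 1) * f' s.
  by rewrite mulrBl mul1r /q -mulrA (mulrC (r' s)) fr' // mulr1.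
rewrite cmM; have q3 := cm_tri (q s) (q (1 / 2)) 1.
apply: le_trans (_ : (3 * (e / (3 * B1))) * B1 <= _).
  rewrite ler_pM ?cm_ge0 //; last exact: fbound t'd s01 (f'N s s01).
  by move: q1 q2 q3 e20; set y := e / (3 * B1); lra.
have -> // : 3 * (e / (3 * B1)) * B1 = e.
by field; rewrite gt_eqF.
Qed.

(** The limit at each point is sought among the finitely many N-th roots of g - z0: their separation
    and the Cauchy estimate single one out. The quantification over [e] and [d] inside [lim] lets
    the uniform estimate pass to this pointwise choice. *)
Lemma root_function_exists : exists2 om, Afun g om &
  forall s, 0 <= s <= 1 -> om s ^+ N = g s - z0.
Proof.
have [c cN] := root_exists (g (1 / 2) - z0) N0.
have lim s : exists w, 0 <= s <= 1 -> w ^+ N = g s - z0 /\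
  forall e d : R, 0 < e -> 0 < d ->
  (forall t t' f f', cm (t - z0) <= d -> cm (t' - z0) <= d ->
    root_branch c t f -> root_branch c t' f' -> cm (f s - f' s) <= e) ->
  forall t f, cm (t - z0) <= d -> root_branch c t f -> cm (f s - w) <= e.
  have [s01|ns] := pselect (0 <= s <= 1); last by exists 0.
  have [sep sep0 sepP] := root_separation (g s - z0) N0.
  have e0 : 0 < sep / 4 by lra.
  have [d0 d00 cau] := root_branch_cauchy cN e0.
  have near (h : R) : 0 < h -> exists t f w, [/\ root_branch c t f, cm (t - z0) < h,
      w ^+ N = g s - z0 & cm (f s - w) <= h].
    move=> h0; have h1 : 0 < Num.min h (h ^+ N) by rewrite lt_min h0 exprn_gt0.
    have [t Dt] := Dcl h1; rewrite lt_min => /andP[th thN].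
    have [f fb] := root_branch_exists cN Dt; case: (fb) => _ _ fN _.
    have [w wN wle] := close_root (g s - z0) (f s) N0.
    exists t, f, w; split => //.
    rewrite -(ler_pXn2r N0) ?nnegrE ?cm_ge0 ?(ltW h0) //; apply: le_trans wle _.
    have -> : f s ^+ N - (g s - z0) = - (t - z0) by rewrite fN //; ring.
    by rewrite cmN ltW.
  have hm : 0 < Num.min d0 (sep / 4) by rewrite lt_min d00.
  have [t1 [f1 [w [b1 t1z wN fw]]]] := near _ hm.
  move: t1z fw; rewrite lt_min le_min => /andP[t1d _] /andP[_ f1w].
  exists w => _; split=> // e d e_gt0 d_gt0 cau' t f td fb.
  apply/ler_addgt0Pr => h h0.
  have hm' : 0 < Num.min (Num.min d0 d) (Num.min h (sep / 4)) by rewrite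
    !lt_min d00 d_gt0 h0.
  have [t2 [f2 [w2 [b2 t2z w2N fw2]]]] := near _ hm'.
  move: t2z fw2; rewrite !lt_min !le_min => /andP[/andP[t2d0 t2d] _].
  move=> /andP[_ /andP[f2h f2s]].
  (* Three gaps of at most a quarter of the separation lie between the two roots. *)
  have w2w : w2 = w.
    apply: sepP => //; have := cau _ _ _ _ (ltW t1d) (ltW t2d0) b1 b2 s s01.
    have := cm_tri w2 (f2 s) w; have := cm_tri (f2 s) (f1 s) w.
    rewrite (cmBC w2 (f2 s)) (cmBC (f2 s) (f1 s)); lra.
  subst w2; have := cau' _ _ _ _ td (ltW t2d) fb b2.
  by have := cm_tri (f s) (f2 s) w; lra.
pose om s := sval (cid (lim s)).
have omP s : 0 <= s <= 1 -> _ := svalP (cid (lim s)).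
exists om; last by move=> s /omP[].
apply: Afun_lim => e e0.
have [d d0 cau] := root_branch_cauchy cN e0.
have [t Dt td] := Dcl d0; have [f fb] := root_branch_exists cN Dt.
exists f; first by case: fb.
move=> s s01; have [_ H] := omP s s01; rewrite cmBC.
apply: (H e d) (ltW td) fb => // t1 t2 f1 f2 h1 h2 b1 b2.
exact: cau h1 h2 b1 b2 s s01.
Qed.
End RootFunction.

(** * Complex-valued functions of a real variable *)

Section ComplexDerivative.
Variable R : realType.
Local Notation C := (cplx R).
Implicit Types (F G : R -> C) (x : R) (d : C).

(** The neighbourhood contains [x] itself, so the limit is forced to be the value there. *)
Definition ccvg (f : R -> C) x d :=
  forall e : R, 0 < e -> \forall t \near x, cm (f t - d) < e.

Lemma ccvg_cst (c : C) x : ccvg (fun=> c) x c.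
Proof. by move=> e e0; near=> t; rewrite subrr cm0.
Unshelve. all: by end_near. Qed.

Lemma ccvg_near f h x d : (\forall t \near x, f t = h t) -> ccvg f x d -> ccvg h x d.
Proof.
by move=> fh cf e e0; near=> t; rewrite -(near fh t) //; near: t; exact: cf.
Unshelve. all: by end_near. Qed.

Lemma ccvgD f h x a b : ccvg f x a -> ccvg h x b -> ccvg (fun t => f t + h t) x (a + b).
Proof.
move=> cf ch e e0; have e2 : 0 < e / 2 by lra.
near=> t; rewrite opprD addrACA; apply: le_lt_trans (cmD _ _) _.
have -> : e = e / 2 + e / 2 by field.
by apply: ltrD; near: t; [exact: cf | exact: ch].
Unshelve. all: by end_near. Qed.

Lemma ccvgM f h x a b : ccvg f x a -> ccvg h x b -> ccvg (fun t => f t * h t) x (a * b).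
Proof.
move=> cf ch e e0; pose K := cm a + cm b + 1.
have K0 : 0 < K by rewrite /K; have := cm_ge0 a; have := cm_ge0 b; lra.
have e1 : 0 < e / (2 * K) by rewrite divr_gt0 // mulr_gt0.
near=> t.
have h1 : cm (h t - b) < 1 by near: t; exact: ch.
have h2 : cm (f t - a) < e / (2 * K) by near: t; exact: cf.
have h3 : cm (h t - b) < e / (2 * K) by near: t; exact: ch.
have -> : f t * h t - a * b = (f t - a) * h t + a * (h t - b) by ring.
have ht : cm (h t) <= cm b + 1 by have := cm_rtri (h t) b; lra.
apply: le_lt_trans (cmD _ _) _; rewrite !cmM.
have H1 : cm (f t - a) * cm (h t) <= e / (2 * K) * (cm b + 1).
  by rewrite ler_pM ?cm_ge0 // ltW.
have H2 : cm a * cm (h t - b) <= cm a * (e / (2 * K)).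
  by rewrite ler_wpM2l ?cm_ge0 // ltW.
apply: le_lt_trans (lerD H1 H2) _.
have -> : e / (2 * K) * (cm b + 1) + cm a * (e / (2 * K)) = e / 2.
  rewrite [cm a * _]mulrC -mulrDr (_ : _ + cm a = K); last by rewrite /K; ring.
  by field; rewrite gt_eqF.
lra.
Unshelve. all: by end_near. Qed.

Lemma ccvg_neq0 f x a : a != 0 -> ccvg f x a -> \forall t \near x, cm a / 2 < cm (f t).
Proof.
rewrite -cm_gt0 => a0 cf; have e2 : 0 < cm a / 2 by lra.
near=> t; have h : cm (f t - a) < cm a / 2 by near: t; exact: cf.
have := cm_rtri a (f t); rewrite cmBC; lra.
Unshelve. all: by end_near. Qed.

Lemma ccvgV f x a : a != 0 -> ccvg f x a -> ccvg (fun t => (f t)^-1) x a^-1.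
Proof.
move=> a0 cf e e0; have ca : 0 < cm a by rewrite cm_gt0.
have e1 : 0 < e * (cm a / 2 * cm a) by rewrite !mulr_gt0.
near=> t; have ft : cm a / 2 < cm (f t) by near: t; exact: ccvg_neq0.
have ft0 : f t != 0 by rewrite -cm_gt0; lra.
have -> : (f t)^-1 - a^-1 = (a - f t) / (f t * a) by field; rewrite ?ft0 ?a0.
rewrite !cmM cmV cmM ltr_pdivrMr; last by rewrite mulr_gt0 //; lra.
rewrite cmBC; apply: lt_le_trans (_ : e * (cm a / 2 * cm a) <= _).
  by near: t; exact: cf.
by rewrite ler_pM2l // ler_pM2r // ltW.
Unshelve. all: by end_near. Qed.

Lemma ccvg_sum n (f : 'I_n -> R -> C) (a : 'I_n -> C) x :
  (forall i, ccvg (f i) x (a i)) ->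
  ccvg (fun t => \sum_(i < n) f i t) x (\sum_(i < n) a i).
Proof.
elim: n f a => [|n IH] f a fa.
  rewrite big_ord0; apply: ccvg_near (ccvg_cst 0 x).
  by near=> t; rewrite big_ord0.
rewrite big_ord_recr /=; apply: ccvg_near (ccvgD (IH _ _ (fun i => fa _)) (fa _)).
by near=> t; rewrite big_ord_recr.
Unshelve. all: by end_near. Qed.

(* Caratheodory's form of differentiability *)
Definition cder F x d := exists2 q : R -> C, ccvg q x d &
  \forall t \near x, F t - F x = rc (t - x) * q t.

Lemma cder_cvg F x d : cder F x d -> ccvg F x (F x).
Proof.
move=> [q qd qE].
have : ccvg (fun t => F x + rc (t - x) * q t) x (F x + 0 * d).
  apply: ccvgD; first exact: ccvg_cst.
  apply: ccvgM => // e e0; apply/nbhs_dist; exists e => // t.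
  by rewrite subr0 cm_rc.
rewrite mul0r addr0; apply: ccvg_near.
by near=> t; rewrite -(near qE t) // addrC subrK.
Unshelve. all: by end_near. Qed.

Lemma cder_near F G x d : (\forall t \near x, F t = G t) -> cder F x d -> cder G x d.
Proof.
move=> FG [q qd qE]; exists q => //; have FGx := nbhs_singleton FG.
by near=> t; rewrite -FGx -(near FG t) // (near qE t).
Unshelve. all: by end_near. Qed.

Lemma cder_cst (c : C) x : cder (fun=> c) x 0.
Proof.
exists (fun=> 0); first exact: ccvg_cst.
by near=> t; rewrite subrr mulr0.
Unshelve. all: by end_near. Qed.

Lemma cderD F G x d e : cder F x d -> cder G x e -> cder (fun t => F t + G t) x (d + e).
Proof.
move=> [q qd qE] [r re rE]; exists (fun t => q t + r t); first exact: ccvgD.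
near=> t; rewrite mulrDr -(near qE t) // -(near rE t) //; ring.
Unshelve. all: by end_near. Qed.

Lemma cderM F G x d e : cder F x d -> cder G x e ->
  cder (fun t => F t * G t) x (d * G x + F x * e).
Proof.
move=> dF dG; have cG := cder_cvg dG; case: dF dG => q qd qE [r re rE].
exists (fun t => q t * G t + F x * r t).
  by apply: ccvgD; apply: ccvgM => //; exact: ccvg_cst.
near=> t; rewrite mulrDr mulrA -(near qE t) // mulrCA -(near rE t) //; ring.
Unshelve. all: by end_near. Qed.

Lemma cderB F G x d e : cder F x d -> cder G x e -> cder (fun t => F t - G t) x (d - e).
Proof.
move=> dF dG; have := cderD dF (cderM (cder_cst (-1) x) dG).
rewrite mul0r add0r mulN1r; apply: cder_near.
by near=> t; rewrite mulN1r.
Unshelve. all: by end_near. Qed.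

Lemma cder_poly F x d (p : {poly C}) : cder F x d ->
  cder (fun t => p.[F t]) x (p^`().[F x] * d).
Proof.
move=> dF; elim/poly_ind: p => [|p c IH].
  rewrite deriv0 horner0 mul0r; apply: cder_near (cder_cst 0 x).
  by near=> t; rewrite horner0.
have := cderD (cderM IH dF) (cder_cst c x).
rewrite addr0 derivD derivC addr0 derivM derivX mulr1 hornerD hornerM hornerX.
rewrite mulrDl mulrAC; apply: cder_near.
by near=> t; rewrite hornerMXaddC.
Unshelve. all: by end_near. Qed.

Lemma cder_inv F x d : F x != 0 -> cder F x d ->
  cder (fun t => (F t)^-1) x (- (d / F x ^+ 2)).
Proof.
move=> Fx0 dF; have cF := cder_cvg dF; case: dF => q qd qE.
exists (fun t => - (q t / (F t * F x))).
  rewrite expr2 -mulN1r; apply: (@ccvg_near (fun t => -1 * (q t / (F t * F x)))).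
    by near=> t; rewrite mulN1r.
  apply: ccvgM; first exact: ccvg_cst.
  apply: ccvgM => //; apply: ccvgV; first by rewrite mulf_neq0.
  by apply: ccvgM => //; exact: ccvg_cst.
near=> t.
have Ft0 : F t != 0.
  rewrite -cm_gt0; apply: le_lt_trans (_ : cm (F x) / 2 < _).
    by rewrite divr_ge0 ?cm_ge0.
  by near: t; exact: ccvg_neq0.
have -> : rc (t - x) * - (q t / (F t * F x)) = - ((rc (t - x) * q t) / (F t * F
  x)) by ring.
rewrite -(near qE t) //; field; exact/andP.
Unshelve. all: by end_near. Qed.

(** Continuity of the root suffices: F(t)^n - F(x)^n is F(t) - F(x) times a sum tending to n
    F(x)^(n-1), which is not zero. *)
Lemma cder_root n F G x d : (0 < n)%N -> F x != 0 -> ccvg F x (F x) ->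
  (\forall t \near x, F t ^+ n = G t) -> cder G x d ->
  cder F x (d / (n%:R * F x ^+ n.-1)).
Proof.
move=> n0 Fx0 cF FG [q qd qE].
have FGx := nbhs_singleton FG.
pose S t := \sum_(i < n) F t ^+ (n.-1 - i) * F x ^+ i.
have cX m : ccvg (fun t => F t ^+ m) x (F x ^+ m).
  elim: m => [|m IH].
    by rewrite expr0; apply: ccvg_near (ccvg_cst 1 x); near=> t; rewrite expr0.
  rewrite exprS; apply: ccvg_near (ccvgM cF IH).
  by near=> t; rewrite exprS.
have cS : ccvg S x (n%:R * F x ^+ n.-1).
  have -> : n%:R * F x ^+ n.-1 = \sum_(i < n) F x ^+ (n.-1 - i) * F x ^+ i.
    transitivity (\sum_(i < n) F x ^+ n.-1).
      by rewrite sumr_const card_ord mulr_natl.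
    by apply: eq_bigr => i _; rewrite -exprD subnK // -ltnS prednK.
  by apply: ccvg_sum => i; apply: ccvgM; [exact: cX | exact: ccvg_cst].
have S0 : n%:R * F x ^+ n.-1 != 0 :> C.
  by rewrite mulf_neq0 ?expf_neq0 // pnatr_eq0 -lt0n.
exists (fun t => q t / S t); first by apply: ccvgM => //; apply: ccvgV.
near=> t; have St0 : S t != 0.
  rewrite -cm_gt0; apply: le_lt_trans (_ : cm (n%:R * F x ^+ n.-1) / 2 < _).
    by rewrite divr_ge0 ?cm_ge0.
  by near: t; exact: ccvg_neq0.
apply: (mulIf St0); rewrite mulrA divfK // -(near qE t) //.
by rewrite -(near FG t) // -FGx subrXX.
Unshelve. all: by end_near. Qed.

Lemma cder_ReIm F x (a b : R) :
  is_derive x (1 : R) (fun t => complex.Re (F t)) a ->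
  is_derive x (1 : R) (fun t => complex.Im (F t)) b ->
  cder F x (Complex a b).
Proof.
have quot (f : R -> R) c : is_derive x (1 : R) f c -> forall e : R, 0 < e ->
    exists2 r : R, 0 < r & forall t, `|t - x| < r -> t != x ->
      `|(f t - f x) / (t - x) - c| < e.
  move=> df e e0; have [df1 df2] := df.
  have := df1; rewrite /derivable -/(derive _ _ _) => /cvgrPdist_lt/(_ e e0).
  rewrite -/(derive f x 1) df2 => /nbhs_dist[r r0 rP]; exists r => // t tr tx.
  have := rP (t - x); rewrite subr0 => /(_ tr); rewrite subr_eq0 => /(_ tx).
  by rewrite distrC /GRing.scale /= mulr1 subrK mulrC.
move=> /quot da /quot db.
exists (fun t => if t == x then Complex a b : C else (F t - F x) / rc (t - x)).
  move=> e e0; have e2 : 0 < e / 2 by lra.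
  have [r1 r10 r1P] := da _ e2; have [r2 r20 r2P] := db _ e2.
  apply/nbhs_dist; exists (Num.min r1 r2); first by rewrite lt_min r10.
  move=> t; rewrite lt_min => /andP[t1 t2]; case: eqVneq => [_|tx].
    by rewrite subrr cm0.
  apply: le_lt_trans (cm_ReIm _) _; have := r1P t t1 tx; have := r2P t t2 tx.
  have -> : (F t - F x) / rc (t - x) = Complex (complex.Re (F t - F x) / (t -
    x)) (complex.Im (F t - F x) / (t - x)) :> C.
    rewrite /rc -fmorphV; case: (F t - F x) => u v /=.
    by simpc.
  rewrite !raddfB /=; lra.
near=> t; case: eqVneq => [->|tx]; first by rewrite !subrr mul0r.
by rewrite mulrCA divff ?mulr1 // rc_eq0 subr_eq0.
Unshelve. all: by end_near. Qed.

Lemma cder_is_derive F x d : cder F x d ->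
  is_derive x (1 : R) (fun t => complex.Re (F t)) (complex.Re d) /\
  is_derive x (1 : R) (fun t => complex.Im (F t)) (complex.Im d).
Proof.
have key (f : R -> R) (c : R) (q : R -> R) :
    (forall e : R, 0 < e -> exists2 r :
      R, 0 < r & forall t, `|t - x| < r -> `|q t - c| < e) ->
    (\forall t \near x, f t - f x = (t - x) * q t) -> is_derive x (1 : R) f c.
  move=> qc fE.
  have lim : h^-1 *: (f (h *: (1 : R) + x) - f x) @[h --> 0^'] --> c.
    apply/cvgrPdist_lt => e e0; have [r r0 rP] := qc e e0.
    move: fE => /nbhs_dist[r' r'0 r'P].
    apply/nbhs_dist; exists (Num.min r r'); first by rewrite lt_min r0.
    move=> h; rewrite subr0 lt_min => /andP[h1 h2] h0.
    rewrite /GRing.scale /= mulr1 r'P ?addrK // mulrA mulVf // mul1r distrC.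
    by apply: rP; rewrite addrK.
  split; first by apply/cvg_ex; exists c.
  exact: (cvg_lim _ lim).
move=> [q qd' qE]; have qd (e : R) : 0 < e -> exists2 r :
  R, 0 < r & forall t, `|t - x| < r -> cm (q t - d) < e.
  by move=> /qd' /nbhs_dist.
split.
  apply: (key _ _ (fun t => complex.Re (q t))) => [e /qd[r r0 rP]|].
    exists r => // t /rP; apply: le_lt_trans.
    by rewrite -raddfB; exact: cm_Re.
  near=> t; rewrite -raddfB /= (near qE t) //.
  by case: (q t) => u v; rewrite /rc /= mul0r subr0.
apply: (key _ _ (fun t => complex.Im (q t))) => [e /qd[r r0 rP]|].
  exists r => // t /rP; apply: le_lt_trans.
  by rewrite -raddfB; exact: cm_Im.
near=> t; rewrite -raddfB /= (near qE t) //.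
by case: (q t) => u v; rewrite /rc /= mul0r addr0.
Unshelve. all: by end_near. Qed.

Lemma cont_on_Re a b F : cont_on a b F ->
  {within `[a, b], continuous (fun t => complex.Re (F t))}.
Proof.
move=> cf; apply/subspace_continuousP => s; rewrite /= in_itv /= => sab.
apply/cvgrPdist_lt => e e0; have [d d0 dP] := cf s sab e e0.
apply/nbhs_dist; exists d => // t ts; rewrite /= in_itv /= => tab.
apply: le_lt_trans _ (dP t tab ts); rewrite distrC /from_subspace -raddfB.
exact: cm_Re.
Qed.

Lemma cont_on_Im a b F : cont_on a b F ->
  {within `[a, b], continuous (fun t => complex.Im (F t))}.
Proof.
move=> cf; apply/subspace_continuousP => s; rewrite /= in_itv /= => sab.
apply/cvgrPdist_lt => e e0; have [d d0 dP] := cf s sab e e0.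
apply/nbhs_dist; exists d => // t ts; rewrite /= in_itv /= => tab.
apply: le_lt_trans _ (dP t tab ts); rewrite distrC /from_subspace -raddfB.
exact: cm_Im.
Qed.

(** The factor 2 comes from applying the real mean value theorem to real and imaginary parts
    separately. The exceptional points, corners of the path, are removed one by one by cutting the
    interval there. *)
Lemma mean_value_ineq (E : seq R) (M : R) F a b : a <= b -> 0 <= M -> cont_on a b F ->
  (forall x, a < x < b -> x \notin E -> exists2 d, cder F x d & cm d <= M) ->
  cm (F b - F a) <= 2 * M * (b - a).
Proof.
move=> + M0; elim: E a b => [|e E IH] a b ab cF dF; last first.
  have [/andP[ae eb]|ne] := boolP (a < e < b); last first.
    apply: IH => // x xab xE; apply: dF => //; rewrite inE negb_or xE andbT.
    by apply: contraNneq ne => <-.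
  have h1 := IH a e (ltW ae); have h2 := IH e b (ltW eb).
  have {}h1 : cm (F e - F a) <= 2 * M * (e - a).
    apply: h1; first by apply: cont_on_sub cF; lra.
    move=> x xae xE; apply: dF; first by lra.
    by rewrite inE negb_or xE andbT lt_eqF //; lra.
  have {}h2 : cm (F b - F e) <= 2 * M * (b - e).
    apply: h2; first by apply: cont_on_sub cF; lra.
    move=> x xae xE; apply: dF; first by lra.
    by rewrite inE negb_or xE andbT gt_eqF //; lra.
  have := cm_tri (F b) (F e) (F a).
  have -> : 2 * M * (b - a) = 2 * M * (b - e) + 2 * M * (e - a) by ring.
  by lra.
pose dd x := xget 0 [set d | cder F x d /\ cm d <= M].
have ddP x : x \in `]a, b[ -> cder F x (dd x) /\ cm (dd x) <= M.
  rewrite in_itv /= => xab; have [//|d d1 d2] := dF x xab.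
  exact: (xgetPex 0 (ex_intro (fun d => cder F x d /\ cm d <= M) d (conj d1 d2))).
move: ab; rewrite le_eqVlt => /predU1P[->|ab].
  by rewrite !subrr cm0 mulr0.
have [c1 /ddP[_ c1M] E1] :=
  MVT ab (fun x xab => (cder_is_derive (ddP x xab).1).1) (cont_on_Re cF).
have [c2 /ddP[_ c2M] E2] :=
  MVT ab (fun x xab => (cder_is_derive (ddP x xab).1).2) (cont_on_Im cF).
apply: le_trans (cm_ReIm _) _; rewrite !raddfB E1 E2 !normrM.
have ba : 0 < b - a by rewrite subr_gt0.
rewrite (gtr0_norm ba) -mulrDl ler_pM2r //.
by have := cm_Re (dd c1); have := cm_Im (dd c2); lra.
Qed.
End ComplexDerivative.

(** * Path integrals of polynomials *)

Section Partition.
Variable R : realType.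

(** Induction along a partition, which carries facts about the C1 pieces over to the whole path. *)
Lemma partition_glue (Q P : R -> R -> Prop) (a b : R) (s : seq R) : a != b ->
  itv_partition a b s ->
  (forall i, (i < size s)%N -> Q (nth 0 (a :: s) i) (nth 0 s i)) ->
  (forall u v, a <= u -> u < v -> v <= b -> Q u v -> P u v) ->
  (forall u v w, a <= u -> u < v -> v < w -> w <= b -> P u v -> P v w -> P u w) ->
  P a b.
Proof.
move=> + [+ +] + QP glue.
suff H : forall s c, a <= c -> c != b -> path <%R c s -> last c s == b ->
    (forall i, (i < size s)%N -> Q (nth 0 (c :: s) i) (nth 0 s i)) -> P c b.
  by move=> ab p l QQ; exact: H QQ.
elim=> [|v s' IH] c ac cb /=; first by rewrite (negPf cb).
move=> /andP[cv pv] lv QQ.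
have Pcv : v <= b -> P c v by move=> vb; apply: QP => //; exact: (QQ 0%N).
have [vb|vb] := eqVneq v b; first by rewrite -vb; apply: Pcv; rewrite vb.
have Pvb : P v b.
  apply: IH => //; first by rewrite (le_trans ac) // ltW.
  by move=> i si; exact: (QQ i.+1).
have vb' : v < b.
  case: (s') pv lv => [|w s'' pv /eqP<-]; first by rewrite /= (negPf vb).
  have := order_path_min lt_trans pv => /allP/(_ (last v (w :: s''))).
  by rewrite /= mem_last; exact.
by apply: (glue c v b) => //; apply: Pcv; exact: ltW.
Qed.

Local Notation mu := (@lebesgue_measure R).

Lemma integrable_oo_cc (f : R -> R) (u v : R) :
  mu.-integrable `]u, v[ (EFin \o f) -> mu.-integrable `[u, v] (EFin \o f).
Proof.
move=> /integrableP[mf lf];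
  have mf' : measurable_fun `]u, v[ f by exact/measurable_EFinP.
have mabs : measurable_fun `]u, v[ (fun x =>
  `|(EFin \o f) x|%E) by exact: measurableT_comp.
apply/integrableP; split.
  apply/measurable_EFinP; apply/measurable_fun_itv_obnd_cbndP.
  exact/measurable_fun_itv_bndo_bndcP.
rewrite -integral_itv_obnd_cbnd; last exact/emeasurable_fun_itv_bndo_bndcP.
by rewrite -integral_itv_bndo_bndc.
Qed.

Lemma integrable_setU_itv (f : R -> R) (u v w : R) : u < v -> v < w ->
  mu.-integrable `[u, v] (EFin \o f) -> mu.-integrable `[v, w] (EFin \o f) ->
  mu.-integrable `[u, w] (EFin \o f) /\
  \int[mu]_(x in `[u, w]) f x = \int[mu]_(x in `[u,
    v]) f x + \int[mu]_(x in `[v, w]) f x.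
Proof.
move=> uv vw i1 i2.
have i2' : mu.-integrable `]v, w] (EFin \o f).
  by apply: integrableS i2 => //; apply: subset_itvr; rewrite bnd_simp.
have E : `[u, w]%classic = `[u, v]%classic `|` `]v, w]%classic.
  by apply: itv_bndbnd_setU; rewrite bnd_simp ltW.
have dis : [disjoint `[u, v]%classic & `]v, w]%classic].
  apply/disj_setPLR => x /=; rewrite !in_itv /= => /andP[_ xv].
  by apply/negP; rewrite negb_and -leNgt xv.
have i : mu.-integrable `[u, w] (EFin \o f).
  rewrite E; move: i1 i2' => /integrableP[m1 l1] /integrableP[m2 l2].
  have m : measurable_fun (`[u, v]%classic `|` `]v, w]%classic) (EFin \o f).
    by apply/measurable_funU => //; split.
  have mabs : measurable_fun (`[u, v]%classic `|` `]v, w]%classic)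
      (fun x => `|(EFin \o f) x|%E) by exact: measurableT_comp.
  apply/integrableP; split=> //; rewrite ge0_integral_setU //=.
  exact: lte_add_pinfty.
split=> //; rewrite E Rintegral_setU //; last by rewrite -E.
by congr (_ + _); rewrite Rintegral_itv_obnd_cbnd.
Qed.

(** The integrand is only known inside the piece, since the two-sided derivative in [velocity] says
    nothing at a corner; the end points have measure zero. *)
Lemma integral_piece (phi h G : R -> R) (u v : R) : u < v ->
  {within `[u, v], continuous h} -> {within `[u, v], continuous G} ->
  (forall x, u < x < v -> is_derive x (1 : R) G (h x)) ->
  (forall x, u < x < v -> phi x = h x) ->
  mu.-integrable `[u, v] (EFin \o phi) /\ \int[mu]_(x in `[u, v]) phi x = G v - G u.
Proof.
move=> uv ch cG dG ph.
have ih : mu.-integrable `[u, v] (EFin \o h).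
  apply: continuous_compact_integrable => //; exact: segment_compact.
have ih' : mu.-integrable `]u, v[ (EFin \o h).
  by apply: integrableS ih => //; exact: subset_itv_oo_cc.
have ip' : mu.-integrable `]u, v[ (EFin \o phi).
  apply: eq_integrable ih' => // x; rewrite inE /= in_itv /= => xuv.
  by rewrite ph.
have ip := integrable_oo_cc ip'; split=> //.
have oo_cc f : mu.-integrable `[u, v] (EFin \o f) ->
    \int[mu]_(x in `[u, v]) f x = \int[mu]_(x in `]u, v[) f x.
  move=> fi; rewrite -Rintegral_itv_obnd_cbnd; last first.
    by apply: integrableS fi => //; apply: subset_itvr; rewrite bnd_simp.
  by rewrite -Rintegral_itv_bndo_bndc // ; apply: integrableS fi => //;
    exact: subset_itv_oo_cc.
have eqI : \int[mu]_(x in `]u, v[) phi x = \int[mu]_(x in `]u, v[) h x.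
  by apply: eq_Rintegral => x; rewrite inE /= in_itv /= => xuv; rewrite ph.
rewrite (oo_cc _ ip) eqI -(oo_cc _ ih) /Rintegral (@continuous_FTC2 _ h G) //.
  split.
  - by move=> x; rewrite in_itv /= => /dG[].
  - by have /continuous_within_itvP := cG => /(_ uv)[].
  - by have /continuous_within_itvP := cG => /(_ uv)[].
by move=> x; rewrite in_itv /= => /dG dGx; rewrite derive1E derive_val.
Qed.
End Partition.

Section PathIntegral.
Variable R : realType.
Local Notation C := (cplx R).
Variable c : R -> C.
Hypothesis psc : piecewise_smooth c.

Lemma path_cont : cont_on 0 1 c.
Proof. by case: psc => /within_cont_on. Qed.

Lemma C1_cder u v : C1_on (fun t => complex.Re (c t)) u v -> C1_on (fun t =>
  complex.Im (c t)) u v ->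
  exists2 d : R -> C, cont_on u v d & forall x, u < x < v ->
    cder c x (d x) /\ velocity c x = d x.
Proof.
move=> [f1 cf1 df1] [f2 cf2 df2]; exists (fun t => Complex (f1 t) (f2 t)).
  move=> s suv e e0; have e2 : 0 < e / 2 by lra.
  move: cf1 cf2 => /subspace_continuousP c1 /subspace_continuousP c2.
  have suv' : [set` `[u, v]] s by rewrite /= in_itv.
  have /cvgrPdist_lt/(_ _ e2)/nbhs_dist[r1 r10 r1P] := c1 s suv'.
  have /cvgrPdist_lt/(_ _ e2)/nbhs_dist[r2 r20 r2P] := c2 s suv'.
  exists (Num.min r1 r2); first by rewrite lt_min r10.
  move=> t tuv; rewrite lt_min => /andP[/r1P h1 /r2P h2].
  have tuv' : [set` `[u, v]] t by rewrite /= in_itv.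
  have {}h1 := h1 tuv'; have {}h2 := h2 tuv'.
  apply: le_lt_trans (cm_ReIm _) _ => /=.
  by rewrite (distrC (f1 t)) (distrC (f2 t)); rewrite /from_subspace in h1 h2; lra.
move=> x xuv; have xuv' : x \in `]u, v[ by rewrite in_itv.
have d1 := df1 x xuv'; have d2 := df2 x xuv'.
split; first exact: cder_ReIm.
by rewrite /velocity !derive1E !derive_val.
Qed.

Lemma path_cder : exists (E : seq R) (M : R), 0 <= M /\
  forall x, 0 < x < 1 -> x \notin E -> exists2 d, cder c x d & cm d <= M.
Proof.
case: psc => cc [s s01 sP].
apply: (partition_glue (Q := fun u v => C1_on (fun t => complex.Re (c t)) u v /\
   C1_on (fun t => complex.Im (c t)) u v)
  (P := fun u v => exists (E : seq R) (M : R), 0 <= M /\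
    forall x, u < x < v -> x \notin E ->
      exists2 d, cder c x d & cm d <= M) _ s01) => //.
- by rewrite lt_eqF.
- move=> u v _ uv _ [c1 c2]; have [d cd dP] := C1_cder c1 c2.
  have [M M0 MP] := cont_on_max (ltW uv) cd.
  exists [::], M; split; first exact: ltW.
  by move=> x xuv _; exists (d x); [case: (dP x xuv) | apply: MP; lra].
move=> u v w _ uv vw _ [E1 [M1 [M10 H1]]] [E2 [M2 [M20 H2]]].
exists (v :: E1 ++ E2), (M1 + M2); split; first by lra.
move=> x xuw; rewrite inE mem_cat !negb_or => /and3P[xv xE1 xE2].
have [xltv|] := ltP x v.
  have [|//|d d1 d2] := H1 x; first by lra.
  by exists d => //; lra.
rewrite le_eqVlt eq_sym (negPf xv) /= => vx.
have [|//|d d1 d2] := H2 x; first by lra.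
by exists d => //; lra.
Qed.

Lemma path_integral_poly (f T : {poly C}) : T^`() = f ->
  path_integral c (fun x => f.[x]) = T.[c 1] - T.[c 0].
Proof.
move=> Tf; case: psc => cc [s s01 sP].
have cT : cont_on 0 1 (fun t => T.[c t]) by apply: cont_on_poly path_cont.
have H : (lebesgue_measure.-integrable `[0, 1] (EFin \o (fun t =>
  complex.Re (f.[c t] * velocity c t))) /\
    \int[lebesgue_measure]_(t in `[0, 1]) complex.Re (f.[c t] * velocity c t) =
    complex.Re T.[c 1] - complex.Re T.[c 0]) /\
  (lebesgue_measure.-integrable `[0, 1] (EFin \o (fun t =>
    complex.Im (f.[c t] * velocity c t))) /\
    \int[lebesgue_measure]_(t in `[0, 1]) complex.Im (f.[c t] * velocity c t) =
    complex.Im T.[c 1] - complex.Im T.[c 0]).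
  apply: (partition_glue (Q := fun u v => C1_on (fun t => complex.Re (c t)) u v /\
     C1_on (fun t => complex.Im (c t)) u v)
  (P := fun u v => (lebesgue_measure.-integrable `[u, v] (EFin \o (fun t =>
    complex.Re (f.[c t] * velocity c t))) /\
    \int[lebesgue_measure]_(t in `[u, v]) complex.Re (f.[c t] * velocity c t) =
    complex.Re T.[c v] - complex.Re T.[c u]) /\
  (lebesgue_measure.-integrable `[u, v] (EFin \o (fun t =>
    complex.Im (f.[c t] * velocity c t))) /\
    \int[lebesgue_measure]_(t in `[u, v]) complex.Im (f.[c t] * velocity c t) =
    complex.Im T.[c v] - complex.Im T.[c u])) _ s01) => //.
  - by rewrite lt_eqF.
  - move=> u v u0 uv v1 [c1 c2]; have [d cd dP] := C1_cder c1 c2.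
    have ch : cont_on u v (fun t => f.[c t] * d t).
      by apply: cont_onM => //; apply: cont_on_poly; apply: cont_on_sub path_cont.
    have cTuv : cont_on u v (fun t => T.[c t]) by apply: cont_on_sub cT.
    have dT x : u < x < v -> cder (fun t => T.[c t]) x (f.[c x] * d x).
      by move=> xuv; rewrite -Tf; apply: cder_poly; case: (dP x xuv).
    have vE x : u < x < v -> f.[c x] * velocity c x = f.[c x] * d x.
      by move=> xuv; case: (dP x xuv) => _ ->.
    split.
      apply: (integral_piece uv (cont_on_Re ch) (cont_on_Re cTuv)) => x xuv.
        exact: (cder_is_derive (dT x xuv)).1.
      by rewrite vE.
    apply: (integral_piece uv (cont_on_Im ch) (cont_on_Im cTuv)) => x xuv.
      exact: (cder_is_derive (dT x xuv)).2.
    by rewrite vE.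
  move=> u v w _ uv vw _ [[i1 e1] [i1' e1']] [[i2 e2] [i2' e2']].
  have [i e] := integrable_setU_itv uv vw i1 i2.
  have [i' e'] := integrable_setU_itv uv vw i1' i2'.
  split; split=> //.
    by rewrite e e1 e2; ring.
  by rewrite e' e1' e2'; ring.
case: H => [[_ H1] [_ H2]]; rewrite /path_integral H1 H2.
by case: T.[c 1] T.[c 0] => [? ?] [? ?].
Qed.
End PathIntegral.

(** * A differential equation with half-integer exponent *)

Section HalfIntegerEquation.
Variable R : realType.
Local Notation C := (cplx R).
Variable r0 : nat.

Let beta : C := r0%:R + 2^-1.
(** An upper bound for all |j/(j - beta)|, whose largest value 2 r0 + 2 is reached at j = r0 + 1. *)
Let kappa : R := 2 * r0%:R + 4.

Let cm_jbeta j : cm (j%:R - beta) = `|j%:R - r0%:R - 2^-1| :> R.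
Proof.
rewrite -cm_rc !rcB; congr cm; rewrite /beta opprD addrA; congr (_ - _ - _).
- by rewrite /rc rmorph_nat.
- by rewrite /rc rmorph_nat.
by rewrite /rc fmorphV rmorph_nat.
Qed.

Let jbeta_ge j : 2^-1 <= cm (j%:R - beta).
Proof.
rewrite cm_jbeta; have [h|h] := leqP j r0.
  have : (j%:R : R) <= r0%:R by rewrite ler_nat.
  by move=> h'; rewrite ler0_norm; lra.
have : (r0.+1%:R : R) <= j%:R by rewrite ler_nat.
by rewrite -natr1 => h'; rewrite ger0_norm; lra.
Qed.

Let jbeta_neq0 j : j%:R - beta != 0.
Proof. by rewrite -cm_gt0; apply: lt_le_trans (jbeta_ge j); rewrite invr_gt0. Qed.

Let ratio_le j : cm (j%:R / (j%:R - beta)) <= kappa.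
Proof.
rewrite cmM cmV cm_nat ler_pdivrMr ?cm_gt0 // cm_jbeta /kappa.
have r00 : 0 <= r0%:R :> R by [].
have [h|h] := leqP j r0.
  have : (j%:R : R) <= r0%:R by rewrite ler_nat.
  by move=> h'; rewrite ler0_norm; nra.
have : (r0.+1%:R : R) <= j%:R by rewrite ler_nat.
by rewrite -natr1 => h'; rewrite ger0_norm; nra.
Qed.

Variable tau : C.

(* [half_sol j] is the polynomial solution of [(w - tau) A' - beta A = w^j]; it
   exists because [beta] is not an integer. *)
Fixpoint half_sol (j : nat) : {poly C} :=
  if j is j'.+1 then
    (j%:R - beta)^-1 *: ('X^j + (j%:R * tau) *: half_sol j')
  else (- beta)^-1%:P.

Let half_solE j w :
  (w - tau) * (half_sol j)^`().[w] - beta * (half_sol j).[w] = w ^+ j.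
Proof.
elim: j => [|j IH].
  have b0 := jbeta_neq0 0; rewrite sub0r oppr_eq0 in b0.
  by rewrite /= derivC horner0 hornerC mulr0 sub0r expr0 invrN mulrN divff // opprK.
have b0 := jbeta_neq0 j.+1.
rewrite [half_sol _]/= derivZ derivD derivXn derivZ !(hornerD, hornerZ,
  hornerMn, hornerXn).
apply: (mulfI b0); rewrite mulrBr.
have -> : (j.+1%:R - beta) * ((w - tau) * ((j.+1%:R - beta)^-1 *
    (w ^+ j *+ j.+1 + j.+1%:R * tau * (half_sol j)^`().[w]))) =
    (w - tau) * (w ^+ j *+ j.+1) + j.+1%:R * tau * ((w - tau) * (half_sol j)^`().[w]).
  by rewrite mulrCA mulVKf //; ring.
have -> : (j.+1%:R - beta) * (beta * ((j.+1%:R - beta)^-1 *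
   (w ^+ j.+1 + j.+1%:R * tau * (half_sol j).[w]))) =
   beta * w ^+ j.+1 + j.+1%:R * tau * (beta * (half_sol j).[w]).
  by rewrite mulrCA mulVKf //; ring.
have E : (w - tau) * (half_sol j)^`().[w] = w ^+ j + beta * (half_sol j).[w].
  by rewrite -IH subrK.
rewrite E exprS -[w ^+ j *+ _]mulr_natr; ring.
Qed.

(** The recursion multiplies the previous solution by tau j/(j - beta), of modulus at most kappa
    |tau|; this is why [m] must exceed that number. *)
Let half_sol_bound j m w : cm w <= m -> kappa * cm tau <= m ->
  cm (half_sol j).[w] <= 2 * (2 * m) ^+ j.
Proof.
move=> wm km; have m0 : 0 <= m by apply: le_trans wm; exact: cm_ge0.
have inv_le i : (cm (i%:R - beta))^-1 <= 2.
  by rewrite -[leRHS]invrK lef_pV2 ?posrE ?invr_gt0 ?cm_gt0.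
elim: j => [|j IH].
  rewrite /= hornerC cmV cmN expr0 mulr1.
  by have := inv_le 0; rewrite sub0r cmN.
rewrite [half_sol _]/= hornerZ hornerD hornerXn hornerZ mulrDr.
have -> : (j.+1%:R - beta)^-1 * (j.+1%:R * tau * (half_sol j).[w]) =
  (j.+1%:R / (j.+1%:R - beta)) * tau * (half_sol j).[w] by ring.
apply: le_trans (cmD _ _) _; rewrite !(cmM, cmV, cmX).
have h1 : (cm (j.+1%:R - beta))^-1 * cm w ^+ j.+1 <= 2 * m ^+ j.+1.
  rewrite ler_pM ?invr_ge0 ?exprn_ge0 ?cm_ge0 ?inv_le //.
  by apply: lerXn2r; rewrite ?nnegrE ?cm_ge0.
have h2 : cm (j.+1%:R) / cm (j.+1%:R - beta) * cm tau * cm (half_sol j).[w] <=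
  m * (2 * (2 * m) ^+ j).
  rewrite ler_pM ?mulr_ge0 ?invr_ge0 ?cm_ge0 //; apply: le_trans km.
  by rewrite ler_wpM2r ?cm_ge0 // -cmV -cmM.
apply: le_trans (lerD h1 h2) _.
have -> : 2 * m ^+ j.+1 + m * (2 * (2 * m) ^+ j) = 2 * (m ^+ j.+1 * (1 + 2 ^+ j)).
  rewrite !exprMn exprS; ring.
rewrite exprMn [2 ^+ j.+1 * _]mulrC ler_pM2l // ler_wpM2l ?exprn_ge0 //.
have : 1 <= (2 : R) ^+ j by rewrite exprn_ege1 // ler1n.
by rewrite exprS; lra.
Qed.

(** At 0 the solution [half_sol j] is a monomial of degree j in [tau], with this coefficient; it is
    never zero, as beta is not an integer. *)
Fixpoint half_sol0 (j : nat) : C :=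
  if j is j'.+1 then j%:R / (j%:R - beta) * half_sol0 j' else (- beta)^-1.

Let half_sol_at0 j : (half_sol j).[0] = half_sol0 j * tau ^+ j.
Proof.
elim: j => [|j IH]; first by rewrite /= hornerC expr0 mulr1.
rewrite [half_sol _]/= hornerZ hornerD hornerXn hornerZ IH expr0n /= add0r exprS.
by rewrite /=; ring.
Qed.

Lemma half_sol0_gt0 j : 0 < cm (half_sol0 j).
Proof.
elim: j => [|j IH] /=.
  by rewrite cmV invr_gt0 cm_gt0; have := jbeta_neq0 0; rewrite sub0r.
by rewrite cmM mulr_gt0 // cmM mulr_gt0 // ?cmV ?invr_gt0 cm_gt0 ?jbeta_neq0 //
  pnatr_eq0.
Qed.

(** By linearity A is the combination of the [half_sol j] with the coefficients of [G]. When [G]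
    starts in degree r0, A(0) is its tau^r0 term up to a remainder of order r0 + 1: the condition on
    [rho] makes the ratio 2 kappa |tau| / rho at most 1, so all higher powers are bounded by the
    power r0 + 1. *)
Lemma half_integer_equation (G : {poly C}) : exists A : {poly C},
  [/\ forall w, (w - tau) * A^`().[w] - (r0%:R + 2^-1) * A.[w] = G.[w],
    forall m w, cm w <= m -> (2 * r0%:R + 4) * cm tau <= m ->
      cm A.[w] <= 2 * pn (2 * m) G &
    forall rho, 0 < rho -> (forall j, (j < r0)%N -> G`_j = 0) ->
      2 * ((2 * r0%:R + 4) * cm tau) <= rho ->
      cm (half_sol0 r0) * cm G`_r0 * cm tau ^+ r0 -
        2 * ((2 * ((2 * r0%:R + 4) * cm tau)) / rho) ^+ r0.+1 * pn rho G <= cm A.[0]].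
Proof.
pose n := maxn (size G) r0.+1.
have sn : (size G <= n)%N by rewrite leq_maxl.
have rn : (r0 < n)%N by rewrite leq_maxr.
exists (\sum_(j < n) G`_j *: half_sol j); split.
- move=> w; rewrite raddf_sum /= !horner_sum !mulr_sumr -sumrB.
  rewrite (horner_coef_wide w sn); apply: eq_bigr => j _.
  by rewrite derivZ !hornerZ -half_solE mulrBr !mulrA ![_ * G`_j]mulrC.
- move=> m w wm km; rewrite horner_sum; apply: le_trans (cm_sum _ _) _.
  have m0 : 0 <= 2 * m by rewrite mulr_ge0 //; apply: le_trans wm; exact: cm_ge0.
  rewrite (pnE _ sn) mulr_sumr; apply: ler_sum => j _.
  by rewrite hornerZ cmM mulrCA ler_wpM2l ?cm_ge0 ?half_sol_bound.
move=> rho rho0 Gj hrho.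
rewrite horner_sum (bigD1 (Ordinal rn)) //= hornerZ half_sol_at0.
set S := \sum_(i < n | _) _.
have kappa0 : 0 <= kappa by rewrite addr_ge0 // mulr_ge0.
have Sle : cm S <= 2 * ((2 * ((2 * r0%:R + 4) * cm tau)) / rho) ^+ r0.+1 * pn rho G.
  have q0 : 0 <= 2 * ((2 * r0%:R + 4) * cm tau) / rho.
    by rewrite divr_ge0 ?(ltW rho0) // !mulr_ge0 ?cm_ge0 // addr_ge0 // mulr_ge0.
  have q1 : 2 * ((2 * r0%:R + 4) * cm tau) / rho <= 1 by rewrite ler_pdivrMr // mul1r.
  rewrite /S big_mkcond /=; apply: le_trans (cm_sum _ _) _.
  rewrite (pnE _ sn) mulr_sumr; apply: ler_sum => j _.
  case: ifP => [jr|_]; last first.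
    by rewrite cm0 !mulr_ge0 ?exprn_ge0 ?cm_ge0 ?(ltW rho0).
  rewrite hornerZ cmM; have [jlt|jge] := ltnP j r0.
    by rewrite Gj // cm0 !mul0r mulr0.
  have jlt : (r0 < j)%N by rewrite ltn_neqAle jge andbT; move: jr;
    rewrite -val_eqE /= eq_sym.
  have := @half_sol_bound j (kappa * cm tau) 0; rewrite cm0 => /(_ _ (lexx _)) h.
  have {}h := h (mulr_ge0 kappa0 (cm_ge0 _)).
  rewrite mulrCA; apply: ler_wpM2l; first exact: cm_ge0.
  apply: le_trans h _; rewrite -[leRHS]mulrA ler_pM2l //.
  have -> : (2 * (kappa * cm tau)) ^+ j = (2 * (kappa * cm tau) / rho) ^+ j * rho ^+ j.
    by rewrite -exprMn divfK // gt_eqF.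
  rewrite ler_wpM2r ?exprn_ge0 ?(ltW rho0) //.
  by apply: ler_wiXn2l.
have := cm_rtri (G`_r0 * (half_sol0 r0 * tau ^+ r0)) (- S).
rewrite opprK cmN !(cmM, cmX); move: Sle; set y := _ * pn rho G.
have -> : cm G`_r0 * (cm (half_sol0 r0) * cm tau ^+ r0) = cm (half_sol0 r0) *
  cm G`_r0 * cm tau ^+ r0 by ring.
by lra.
Qed.
End HalfIntegerEquation.

(** * Localization at the base point *)

Section Localization.
Variable R : realType.
Local Notation C := (cplx R).
Implicit Types (s t x : R) (w : C).
Variables (P Q : {poly C}) (c : R -> C) (z0 : C).
Let g (s : R) : C := P.[c s].
Variables (ex : seq R) (Mc : R).
Hypothesis Mc0 : 0 <= Mc.
Hypothesis c_cont : cont_on 0 1 c.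
Hypothesis c_der : forall x, 0 < x < 1 -> x \notin ex ->
  exists2 d, cder c x d & cm d <= Mc.
Hypothesis g0 : g 0 = z0.
Hypothesis g1 : g 1 = z0.
Hypothesis g_neq : forall s, 0 < s < 1 -> g s != z0.
Hypothesis moments0 : forall p T :
  {poly C}, T^`() = (p \Po P) * Q * P^`() -> T.[c 0] = T.[c 1].
Variables (om : R -> C) (N : nat).
Hypothesis N0 : (0 < N)%N.
Hypothesis Aom : Afun g om.
Hypothesis omN : forall s, 0 <= s <= 1 -> om s ^+ N = g s - z0.

Let g_cont : cont_on 0 1 g. Proof. exact: cont_on_poly. Qed.

Let om0 : om 0 = 0.
Proof.
have h : 0 <= (0 : R) <= 1 by lra.
by have := omN h; rewrite g0 subrr => /eqP; rewrite expf_eq0 N0 => /eqP.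
Qed.

Let om1 : om 1 = 0.
Proof.
have h : 0 <= (1 : R) <= 1 by lra.
by have := omN h; rewrite g1 subrr => /eqP; rewrite expf_eq0 N0 => /eqP.
Qed.

Let om_neq0 s : 0 < s < 1 -> om s != 0.
Proof.
move=> s01; have := g_neq s01; rewrite -subr_eq0 -omN; last by lra.
by rewrite expf_eq0 N0.
Qed.

Let near01 x : 0 < x < 1 -> \forall t \near x, 0 <= t <= 1.
Proof.
move=> x01; apply/nbhs_dist; exists (Num.min x (1 - x)); first by rewrite lt_min; lra.
by move=> t; rewrite lt_min !ltr_norml; lra.
Qed.

Let cont_ccvg f x : cont_on 0 1 f -> 0 < x < 1 -> ccvg f x (f x).
Proof.
move=> cf x01 e e0; have [|d d0 dP] := cf x _ e e0; first by lra.
have n1 := near01 x01; near=> t; apply: dP; first by near: t.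
by near: t; apply/nbhs_dist; exists d.
Unshelve. all: by end_near. Qed.

Let om_cder x dg : 0 < x < 1 -> cder g x dg ->
  exists2 d, cder om x d & N%:R * om x ^+ N.-1 * d = dg.
Proof.
move=> x01 dG; have n1 := near01 x01.
have ox := om_neq0 x01.
have K0 : N%:R * om x ^+ N.-1 != 0 by rewrite mulf_neq0 ?expf_neq0 // pnatr_eq0 -lt0n.
exists (dg / (N%:R * om x ^+ N.-1)); last by rewrite mulrC divfK.
apply: (@cder_root _ N om (fun t => g t - z0)) => //.
- by apply: cont_ccvg => //; exact: Afun_cont Aom.
- by near=> t; apply: omN; near: t.
- by have := cderB dG (cder_cst z0 x); rewrite subr0.
Unshelve. all: by end_near. Qed.

Let inv_root_cder r tau x dom : Afun g r ->
  (forall s, 0 <= s <= 1 -> r s ^+ 2 * (om s - tau) = 1) ->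
  0 < x < 1 -> cder om x dom -> cder r x (- (r x ^+ 3 * dom / 2)).
Proof.
move=> Ar rE x01 dom'; have n1 := near01 x01; have x01' : 0 <= x <= 1 by lra.
have rE' t : 0 <= t <= 1 -> om t - tau != 0 /\ r t ^+ 2 = (om t - tau)^-1.
  move=> /rE E; have h : om t - tau != 0.
    by apply/eqP => h; move: E; rewrite h mulr0 => /esym/eqP; rewrite oner_eq0.
  by split=> //; apply: (mulIf h); rewrite E mulVf.
have [ox r2] := rE' x x01'.
have rx0 : r x != 0.
  apply/eqP => rx0; move: r2; rewrite rx0 expr0n => /esym/eqP.
  by rewrite invr_eq0 (negPf ox).
have -> : - (r x ^+ 3 * dom / 2) = - ((dom - 0) / (om x - tau) ^+ 2) / (2%:R *
  r x ^+ 2.-1).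
  have -> : (om x - tau) = (r x ^+ 2)^-1 by rewrite r2 invrK.
  by rewrite subr0 /= expr1; field; rewrite rx0.
apply: (@cder_root _ 2 r (fun t => (om t - tau)^-1)) => //.
- by apply: cont_ccvg => //; exact: Afun_cont Ar.
- near=> t; have t01 : 0 <= t <= 1 by near: t.
  by have [_] := rE' t t01.
- exact: (cder_inv ox (cderB dom' (cder_cst tau x))).
Unshelve. all: by end_near. Qed.

(** With r = (om - tau)^(-1/2) and dg = N om^(N-1) d om, the equation for A says that (om -
    tau)^(-n-1/2) A(om) is a primitive of (om - tau)^(-n-3/2) f(om) dg. *)
Let primitive_cder r tau n (f A : {poly C}) x dg : Afun g r ->
  (forall s, 0 <= s <= 1 -> r s ^+ 2 * (om s - tau) = 1) ->
  (forall w, (w - tau) * A^`().[w] - (n%:R + 2^-1) * A.[w] = (f * (N%:R *: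
    'X^(N.-1))).[w]) ->
  0 < x < 1 -> cder g x dg ->
  cder (fun s => r s ^+ (2 * n + 1) * A.[om s]) x (r x ^+ (2 * n + 3) * f.[om x] * dg).
Proof.
move=> Ar rE AE x01 dG; have [d dom dE] := om_cder x01 dG.
have dr := inv_root_cder Ar rE x01 dom.
have dX m : cder (fun s => r s ^+ m.+1) x (m.+1%:R * r x ^+ m * - (r x ^+ 3 * d / 2)).
  have := cder_poly 'X^(m.+1) dr; rewrite derivXn hornerMn hornerXn -mulr_natl.
  by apply: cder_near; near=> t; rewrite hornerXn.
have := cderM (dX (2 * n)%N) (cder_poly A dom).
have x01' : 0 <= x <= 1 by lra.
rewrite addn1 => H; rewrite addn3.
have -> : r x ^+ (2 * n).+3 * f.[om x] * dg =
  (2 * n).+1%:R * r x ^+ (2 * n) * - (r x ^+ 3 * d / 2) * A.[om x] +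
  r x ^+ (2 * n).+1 * (A^`().[om x] * d); last exact: H.
have := AE (om x); rewrite hornerM hornerZ hornerXn => AEx.
rewrite -[LHS]mulrA; have -> :
  f.[om x] * dg = ((om x - tau) * A^`().[om x] - (n%:R + 2^-1) * A.[om x]) * d.
  by rewrite AEx -dE; ring.
have -> : r x ^+ (2 * n).+1 * (A^`().[om x] * d) = (r x ^+ 2 * (om x - tau)) *
  (r x ^+ (2 * n).+1 * (A^`().[om x] * d)).
  by rewrite rE // mul1r.
rewrite (_ : (2 * n).+1%:R = 2 * n%:R + 1 :> C); last by rewrite -natr1 natrM.
rewrite !exprS; field.
Unshelve. all: by end_near. Qed.

Variables (eta rho B C0 : R) (fa fb : nat -> {poly C}).
Hypothesis eta_gt0 : 0 < eta.
Hypothesis eta_lt : eta + eta < 1.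
Hypothesis rho0 : 0 < rho.
Hypothesis B0 : 0 < B.
Hypothesis C00 : 0 < C0.
Hypothesis faB : forall m, pn rho (fa m) <= B.
Hypothesis fbB : forall m, pn rho (fb m) <= B.
Hypothesis faQ : forall m s, 0 <= s <= eta ->
  cm (Q.[c s] - (fa m).[om s]) <= C0 / 2 ^+ m.
Hypothesis fbQ : forall m s, 1 - eta <= s <= 1 ->
  cm (Q.[c s] - (fb m).[om s]) <= C0 / 2 ^+ m.
Hypothesis om_small : forall s, 0 <= s <= 1 -> (s <= eta) || (1 - eta <= s) ->
  cm (om s) <= rho / 4.
Variables (n0 m0 : nat) (cc : C).
Hypothesis cc0 : cc != 0.
Hypothesis coef_lt : forall m j, (m0 <= m)%N -> (j < n0)%N -> (fb m - fa m)`_j = 0.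
Hypothesis coef_n0 : forall m, (m0 <= m)%N -> (fb m - fa m)`_n0 = cc.
Hypothesis taus : forall h : R, 0 < h -> exists2 tau : C, cm tau < h &
  exists2 r, Afun g r & forall s, 0 <= s <= 1 -> r s ^+ 2 * (om s - tau) = 1.

Let n := (n0 + N.-1)%N.
Let B1 := B * pn rho (N%:R *: 'X^(N.-1) : {poly C}).

Let B10 : 0 <= B1.
Proof. by rewrite mulr_ge0 ?(ltW B0) // pn_ge0 // ltW. Qed.

Let c_bound : exists2 K : R, 0 < K &
  forall s, 0 <= s <= 1 -> cm Q.[c s] <= K /\ cm P^`().[c s] <= K.
Proof.
have [K1 K10 K1P] := cont_on_max ler01 (cont_on_poly Q c_cont).
have [K2 K20 K2P] := cont_on_max ler01 (cont_on_poly P^`() c_cont).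
exists (K1 + K2) => [|s s01]; first by lra.
by have := K1P s s01; have := K2P s s01; lra.
Qed.

(** On a piece near an end, the global polynomial primitive [T] and the local half-integer primitive
    have nearly equal derivatives. The error has two sources: [p] replaces r^(2n+3), and f(om)
    replaces Q(c). *)
Let compare (u v K e1 eps Kr : R) (f A p T : {poly C}) tau r :
  0 <= u -> u <= v -> v <= 1 ->
  (forall s, 0 <= s <= 1 -> cm Q.[c s] <= K /\ cm P^`().[c s] <= K) ->
  Afun g r -> (forall s, 0 <= s <= 1 -> r s ^+ 2 * (om s - tau) = 1) ->
  (forall w, (w - tau) * A^`().[w] - (n%:R + 2^-1) * A.[w] = (f * (N%:R *:
    'X^(N.-1))).[w]) ->
  (forall s, u <= s <= v -> cm (Q.[c s] - f.[om s]) <= e1) ->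
  (forall s, 0 <= s <= 1 -> cm (r s ^+ (2 * n + 3)) <= Kr) ->
  (forall s, 0 <= s <= 1 -> cm (r s ^+ (2 * n + 3) - p.[g s]) <= eps) ->
  T^`() = (p \Po P) * Q * P^`() -> 0 <= e1 -> 0 <= eps -> 0 <= Kr -> 0 <= K ->
  cm ((T.[c v] - r v ^+ (2 * n + 1) * A.[om v]) - (T.[c u] - r u ^+ (2 * n + 1)
    * A.[om u]))
   <= 2 * ((eps * K + Kr * e1) * (K * Mc)).
Proof.
move=> u0 uv v1 KP Ar rE AE fe rK pe T' e10 eps0 Kr0 K0.
set M := (eps * K + Kr * e1) * (K * Mc).
have M0 : 0 <= M by rewrite mulr_ge0 ?addr_ge0 ?mulr_ge0.
apply: le_trans (_ : 2 * M * (v - u) <= _); last first.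
  have M20 : 0 <= 2 * M by lra.
  by rewrite ler_piMr //; lra.
pose F s := T.[c s] - r s ^+ (2 * n + 1) * A.[om s].
apply: (@mean_value_ineq R ex M F) => //.
  apply: (@cont_on_sub _ 0 1) => //; apply: cont_onD; first exact: cont_on_poly.
  apply: (Afun_cont g_cont);
    apply: (Afun_ext (f := fun s => 0 - r s ^+ (2 * n + 1) * A.[om s])).
    by move=> s _; rewrite sub0r.
  apply: (AfunB g_cont); first exact: Afun_cst.
  by apply: (AfunM g_cont); [exact: AfunX | exact: Afun_poly].
move=> x xuv xex; have x01 : 0 < x < 1 by lra.
have x01' : 0 <= x <= 1 by lra.
have [d dc dM] := c_der x01 xex.
have dG : cder g x (P^`().[c x] * d) by exact: cder_poly.
have [Q1 P1] := KP x x01'.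
exists (T^`().[c x] * d - r x ^+ (2 * n + 3) * f.[om x] * (P^`().[c x] * d)).
  apply: cderB; first exact: cder_poly.
  apply: (primitive_cder Ar rE AE x01 dG).
rewrite T' !hornerM horner_comp -/(g x).
have -> : p.[g x] * Q.[c x] * P^`().[c x] * d - r x ^+ (2 * n + 3) * f.[om x] *
  (P^`().[c x] * d) =
  ((p.[g x] - r x ^+ (2 * n + 3)) * Q.[c x] + r x ^+ (2 * n + 3) * (Q.[c x] -
    f.[om x])) * (P^`().[c x] * d).
  by ring.
rewrite cmM /M ler_pM ?cm_ge0 //; last by rewrite cmM ler_pM ?cm_ge0.
apply: le_trans (cmD _ _) _; rewrite !cmM lerD // ler_pM ?cm_ge0 //.
- by rewrite cmBC pe.
- exact: rK.
- by apply: fe; lra.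
Qed.

Let pn_prod_le (f : {poly C}) K : pn rho f <= K ->
  pn rho (f * (N%:R *: 'X^(N.-1))) <= K * pn rho (N%:R *: 'X^(N.-1) : {poly C}).
Proof.
move=> fK; apply: le_trans (pnM (ltW rho0) _ _) _.
by rewrite ler_wpM2r // pn_ge0 // ltW.
Qed.

(* The constant does not depend on [tau]: along the closed path all boundary
   terms but one stay away from the singularity [tau]. *)
Let key_bound : exists2 K : R, 0 < K & exists2 h : R, 0 < h &
  forall tau r, cm tau < h -> Afun g r ->
  (forall s, 0 <= s <= 1 -> r s ^+ 2 * (om s - tau) = 1) ->
  exists2 m, (m0 <= m)%N & forall AD : {poly C},
    (forall w, (w - tau) * AD^`().[w] - (n%:R + 2^-1) * AD.[w] =
       ((fb m - fa m) * (N%:R *: 'X^(N.-1))).[w]) ->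
    (forall e w, cm w <= e -> (2 * n%:R + 4) * cm tau <= e ->
       cm AD.[w] <= 2 * pn (2 * e) ((fb m - fa m) * (N%:R *: 'X^(N.-1)))) ->
    cm (r 1 ^+ (2 * n + 1) * AD.[0]) <= K.
Proof.
have e_gt0 := eta_gt0; have e_lt := eta_lt; have rho_gt0 := rho0; have B1_ge0 := B10.
have e_le1 : eta <= 1 by lra.
have e_le_1e : eta <= 1 - eta by lra.
have e_ge0' : 0 <= 1 - eta by lra.
have e_le1' : 1 - eta <= 1 by lra.
have [K K0 KP] := c_bound.
have [mu mu0 muP] : exists2 mu :
  R, 0 < mu & forall s, eta <= s <= 1 - eta -> mu <= cm (om s).
  apply: (@cont_on_min R eta (1 - eta) om); first by lra.
    apply: (@cont_on_sub _ 0 1); [lra | lra | exact: Afun_cont Aom].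
  by move=> s se; apply: om_neq0; lra.
(* Away from the ends |om - tau| >= mu/2, so |r|^2 <= 2/mu; adding 1 bounds |r| itself without a
   square root. *)
pose K2 := 1 + 2 / mu.
have mu2 : 0 < 2 / mu by rewrite divr_gt0.
have K21 : 1 <= K2 by rewrite /K2; lra.
have K20 : 0 < K2 by lra.
pose kp : R := 2 * n%:R + 4; have kp0 : 0 < kp by rewrite /kp;
  have : 0 <= n%:R :> R by []; lra.
pose h := Num.min (mu / 2) (rho / 4 / kp).
have h0 : 0 < h by rewrite lt_min !divr_gt0.
(* [Kb] bounds each boundary term at eta and 1 - eta, [Km] the variation of [T] in between; both are
   fixed before [tau]. *)
pose Kb := K2 ^+ (2 * n + 1) * (2 * (2 * B1)).
pose Km := 2 * ((K2 ^+ (2 * n + 3) + 1) * K * (K * Mc)).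
have Kb0 : 0 <= Kb by rewrite /Kb mulr_ge0 ?exprn_ge0 ?(ltW K20) //; lra.
have Km0 : 0 <= Km by rewrite !mulr_ge0 ?(ltW K0) ?addr_ge0 ?exprn_ge0 ?(ltW K20).
exists (3 * Kb + Km + 4); first by lra.
exists h => // tau r; rewrite lt_min => /andP[tmu tkp] Ar rE.
have tk : kp * cm tau <= rho / 4 by rewrite mulrC -ler_pdivlMr // ltW.
have r_le s : eta <= s <= 1 - eta -> cm (r s) <= K2.
  move=> se; have s01 : 0 <= s <= 1 by lra.
  have os := muP s se; have ot : mu / 2 <= cm (om s - tau).
    by have := cm_rtri (om s) tau; lra.
  have r2 : cm (r s) ^+ 2 <= 2 / mu.
    have := congr1 (@cm R) (rE s s01); rewrite cmM cmX cm1 => E.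
    have ot0 : 0 < cm (om s - tau) by lra.
    rewrite -(ler_pM2r ot0) E; apply: le_trans (_ : 2 / mu * (mu / 2) <= _).
      by rewrite mulrA divfK ?gt_eqF // divff.
    by rewrite ler_pM2l.
  have [le1|lt1] := leP (cm (r s)) 1; first by lra.
  by rewrite /K2; have : cm (r s) <= cm (r s) ^+ 2; [rewrite ler_eXnr // ltW | lra].
have [Kr Kr0 KrP] := Afun_bounded g_cont (AfunX g_cont (2 * n + 3) Ar).
pose Y := K * Mc + 1.
have KM0 : 0 <= K * Mc by rewrite mulr_ge0 // ltW.
have Y0 : 0 < Y by rewrite /Y; lra.
(* The accuracy [eps] and the index [m] bring the error near each end below 1. The index comes after
   [r], because the bound [Kr] blows up as [tau] tends to 0. *)
pose eps := Num.min 1 (4 * K * Y)^-1.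
have eps0 : 0 < eps by rewrite lt_min ltr01 invr_gt0 !mulr_gt0.
have eps1 : eps <= 1 by rewrite ge_min lexx.
have epsK : eps * K <= 1 / (4 * Y).
  apply: le_trans (_ : (4 * K * Y)^-1 * K <= _).
    by rewrite ler_wpM2r ?(ltW K0) // ge_min lexx orbT.
  have -> // : (4 * K * Y)^-1 * K = 1 / (4 * Y).
  by field; rewrite !gt_eqF.
have e0 : 0 < (4 * Kr * Y)^-1 by rewrite invr_gt0 !mulr_gt0.
have [m1 m1P] := half_pow_small C0 e0.
pose m := (m0 + m1)%N; pose e1 := C0 / 2 ^+ m.
have e10 : 0 <= e1 by rewrite divr_ge0 ?exprn_ge0 // ltW.
have e1Kr : Kr * e1 <= 1 / (4 * Y).
  apply: le_trans (_ : Kr * (4 * Kr * Y)^-1 <= _).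
    rewrite ler_pM2l //; apply: le_trans m1P; rewrite ler_pM2l //.
    rewrite lef_pV2 ?posrE ?exprn_gt0 // ler_weXn2l ?ler1n //.
    by rewrite leq_addl.
  have -> // : Kr * (4 * Kr * Y)^-1 = 1 / (4 * Y).
  by field; rewrite !gt_eqF.
have small : 2 * ((eps * K + Kr * e1) * (K * Mc)) <= 1.
  apply: le_trans (_ : 2 * ((1 / (4 * Y) + 1 / (4 * Y)) * Y) <= _).
    have S1 := lerD epsK e1Kr.
    have S0 : 0 <= eps * K + Kr * e1.
      exact: addr_ge0 (mulr_ge0 (ltW eps0) (ltW K0)) (mulr_ge0 (ltW Kr0) e10).
    by rewrite ler_pM2l // ler_pM // /Y; lra.
  have -> : 2 * ((1 / (4 * Y) + 1 / (4 * Y)) * Y) = 1 by field; rewrite gt_eqF.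
  exact: lexx.
exists m; first by rewrite leq_addr.
move=> AD ADE ADb.
have [p pE] := AfunX g_cont (2 * n + 3) Ar eps0.
have [T TE] := antiderivative_exists ((p \Po P) * Q * P^`()).
have T01 := moments0 TE.
have [Aa [AaE Aab _]] := half_integer_equation n tau (fa m * (N%:R *: 'X^(N.-1))).
(* The solution at the final end is taken as that of the initial end plus [AD]: at om = 0 the two
   [Aa] terms will cancel and only the difference of the germs remains. *)
have AbE w : (w - tau) * (Aa + AD)^`().[w] - (n%:R + 2^-1) * (Aa + AD).[w] =
    (fb m * (N%:R *: 'X^(N.-1))).[w].
  have -> : fb m = fa m + (fb m - fa m) by rewrite addrC subrK.
  rewrite [in RHS]mulrDl [in RHS]hornerD -AaE -ADE derivD !hornerD; ring.
have H1 : cm ((T.[c eta] - r eta ^+ (2 * n + 1) * Aa.[om eta]) -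
    (T.[c 0] - r 0 ^+ (2 * n + 1) * Aa.[om 0])) <= 1.
  apply: le_trans small;
    apply: (compare (p := p) (lexx 0) (ltW e_gt0) e_le1 KP Ar rE AaE) => //.
  - exact: faQ.
  - exact: ltW.
  - exact: ltW.
  - exact: ltW.
have H2 : cm ((T.[c 1] - r 1 ^+ (2 * n + 1) * (Aa + AD).[om 1]) -
    (T.[c (1 - eta)] - r (1 - eta) ^+ (2 * n + 1) * (Aa + AD).[om (1 - eta)])) <= 1.
  apply: le_trans small;
    apply: (compare (p := p) e_ge0' e_le1' (lexx 1) KP Ar rE AbE) => //.
  - exact: fbQ.
  - exact: ltW.
  - exact: ltW.
  - exact: ltW.
have H3 : cm (T.[c (1 - eta)] - T.[c eta]) <= Km.
  apply: le_trans (_ : 2 * ((K2 ^+ (2 * n + 3) + 1) * K * (K * Mc)) * (1 - eta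
    - eta) <= _); last first.
    by rewrite /Km ler_piMr //; lra.
  have M0 : 0 <= (K2 ^+ (2 * n + 3) + 1) * K * (K * Mc).
    by rewrite !mulr_ge0 ?(ltW K0) ?addr_ge0 ?exprn_ge0 ?(ltW K20).
  apply: (@mean_value_ineq R ex _ (fun s => T.[c s])) => //.
    by apply: (@cont_on_sub _ 0 1); [exact: ltW | exact: e_le1' | exact: cont_on_poly].
  move=> x xe xex; have x01 : 0 < x < 1 by lra.
  have x01' : 0 <= x <= 1 by lra.
  have [d dc dM] := c_der x01 xex; have [Q1 P1] := KP x x01'.
  exists (T^`().[c x] * d); first exact: cder_poly.
  have -> : cm (T^`().[c x] * d) = cm p.[g x] * cm Q.[c x] * (cm P^`().[c x] * cm d).
    by rewrite TE !hornerM horner_comp -/(g x) !cmM; ring.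
  rewrite ler_pM ?mulr_ge0 ?cm_ge0 //; last by rewrite ler_pM ?cm_ge0.
  rewrite ler_pM ?cm_ge0 //.
  have rx : cm (r x ^+ (2 * n + 3)) <= K2 ^+ (2 * n + 3).
    by rewrite cmX; apply: lerXn2r; rewrite ?nnegrE ?cm_ge0 ?(ltW K20) // r_le //; lra.
  have := pE x x01'; have := cm_rtri p.[g x] (r x ^+ (2 * n + 3)).
  by rewrite (cmBC p.[g x]); lra.
have rho4 : 2 * (rho / 4) <= rho by lra.
have rho40 : 0 <= 2 * (rho / 4) by lra.
have bnd (A : {poly C}) (G : {poly C}) s :
  (forall e w, cm w <= e -> (2 * n%:R + 4) * cm tau <= e ->
       cm A.[w] <= 2 * pn (2 * e) G) -> pn rho G <= 2 * B1 -> 0 <= s <= 1 ->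
    (s <= eta) || (1 - eta <= s) -> eta <= s <= 1 - eta ->
      cm (r s ^+ (2 * n + 1) * A.[om s]) <= Kb.
  move=> AG GB s01 sout sin; rewrite cmM /Kb ler_pM ?cm_ge0 //.
    by rewrite cmX; apply: lerXn2r; rewrite ?nnegrE ?cm_ge0 ?(ltW K20) // r_le.
  apply: le_trans (AG (rho / 4) (om s) (om_small s01 sout) tk) _.
  by rewrite ler_pM2l //; apply: le_trans GB; exact: pn_le.
have pa : pn rho (fa m * (N%:R *: 'X^(N.-1))) <= 2 * B1.
  by apply: le_trans (pn_prod_le (faB m)) _; rewrite -/B1; lra.
have pd : pn rho ((fb m - fa m) * (N%:R *: 'X^(N.-1))) <= 2 * B1.
  rewrite /B1 mulrA; apply: pn_prod_le; apply: le_trans (pnD (ltW rho0) _ _) _.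
  by rewrite pnN ?(ltW rho0) //; have := faB m; have := fbB m; lra.
have ein : eta <= eta <= 1 - eta by rewrite lexx.
have ein' : eta <= 1 - eta <= 1 - eta by rewrite lexx andbT.
have e01 : 0 <= eta <= 1 by rewrite ltW.
have e01' : 0 <= 1 - eta <= 1 by rewrite e_ge0'.
have so : (eta <= eta) || (1 - eta <= eta) by rewrite lexx.
have so' : (1 - eta <= eta) || (1 - eta <= 1 - eta) by rewrite lexx orbT.
have b1 := bnd _ _ eta Aab pa e01 so ein.
have b2 := bnd _ _ (1 - eta) Aab pa e01' so' ein'.
have b3 := bnd _ _ (1 - eta) ADb pd e01' so' ein'.
(* The half-integer power has the same value at both ends, as the cancellation requires. *)
have rends : r 0 = r 1.
  by apply: Afun_ends Ar; exact: etrans g0 (esym g1).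
move: H1 H2; rewrite om0 om1 rends !hornerD.
set Sa := r 1 ^+ _ * Aa.[0]; set SD := r 1 ^+ _ * AD.[0].
set Sae := r eta ^+ _ * _ in b1 *; set Sae' := r (1 - eta) ^+ _ * Aa.[_] in b2 *.
set SDe' := r (1 - eta) ^+ _ * AD.[_] in b3 *.
rewrite !mulrDr -/Sa -/SD -/Sae' -/SDe' -T01.
set t0 := T.[c 0]; set te := T.[c eta] in H3 *; set te' := T.[c (1 - eta)] in H3 *.
set X1 := (te - Sae - (t0 - Sa)); set X2 := t0 - (Sa + SD) - (te' - (Sae' + SDe')).
move=> H1 H2.
(* One turn around the path, with T(c 0) = T(c 1): the singular term is balanced by three boundary
   terms, the middle variation and two errors of size at most 1. *)
have E : SD = (Sae' - Sae) + (SDe' - X2) + (- X1 + - (te' - te)) by rewrite /X1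
  /X2; ring.
rewrite E; apply: le_trans (cmD _ _) _; have := cmD (Sae' - Sae) (SDe' - X2).
have := cmB Sae' Sae; have := cmB SDe' X2; have := cmD (- X1) (- (te' - te)).
rewrite !cmN; lra.
Qed.

(** Since n is the order of the right-hand side, |AD(0)| is at least (L/2) |tau|^n. By [key_bound]
    it is at most K |r 1|^(-2n-1) = K |tau|^(n+1/2), which is smaller for small [tau]. *)
Lemma localization : False.
Proof.
have rho_gt0 := rho0; have B1_ge0 := B10.
have [K K0 [h h0 key]] := key_bound.
have aN : 0 < cm (half_sol0 R n n) * cm (cc * N%:R).
  by rewrite mulr_gt0 ?half_sol0_gt0 // cm_gt0 mulf_neq0 // pnatr_eq0 -lt0n.
set L := _ * _ in aN.
pose kp : R := 2 * n%:R + 4; have kp0 : 0 < kp by rewrite /kp;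
  have : 0 <= n%:R :> R by []; lra.
pose q := 2 * kp / rho; have q0 : 0 < q by rewrite divr_gt0 // mulr_gt0.
pose D := 2 * (q ^+ n.+1 * (2 * B1 + 1)).
have D0 : 0 < D by rewrite mulr_gt0 // mulr_gt0 ?exprn_gt0 //; lra.
(* In order: the range of [key_bound], the smallness asked by the differential equation, a remainder
   below half of the leading term, and the final contradiction between upper and lower bound. *)
pose hh := Num.min (Num.min h (rho / (2 * kp))) (Num.min (L / (2 * D)) ((L / 2)
  ^+ 2 / (2 * K ^+ 2))).
have hh0 : 0 < hh.
  have h1 : 0 < rho / (2 * kp) by rewrite divr_gt0 // mulr_gt0.
  have h2 : 0 < L / (2 * D) by apply: divr_gt0 => //; rewrite mulr_gt0.
  have h3 : 0 < (L / 2) ^+ 2 / (2 * K ^+ 2).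
    apply: divr_gt0; last by rewrite mulr_gt0 ?exprn_gt0.
    by apply: exprn_gt0; exact: divr_gt0.
  by rewrite !lt_min h0 h1 h2 h3.
have [tau] := taus hh0; rewrite !lt_min => /andP[/andP[th trho] /andP[tD tK]] [r Ar rE].
have [m mm0 mP] := key tau r th Ar rE.
have [AD [ADE ADb ADl]] :=
  half_integer_equation n tau ((fb m - fa m) * (N%:R *: 'X^(N.-1))).
have up := mP AD ADE ADb.
(* The factor N om^(N-1) of dg shifts the first nonzero coefficient from n0 to n. *)
have coefG j : ((fb m - fa m) * (N%:R *: 'X^(N.-1)))`_j =
    if (j < N.-1)%N then 0 else N%:R * (fb m - fa m)`_(j - N.-1).
  by rewrite -scalerAr coefZ coefMXn; case: ifP => _ //; rewrite mulr0.
have pd : pn rho ((fb m - fa m) * (N%:R *: 'X^(N.-1))) <= 2 * B1.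
  rewrite /B1 mulrA; apply: pn_prod_le; apply: le_trans (pnD (ltW rho0) _ _) _.
  by rewrite pnN ?(ltW rho0) //; have := faB m; have := fbB m; lra.
have t_kp : 2 * (kp * cm tau) <= rho.
  by rewrite mulrA mulrC -ler_pdivlMr ?mulr_gt0 // ltW.
have Gj j : (j < n)%N -> ((fb m - fa m) * (N%:R *: 'X^(N.-1)))`_j = 0.
  move=> jn; rewrite coefG; case: ltnP => // jN; rewrite coef_lt ?mulr0 //.
  by rewrite ltn_subLR // addnC.
have := ADl rho rho0 Gj t_kp.
have -> : ((fb m - fa m) * (N%:R *: 'X^(N.-1)))`_n = cc * N%:R.
  by rewrite coefG /n ltnNge leq_addl /= addnK coef_n0 // mulrC.
rewrite -/L => low.
have h01 : 0 <= (1 : R) <= 1 by lra.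
have tau0 : 0 < cm tau.
  rewrite cm_gt0; apply/eqP => t0; have := rE 1 h01.
  by rewrite t0 om1 subrr mulr0 => /esym/eqP; rewrite oner_eq0.
have low2 : L / 2 * cm tau ^+ n <= cm AD.[0].
  apply: le_trans low; rewrite -/kp.
  have -> : 2 * (kp * cm tau) / rho = q * cm tau by rewrite /q; field; rewrite gt_eqF.
  have hle : 2 * (q * cm tau) ^+ n.+1 * pn rho ((fb m - fa m) * (N%:R *: 'X^(N.-1))) <=
      D * cm tau * cm tau ^+ n.
    have -> : D * cm tau * cm tau ^+ n = 2 * (q * cm tau) ^+ n.+1 * (2 * B1 + 1).
      by rewrite [(q * cm tau) ^+ n.+1]exprMn [cm tau ^+ n.+1]exprS /D; ring.
    have X0 : 0 <= q * cm tau := mulr_ge0 (ltW q0) (cm_ge0 _).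
    apply: ler_wpM2l; first by apply: mulr_ge0 => //; exact: exprn_ge0.
    by apply: le_trans pd _; lra.
  have hD : D * cm tau * cm tau ^+ n <= L / 2 * cm tau ^+ n.
    rewrite ler_wpM2r ?exprn_ge0 ?cm_ge0 // mulrC -ler_pdivlMr //.
    have -> : L / 2 / D = L / (2 * D) by field; rewrite gt_eqF.
    exact: ltW.
  by move: hle hD; rewrite -/L; set y1 := _ * pn _ _; set y2 := D * _ * _; lra.
have r2 : cm (r 1) ^+ 2 * cm tau = 1.
  by have := congr1 (@cm R) (rE 1 h01); rewrite om1 sub0r cmM cmX cmN cm1.
(* Squaring turns the half-integer powers of |tau| into integer ones. *)
have up2 : cm AD.[0] ^+ 2 <= K ^+ 2 * cm tau ^+ (2 * n + 1).
  have E : cm AD.[0] ^+ 2 = cm (r 1 ^+ (2 * n + 1) * AD.[0]) ^+ 2 * cm tau ^+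
    (2 * n + 1).
    by rewrite cmM cmX exprMn -!exprM [((2 * n + 1) * 2)%N]mulnC exprM mulrAC
      -exprMn r2 expr1n mul1r.
  rewrite E ler_wpM2r ?exprn_ge0 ?cm_ge0 //.
  by apply: lerXn2r; rewrite ?nnegrE ?cm_ge0 ?(ltW K0).
have : (L / 2 * cm tau ^+ n) ^+ 2 <= K ^+ 2 * cm tau ^+ (2 * n + 1).
  apply: le_trans up2; apply: lerXn2r => //; rewrite nnegrE ?cm_ge0 //.
  by rewrite mulr_ge0 ?exprn_ge0 ?cm_ge0 // divr_ge0 // ltW.
rewrite exprMn -exprM [(n * 2)%N]mulnC exprD expr1 mulrCA mulrC ler_pM2l ?exprn_gt0 //.
rewrite leNgt => /negP; apply.
move: tK; rewrite ltr_pdivlMr ?mulr_gt0 ?exprn_gt0 // => tK.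
have K2 : 0 < K ^+ 2 by rewrite exprn_gt0.
have : 0 < cm tau * K ^+ 2 by rewrite mulr_gt0.
by rewrite mulrC; move: tK; rewrite mulrCA; lra.
Qed.
End Localization.

(** * Puiseux germs *)

Section ShiftedPower.
Variable A : comNzRingType.
Implicit Types (q : {poly A}) (v x : A).

(** Desingularisation: putting c - a = v x in (c - a)^k p(c) = om^N and dividing by the leading term
    gives an equation for which x = 1 is a simple root at v = 0. *)
Lemma power_equation k q v : (0 < k)%N -> exists H : {poly A},
  (forall x, H.[x] = x ^+ k * q.[v * x] - 1) /\
  H^`().[1] = q.[v] *+ k + q^`().[v] * v.
Proof.
move=> k0; exists ('X^k * (q \Po (v%:P * 'X)) - 1%:P); split=> [x|].
  by rewrite hornerD hornerN hornerM hornerXn horner_comp hornerM !hornerC hornerX.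
rewrite derivB derivC subr0 derivM derivXn deriv_comp derivM derivC derivX.
rewrite mul0r add0r mulr1 hornerD !hornerM hornerMn !hornerXn !horner_comp.
by rewrite !hornerM !hornerC hornerX !expr1n !mul1r mulr1 mulrnAl mul1r.
Qed.
End ShiftedPower.

(** * The path near an end in terms of om *)

Section Germ.
Variable R : realType.
Local Notation C := (cplx R).
Implicit Types (p q : {poly C}) (s : R).

Lemma cont_onV a b (f : R -> C) : a <= b -> cont_on a b f ->
  (forall s, a <= s <= b -> f s != 0) -> cont_on a b (fun s => (f s)^-1).
Proof.
move=> ab cf f0; have [m m0 mP] := cont_on_min ab cf f0.
move=> s sab e e0; have e1 : 0 < e * (m * m) by rewrite !mulr_gt0.
have [d d0 dP] := cf s sab _ e1; exists d => // t tab ts.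
have fs := f0 s sab; have ft := f0 t tab.
have -> : (f t)^-1 - (f s)^-1 = - (f t - f s) / (f t * f s).
  by field; rewrite fs ft.
rewrite cmM cmN cmV cmM ltr_pdivrMr; last by rewrite mulr_gt0 // cm_gt0.
apply: lt_le_trans (dP t tab ts) _.
by rewrite ler_pM2l // ler_pM ?mP // ltW.
Qed.

Lemma pnXn rho n : pn rho ('X^n : {poly C}) = rho ^+ n.
Proof.
elim: n => [|n IH]; first by rewrite !expr0 pnC cm1.
by rewrite exprSr pnMX IH exprSr.
Qed.

Lemma comp_polyXn p q n : (p ^+ n) \Po q = (p \Po q) ^+ n.
Proof.
elim: n => [|n IH]; first by rewrite !expr0 -polyC1 comp_polyC.
by rewrite !exprS comp_polyM IH.
Qed.

Lemma dvdp_Xn_comp p q j : 'X^j %| p -> 'X %| q -> 'X^j %| p \Po q.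
Proof.
move=> /dvdpP[r ->] Xq; rewrite comp_polyM comp_Xn_poly.
by apply: dvdp_mull; exact: dvdp_exp2r.
Qed.

Lemma multiplicity_factor p (a z : C) : (1 < size p)%N -> p.[a] = z ->
  exists k q, [/\ (0 < k)%N, q.[a] != 0 & p - z%:P = ('X - a%:P) ^+ k * q].
Proof.
move=> sp pa; have p0 : p - z%:P != 0.
  rewrite subr_eq0; apply: contraTneq sp => ->.
  by rewrite size_polyC -leqNgt leq_b1.
have [k [q qa E]] := multiplicity_XsubC (p - z%:P) a.
rewrite p0 /= in qa; exists k, q; split; last by rewrite mulrC.
  rewrite lt0n; apply/eqP => k0; move: E qa; rewrite k0 expr0 mulr1 => <-.
  by rewrite rootE hornerD hornerN hornerC pa subrr eqxx.
by [].
Qed.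

Variables (P : {poly C}) (a z0 : C) (k N : nat) (p : {poly C}).
Hypothesis k0 : (0 < k)%N.
Hypothesis N0 : (0 < N)%N.
Hypothesis kN : (k %| N)%N.
Hypothesis pa : p.[a] != 0.
Hypothesis PE : P - z0%:P = ('X - a%:P) ^+ k * p.
Variables (c om : R -> C).
Hypothesis c_cont : cont_on 0 1 c.
Hypothesis om_cont : cont_on 0 1 om.
Hypothesis c0 : c 0 = a.
Hypothesis omN : forall s, 0 <= s <= 1 -> om s ^+ N = P.[c s] - z0.
Hypothesis c_neq : forall s, 0 < s < 1 -> P.[c s] != z0.

Let e := (N %/ k)%N.
Let e0 : (0 < e)%N. Proof. by rewrite divn_gt0 // dvdn_leq. Qed.
Let ek : (e * k = N)%N. Proof. by rewrite divnK. Qed.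
Let p1 : {poly C} := p.[a]^-1 *: (p \Po ('X + a%:P)).

Let p1E x : p1.[x] = p.[x + a] / p.[a].
Proof. by rewrite /p1 hornerZ horner_comp hornerD hornerX hornerC mulrC. Qed.

Let PcE s : P.[c s] - z0 = (c s - a) ^+ k * p.[c s].
Proof.
have := congr1 (fun q : {poly C} => q.[c s]) PE.
by rewrite hornerD hornerN hornerC hornerM horner_exp hornerXsubC.
Qed.

Let pc0 s : 0 < s < 1 -> p.[c s] != 0.
Proof.
by move=> /c_neq; rewrite -subr_eq0 PcE mulf_eq0 negb_or => /andP[].
Qed.

Let om_neq0 s : 0 < s < 1 -> om s != 0.
Proof.
move=> s01; have := c_neq s01; rewrite -subr_eq0 -omN; last by lra.
by rewrite expf_eq0 N0.
Qed.

Let om0 : om 0 = 0.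
Proof.
have h : 0 <= (0 : R) <= 1 by lra.
have := omN h; rewrite PcE c0 subrr expr0n eqn0Ngt k0 mul0r => /eqP.
by rewrite expf_eq0 N0 => /eqP.
Qed.

(* The branch [kappa] of the k-th root of [1 / p(a)] is the one along which the
   path leaves [a]. *)
Let branch (delta : R) : 0 < delta -> exists kappa : C, exists2 eta : R, 0 < eta < 1 &
  kappa ^+ k * p.[a] = 1 /\ forall s, 0 < s <= eta ->
    cm ((c s - a) / (kappa * om s ^+ e) - 1) <= delta.
Proof.
move=> d0; have [kap kapE] := root_exists p.[a]^-1 k0.
have kap0 : kap != 0.
  by apply: contraNneq pa => E; move: kapE;
    rewrite E expr0n eqn0Ngt k0 => /esym/eqP; rewrite invr_eq0.
pose z s := (c s - a) * (kap * om s ^+ e)^-1.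
have zk s : 0 < s < 1 -> z s ^+ k = p.[a] / p.[c s].
  move=> s01; have ps := pc0 s01.
  rewrite /z exprMn exprVn exprMn -exprM ek kapE omN; last by lra.
  rewrite PcE; have ca : c s - a != 0.
    have := c_neq s01; rewrite -subr_eq0 PcE mulf_eq0 negb_or expf_eq0 k0 /=.
    by case/andP.
  by field; rewrite ps expf_neq0 ?pa.
have h2 : 0 < delta / 2 by lra.
have [d d_gt0 follow] := root_follow 1 k0 h2.
pose dd := Num.min d ((delta / 2) ^+ k).
have dd0 : 0 < dd by rewrite lt_min d_gt0 exprn_gt0.
have [eta eta01 etaP] : exists2 eta :
  R, 0 < eta < 1 & forall s, 0 < s <= eta -> cm (z s ^+ k - 1) <= dd.
  have cp : cont_on 0 1 (fun s => p.[c s]) by exact: cont_on_poly.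
  have h : 0 <= (0 : R) <= 1 by lra.
  have pa0 : 0 < cm p.[a] by rewrite cm_gt0.
  have m0 : 0 < Num.min (cm p.[a] / 2) (dd * (cm p.[a] / 2)).
    by rewrite lt_min !mulr_gt0 ?invr_gt0.
  have [r r0 rP] := cp 0 h _ m0; rewrite c0 in rP.
  have mr : 0 < Num.min r 1 by rewrite lt_min r0 /=.
  have mr1 : Num.min r 1 <= 1 by rewrite ge_min lexx orbT.
  have mrr : Num.min r 1 <= r by rewrite ge_min lexx.
  exists (Num.min r 1 / 2); first by lra.
  move=> s sr; have s01 : 0 < s < 1 by lra.
  have /andP[n1 n2] : (cm (p.[c s] - p.[a]) < cm p.[a] / 2) &&
      (cm (p.[c s] - p.[a]) < dd * (cm p.[a] / 2)).
    rewrite -lt_min; apply: rP; first by lra.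
    by rewrite subr0 gtr0_norm; lra.
  rewrite zk //; have ps := pc0 s01.
  have -> : p.[a] / p.[c s] - 1 = - (p.[c s] - p.[a]) / p.[c s] by field.
  have pcs : cm p.[a] / 2 <= cm p.[c s] by have := cm_rtri p.[a] p.[c s];
    rewrite cmBC; lra.
  rewrite cmM cmN cmV ler_pdivrMr ?cm_gt0 //; apply: le_trans (ltW n2) _.
  by rewrite ler_pM2l.
have zeta : 0 < eta <= eta by lra.
(* z^k is close to 1, but z may be close to any k-th root of unity [w]; this [w] is absorbed into
   kappa. *)
have [w wE wle] := close_root 1 (z eta) k0.
have {}wle : cm (z eta - w) <= delta / 2.
  rewrite -(ler_pXn2r k0) ?nnegrE ?cm_ge0 ?(ltW h2) //; apply: le_trans wle _.
  by apply: le_trans (etaP eta zeta) _; rewrite ge_min lexx orbT.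
have cw : cm w = 1.
  have : cm w ^+ k = 1 by rewrite -cmX wE cm1.
  by move=> /eqP; rewrite pexpr_eq1 ?cm_ge0 // => /eqP.
have w0 : w != 0 by rewrite -cm_gt0 cw.
exists (kap * w), eta => //; split; first by rewrite exprMn wE mulr1 kapE mulVf.
move=> s sE; have s01 : 0 < s < 1 by lra.
have os := om_neq0 s01.
have -> : (c s - a) / (kap * w * om s ^+ e) - 1 = (z s - w) / w.
  by rewrite /z; field; rewrite w0 kap0 expf_neq0.
rewrite cmM cmV cw invr1 mulr1.
(* The branch is followed from eta down to s > 0, since at 0 the quotient z is 0/0. *)
have cz : cont_on s eta z.
  apply: cont_onM.
    apply: cont_onD; last exact: cont_on_cst.
    by apply: (@cont_on_sub _ 0 1); [lra|lra|].
  apply: cont_onV; first by lra.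
    apply: cont_onM; first exact: cont_on_cst.
    have cX : cont_on s eta (fun s => ('X^e).[om s]).
      by apply: cont_on_poly; apply: (@cont_on_sub _ 0 1); [lra|lra|].
    move=> x xs h hh; have [r r0 rP] := cX x xs h hh; exists r => // t ts tr.
    by have := rP t ts tr; rewrite !hornerXn.
  by move=> t ts; rewrite mulf_neq0 // expf_neq0 // om_neq0 //; lra.
have H : forall t, s <= t <= eta -> cm (z t ^+ k - 1) <= d.
  by move=> t ts; apply: le_trans (etaP t _) _; [lra | rewrite ge_min lexx].
have := follow s eta z cz H s eta; rewrite !lexx /= andbT; case/andP: (sE) => _ ->.
move=> /(_ isT isT) h; have := cm_tri (z s) (z eta) w; lra.
Qed.

(** Dividing c - a by kappa om^e reduces the k-fold root to a simple one; the Newton iterates are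
    then composed with kappa X^e. Convergence is recorded both numerically along the path and
    X-adically, with P(X) = z0 + X^N as limit equation. The nonzero constant term of [u m] fixes the
    exact order e of X - a, on which later divisions rest. *)
Lemma germ : exists (rho B C0 eta : R) (X : nat -> {poly C}) (u : nat -> {poly C}),
  [/\ [/\ 0 < rho, 0 < B, 0 < C0 & 0 < eta < 1],
   forall m, pn rho (X m) <= B,
   forall m s, 0 <= s <= eta -> cm (c s - (X m).[om s]) <= C0 / 2 ^+ m,
   forall m, 'X^(m.+1) %| X m.+1 - X m /\ 'X^(m.+1) %| P \Po X m - (z0%:P + 'X^N) &
   forall m, X m = a%:P + 'X^e * u m /\ (u m).[0] != 0].
Proof.
have [H [HE H'E]] := power_equation p1^:P ('X : {poly C}) k0.
have HE' (x : {poly C}) : H.[x] = x ^+ k * (p1 \Po ('X * x)) - 1.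
  by rewrite HE.
have p10 : p1.[0] = 1 by rewrite p1E add0r divff.
have H1 : (H.[1]).[0] = 0.
  by rewrite HE' expr1n mul1r mulr1 comp_polyXr hornerD hornerN p10 hornerC subrr.
have H'1 : (H^`().[1]).[0] != 0.
  rewrite H'E hornerD hornerM hornerX mulr0 addr0 hornerMn.
  have -> : p1^:P.['X] = p1 \Po 'X by [].
  by rewrite comp_polyXr p10 pnatr_eq0 -lt0n.
have [delta [rho0 [ee [[d0 r0] eB eX eH ecvg]]]] := hensel H1 H'1.
have [kappa [eta1 eta101 [kE kP]]] := branch d0.
have kap0 : kappa != 0.
  by apply: contra_eq_neq kE => ->; rewrite expr0n eqn0Ngt k0 mul0r eq_sym oner_neq0.
have ck : 0 < cm kappa by rewrite cm_gt0.
pose V : {poly C} := kappa *: 'X^e.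
(* rho <= 1 gives rho^e <= rho, so the norm of kappa X^e is at most [rho0]. *)
pose rho := Num.min 1 (rho0 / cm kappa).
have rho_gt0 : 0 < rho by rewrite lt_min ltr01 divr_gt0.
have rho_le1 : rho <= 1 by rewrite ge_min lexx.
have rhoe : cm kappa * rho ^+ e <= rho0.
  apply: le_trans (_ : cm kappa * rho <= _).
    by rewrite ler_pM2l // ler_iXnr // ltW.
  by rewrite mulrC -ler_pdivlMr // ge_min lexx orbT.
have pnV : pn rho V <= rho0 by rewrite pnZ ?(ltW rho_gt0) // pnXn.
have VX : 'X %| V.
  rewrite /V dvdpZr // -(prednK e0) exprS; exact: dvdp_mulr.
pose X m := a%:P + V * (1 + ee m \Po V).
pose u m := kappa *: (1 + ee m \Po V).
have h : 0 <= (0 : R) <= 1 by lra.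
have [r r_gt0 rP] := om_cont h rho_gt0.
rewrite om0 in rP.
pose eta := Num.min eta1 (r / 2).
have eta_e1 : eta <= eta1 by rewrite ge_min lexx.
have eta_r : eta <= r / 2 by rewrite ge_min lexx orbT.
have eta0 : 0 < eta by rewrite lt_min divr_gt0 //; case/andP: eta101 => ->.
exists rho, (cm a + rho0 * (1 + delta)), (rho0 * delta), eta, X, u; split.
- split=> //; [|exact: mulr_gt0|lra].
  by apply: ltr_wpDl; [exact: cm_ge0 | rewrite mulr_gt0 //; lra].
- move=> m; have rge := ltW rho_gt0.
  apply: le_trans (pnD rge _ _) _; rewrite pnC lerD2l.
  apply: le_trans (pnM rge _ _) _; rewrite ler_pM ?pn_ge0 //.
  apply: le_trans (pn_comp rge _ _) _.
  apply: le_trans (pn_le _ (pn_ge0 rge _) pnV) _.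
  apply: le_trans (pnD (ltW r0) _ _) _.
  by rewrite (_ : (1 : {poly C}) = 1%:P) // pnC cm1 lerD2l.
- move=> m s sE; have d1 : 0 <= rho0 * delta / 2 ^+ m.
    by rewrite divr_ge0 ?exprn_ge0 // mulr_ge0 ?ltW.
  have [s0|sn] := eqVneq s 0.
    rewrite s0 om0 c0 /X hornerD hornerC hornerM /V hornerZ hornerXn expr0n.
    by rewrite eqn0Ngt e0 mulr0 mul0r addr0 subrr cm0.
  have s_gt0 : 0 < s by rewrite lt_neqAle eq_sym sn; case/andP: sE.
  have s01 : 0 < s < 1 by lra.
  have os := om_neq0 s01.
  have osr : cm (om s) <= rho.
    have := rP s; rewrite !subr0 => H'; apply: ltW; apply: H'; first by lra.
    by rewrite gtr0_norm //; lra.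
  pose v := kappa * om s ^+ e; have v0 : v != 0 by rewrite mulf_neq0 ?expf_neq0.
  have vr : cm v <= rho0.
    rewrite cmM cmX; apply: le_trans rhoe; rewrite ler_pM2l //.
    by apply: lerXn2r; rewrite ?nnegrE ?cm_ge0 ?(ltW rho_gt0).
  pose z := (c s - a) / v - 1.
  have zd : cm z <= delta by apply: kP; lra.
  have vz : v * (1 + z) = c s - a by rewrite /z addrC subrK mulrC divfK.
  have Hz : H.[(1 + z)%:P].[v] = 0.
    rewrite HE' hornerD hornerN hornerM horner_exp horner_comp hornerM hornerX !hornerC.
    rewrite vz p1E subrK.
    have vk : v ^+ k * p.[a] = om s ^+ N by rewrite /v exprMn -exprM ek mulrAC kE mul1r.
    have oN : om s ^+ N = (v * (1 + z)) ^+ k * p.[c s] by rewrite vz -PcE omN //; lra.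
    have vk0 : v ^+ k * p.[a] != 0 by rewrite mulf_neq0 ?expf_neq0.
    apply/eqP; rewrite subr_eq0; apply/eqP; apply: (mulfI vk0).
    rewrite mulr1 [RHS]vk oN [(v * (1 + z)) ^+ k]exprMn.
    by set y := v ^+ k; set y' := (1 + z) ^+ k; field; exact: pa.
  have := ecvg v z vr zd Hz m => le.
  have -> : c s - (X m).[om s] = v * (z - (ee m).[v]).
    rewrite /X hornerD hornerC hornerM horner_comp hornerD hornerC /V !hornerZ
      !hornerXn -/v.
    by rewrite -[c s](subrK a) -vz; ring.
  rewrite cmM -mulrA ler_pM ?cm_ge0 // cmBC; exact: le.
- move=> m; split.
    have -> : X m.+1 - X m = V * ((ee m.+1 - ee m) \Po V).
      by rewrite /X comp_polyB !comp_polyD; ring.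
    by apply: dvdp_mull; apply: dvdp_Xn_comp => //; case: (eX m).
  have E : P \Po X m - (z0%:P + 'X^N) = 'X^N * (H.[1 + ee m] \Po V).
    have XE : X m - a%:P = V * (1 + ee m \Po V) by rewrite /X addrC addKr.
    have -> : P \Po X m = (P - z0%:P) \Po X m + z0%:P by rewrite comp_polyB
      comp_polyC subrK.
    rewrite PE comp_polyM comp_polyXn comp_polyB comp_polyX comp_polyC XE.
    have pX : p \Po X m = p.[a] *: (p1 \Po (V * (1 + ee m \Po V))).
      rewrite /p1 comp_polyZ scalerA divff // scale1r -comp_polyA comp_polyD
        comp_polyX comp_polyC.
      by rewrite -XE subrK.
    have H2 : H.[1 + ee m] \Po V = (1 + ee m \Po V) ^+ k * (p1 \Po (V * (1 + ee
      m \Po V))) - 1.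
      rewrite HE' comp_polyB comp_polyM comp_polyXn -comp_polyA !comp_polyM comp_polyX.
      by congr (_ - _); rewrite -polyC1 comp_polyC.
    have Vk : V ^+ k * p.[a]%:P = 'X^N.
      rewrite /V exprZn -exprM ek -scalerAl mulrC mul_polyC scalerA kE scale1r //.
    rewrite pX H2 -Vk -mul_polyC [(V * _) ^+ k]exprMn; ring.
  by rewrite E; apply: dvdp_mull; apply: dvdp_Xn_comp.
move=> m; split; first by rewrite /X /u /V -!mul_polyC; ring.
rewrite /u hornerZ horner_comp.
have -> : V.[0] = 0 by rewrite /V hornerZ hornerXn expr0n eqn0Ngt e0 mulr0.
rewrite hornerD hornerC; have [/dvdpP[q ->] _] := eX m.
by rewrite hornerM hornerX mulr0 addr0 mulr1.
Qed.
End Germ.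

(** * From vanishing moments to the composition condition *)

Section AdicAgreement.
Variable R : realType.
Local Notation C := (cplx R).
Implicit Types (f h p q : {poly C}) (X Y : nat -> {poly C}).

Lemma dvdp_XnP n p : reflect (forall i, (i < n)%N -> p`_i = 0) ('X^n %| p).
Proof.
apply: (iffP idP) => [/dvdpP[q ->] i ilt|H]; first by rewrite coefMXn ilt.
apply/dvdpP; exists (drop_poly n p); rewrite -[LHS](poly_take_drop n p).
rewrite (_ : take_poly n p = 0) ?add0r //; apply/polyP => i.
by rewrite coef_take_poly coef0; case: ifP => // /H.
Qed.

Lemma dvdp_comp_sub f p q : p - q %| (f \Po p) - (f \Po q).
Proof.
elim/poly_ind: f => [|f c IH]; first by rewrite !comp_poly0 subrr dvdp0.
rewrite !comp_poly_MXaddC.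
have -> : (f \Po p) * p + c%:P - ((f \Po q) * q + c%:P) =
    ((f \Po p) - (f \Po q)) * p + (f \Po q) * (p - q) by ring.
by apply: dvdp_add; [exact: dvdp_mulr | exact: dvdp_mull].
Qed.

(* [X] and [Y] are read as their X-adic limits, i.e. as formal power series. *)
Definition adic_agree X Y f := forall j, exists m0, forall m, (m0 <= m)%N ->
  'X^j %| (f \Po X m) - (f \Po Y m).

Lemma adic_agreeC X Y c : adic_agree X Y c%:P.
Proof. by move=> j; exists 0%N => m _; rewrite !comp_polyC subrr dvdp0. Qed.

Lemma adic_agreeB X Y f h :
  adic_agree X Y f -> adic_agree X Y h -> adic_agree X Y (f - h).
Proof.
move=> Af Ah j; have [m1 H1] := Af j; have [m2 H2] := Ah j.
exists (maxn m1 m2) => m; rewrite geq_max => /andP[/H1 d1 /H2 d2].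
rewrite !comp_polyB (_ :
  _ - _ = ((f \Po X m) - (f \Po Y m)) - ((h \Po X m) - (h \Po Y m))); last by ring.
exact: dvdp_sub.
Qed.

Lemma adic_agreeM X Y f h :
  adic_agree X Y f -> adic_agree X Y h -> adic_agree X Y (f * h).
Proof.
move=> Af Ah j; have [m1 H1] := Af j; have [m2 H2] := Ah j.
exists (maxn m1 m2) => m; rewrite geq_max => /andP[/H1 d1 /H2 d2].
rewrite !comp_polyM (_ : _ - _ = ((f \Po X m) - (f \Po Y m)) * (h \Po X m) +
  (f \Po Y m) * ((h \Po X m) - (h \Po Y m))); last by ring.
by apply: dvdp_add; [exact: dvdp_mulr | exact: dvdp_mull].
Qed.

(** The order of f(X) is e times the multiplicity of a in [f], hence the same for all
    approximants. *)
Lemma adic_nonzero (a : C) (e : nat) (u : nat -> {poly C}) X f : (0 < e)%N -> f != 0 ->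
  (forall m, X m = a%:P + 'X^e * u m /\ (u m).[0] != 0) ->
  exists r, forall m, exists2 q, f \Po X m = 'X^r * q & q.[0] != 0.
Proof.
move=> e0 f0 XE; have [i [q qa E]] := multiplicity_XsubC f a; rewrite f0 /= in qa.
exists (e * i)%N => m; have [Xm um] := XE m.
exists ((u m) ^+ i * (q \Po X m)).
  rewrite E comp_polyM comp_polyXn comp_polyB comp_polyX comp_polyC.
  have -> : X m - a%:P = 'X^e * u m by rewrite Xm addrC addKr.
  by rewrite exprMn -exprM; ring.
rewrite hornerM horner_exp mulf_neq0 ?expf_neq0 // horner_comp Xm hornerD hornerC.
by rewrite hornerM hornerXn expr0n eqn0Ngt e0 mul0r addr0 -rootE.
Qed.

(** f(X) (h(X) - h(Y)) is highly divisible as soon as [f] and f h agree to high order, and f(X) can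
    absorb only a fixed power of X. *)
Lemma adic_agree_div (a : C) (e : nat) (u : nat -> {poly C}) X Y f h : (0 < e)%N ->
  (forall m, X m = a%:P + 'X^e * u m /\ (u m).[0] != 0) ->
  f != 0 -> adic_agree X Y f -> adic_agree X Y (f * h) -> adic_agree X Y h.
Proof.
move=> e0 XE f0 Af Afh j; have [r rP] := adic_nonzero e0 f0 XE.
have [m1 H1] := Af (r + j)%N; have [m2 H2] := Afh (r + j)%N.
exists (maxn m1 m2) => m; rewrite geq_max => /andP[/H1 d1 /H2 d2].
have [q qE q0] := rP m.
have : 'X^(r + j) %| (f \Po X m) * ((h \Po X m) - (h \Po Y m)).
  rewrite (_ : _ * _ = (((f * h) \Po X m) - ((f * h) \Po Y m)) -
    ((f \Po X m) - (f \Po Y m)) * (h \Po Y m)); last by rewrite !comp_polyM; ring.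
  by apply: dvdp_sub => //; exact: dvdp_mulr.
rewrite qE exprD -mulrA dvdp_mul2l; last by rewrite expf_neq0 // polyX_eq0.
rewrite Gauss_dvdpr // -['X]subr0; apply: coprimep_expl.
by rewrite coprimep_sym coprimep_XsubC rootE.
Qed.

End AdicAgreement.

(** * Moments as endpoint differences of primitives *)

Section Moments.
Variable R : realType.
Local Notation C := (cplx R).
Implicit Types (P Q T : {poly C}).

Lemma moment_antiderivative c P Q k T : piecewise_smooth c ->
  T^`() = P ^+ k * Q * P^`() -> moment c P Q k = T.[c 1] - T.[c 0].
Proof.
move=> psc TE; rewrite -(path_integral_poly psc TE) /moment; congr path_integral.
by apply/funext => x; rewrite !hornerM horner_exp.
Qed.

(** Substitution: the integrand has a primitive that is a polynomial in W, and W takes equal values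
    at the ends. *)
Lemma composition_moments c P Q k : piecewise_smooth c ->
  composition_condition P Q (c 0) (c 1) -> moment c P Q k = 0.
Proof.
move=> psc [Pt [Qt [W [PE QE Wab]]]].
have [H HE] := antiderivative_exists (Pt ^+ k * Qt * Pt^`()).
rewrite (@moment_antiderivative _ _ _ _ (H \Po W)) //.
  by rewrite !horner_comp Wab subrr.
by rewrite deriv_comp HE PE QE deriv_comp !comp_polyM comp_polyXn; ring.
Qed.

Lemma moments_vanish_comp c P Q : piecewise_smooth c ->
  (forall k, moment c P Q k = 0) ->
  forall p T, T^`() = (p \Po P) * Q * P^`() -> T.[c 0] = T.[c 1].
Proof.
move=> psc m0.
have [Tk TkE] := choice (fun k => antiderivative_exists (P ^+ k * Q * P^`())).
have Tk01 k : (Tk k).[c 1] - (Tk k).[c 0] = 0.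
  by rewrite -(moment_antiderivative psc (TkE k)).
move=> p T TE.
have E : T^`() = (\sum_(i < size p) p`_i *: Tk i)^`().
  rewrite TE comp_polyE raddf_sum /= !mulr_suml; apply: eq_bigr => i _.
  by rewrite derivZ TkE -!scalerAl.
have := deriv_inj_at (c 1) (c 0) E; rewrite !horner_sum -sumrB big1.
  by move=> /eqP; rewrite subr_eq0 => /eqP.
by move=> i _; rewrite !hornerZ -mulrBr Tk01 mulr0.
Qed.

End Moments.

(** * Vanishing moments imply the composition condition *)

Section Core.
Variable R : realType.
Local Notation C := (cplx R).
Variables (P : {poly C}) (c : R -> C) (z0 : C) (D : set C).
Hypothesis psc : piecewise_smooth c.
Let g (s : R) : C := P.[c s].
Hypothesis g0 : g 0 = z0.
Hypothesis g1 : g 1 = z0.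
Hypothesis g_neq : forall s : R, 0 < s < 1 -> g s != z0.
Hypothesis D_conn : connected D.
Hypothesis D_avoid : forall t, D t -> forall s : R, 0 <= s <= 1 -> g s != t.
Hypothesis D_unbounded : forall K : R, exists2 t, D t & K <= cm t.
Hypothesis D_closure : forall e : R, 0 < e -> exists2 t, D t & cm (t - z0) < e.

Let c_cont : cont_on 0 1 c. Proof. exact: path_cont. Qed.
Let g_cont : cont_on 0 1 g. Proof. exact: cont_on_poly. Qed.

Let sizeP : (1 < size P)%N.
Proof.
rewrite ltnNge; apply/negP => /size1_polyC E.
have h : 0 < (2^-1 : R) < 1 by lra.
by have := g_neq h; rewrite -g0 /g E !hornerC eqxx.
Qed.

Let D_dist t : D t -> exists2 d : R, 0 < d & forall s :
  R, 0 <= s <= 1 -> d <= cm (g s - t).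
Proof.
move=> Dt; apply: (@cont_on_min R 0 1 (fun s => g s - t)) => //.
  by apply: cont_onD => //; exact: cont_on_cst.
by move=> s s01; rewrite subr_eq0; exact: D_avoid.
Qed.

(** Pole pushing is used twice: on g - z0 itself, to get N-th roots of g - t for t in D, and then on
    the limit [om], to get the inverse square roots behind the half-integer powers. *)
Let root_function N : (0 < N)%N -> exists om,
  [/\ Afun g om, forall s : R, 0 <= s <= 1 -> om s ^+ N = g s - z0 &
   forall h : R, 0 < h -> exists2 tau : C, cm tau < h &
     exists2 r, Afun g r & forall s : R, 0 <= s <= 1 -> r s ^+ 2 * (om s - tau) = 1].
Proof.
move=> N0.
have [om Aom omN] : exists2 om, Afun g om & forall s :
  R, 0 <= s <= 1 -> om s ^+ N = g s - z0.
  apply: (root_function_exists (D := D)) => // t Dt.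
  have Ag : Afun g (fun s => g s - z0).
    by apply: (AfunB g_cont); [exact: Afun_id | exact: Afun_cst].
  have g1' (s : R) : 0 <= s <= 1 -> (g s - z0) ^+ 1 = g s - z0 by rewrite expr1.
  have [r Ar rE] := inverse_root_component g_cont Ag N0 (ltn0Sn 0) g1' D_conn D_dist
    D_unbounded Dt (expr1 (t - z0)).
  exists r => // s s01; rewrite -[RHS](rE s s01); congr (_ * _); ring.
exists om; split=> // h h0.
have hN : 0 < h ^+ N by exact: exprn_gt0.
have [t Dt th] := D_closure hN; have [tau tauE] := root_exists (t - z0) N0.
exists tau.
  by rewrite -(ltr_pXn2r N0) ?nnegrE ?cm_ge0 ?(ltW h0) // -cmX tauE.
have [r Ar rE] := inverse_root_component g_cont Aom (isT : (0 < 2)%N) N0 omN D_conn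
  D_dist D_unbounded Dt tauE.
by exists r.
Qed.

Lemma composition_of_vanishing_moments Q : (forall k, moment c P Q k = 0) ->
  composition_condition P Q (c 0) (c 1).
Proof.
move=> mom0.
have [ka [pa [ka0 pa0 PaE]]] := multiplicity_factor sizeP g0.
have [kb [pb [kb0 pb0 PbE]]] := multiplicity_factor sizeP g1.
pose N := (ka * kb)%N; have N0 : (0 < N)%N by rewrite muln_gt0 ka0.
have [om [Aom omN taus]] := root_function N0.
have om_cont : cont_on 0 1 om := Afun_cont g_cont Aom.
(* [germ] describes the start of a path, so the other end is reached by reversal. *)
have rev_cont (f : R -> C) : cont_on 0 1 f -> cont_on 0 1 (fun s => f (1 - s)).
  move=> cf s s01 e e0; have [|d d0 dP] := cf (1 - s) _ e e0; first by lra.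
  exists d => // t t01 ts; apply: dP; first by lra.
  by rewrite opprB addrC subrKA -normrN opprB.
have [Kc Kc0 KcP] := cont_on_max ler01 c_cont.
have [rhoa [Ba [Ca [etaa [Xa [ua [[ra0 Ba0 Ca0 ea0] XaB Xac XaX XaE]]]]]]] :=
  germ ka0 N0 (dvdn_mulr kb (dvdnn ka)) pa0 PaE c_cont om_cont (erefl _) omN g_neq.
have omNr (s : R) : 0 <= s <= 1 -> om (1 - s) ^+ N = P.[c (1 - s)] - z0.
  by move=> s01; apply: omN; lra.
have g_neqr (s : R) : 0 < s < 1 -> P.[c (1 - s)] != z0.
  by move=> s01; apply: g_neq; lra.
have c1r : c (1 - 0) = c 1 by rewrite subr0.
have [rhob [Bb [Cb [etab [Xb [ub [[rb0 Bb0 Cb0 eb0] XbB Xbc XbX XbE]]]]]]] :=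
  germ kb0 N0 (dvdn_mull ka (dvdnn kb)) pb0 PbE (rev_cont _ c_cont) (rev_cont _ om_cont)
    c1r omNr g_neqr.
pose del := Ba + Bb + Kc.
have del0 : 0 <= del by rewrite /del; lra.
have Bad : Ba <= del by rewrite /del; lra.
have Bbd : Bb <= del by rewrite /del; lra.
have Kcd : Kc <= del by rewrite /del; lra.
pose RR := adic_agree Xa Xb.
have ea : (0 < N %/ ka)%N by rewrite mulKn.
(* Both P(Xa) and P(Xb) converge X-adically to the same z0 + X^N. *)
have RRP : RR P.
  move=> j; exists j => m jm; have [_ d1] := XaX m; have [_ d2] := XbX m.
  rewrite (_ : _ - _ = (P \Po Xa m - (z0%:P + 'X^N)) - (P \Po Xb m - (z0%:P +
    'X^N))); last by ring.
  by apply: dvdp_trans (dvdp_sub d1 d2); rewrite dvdp_exp2l // ltnW.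
have [W RW Wgen] := polynomial_luroth (adic_agreeC Xa Xb) (@adic_agreeB _ Xa Xb)
  (@adic_agreeM _ Xa Xb) (fun f h =>
    @adic_agree_div _ _ _ ua Xa Xb f h ea XaE) RRP sizeP.
have Wab : W.[c 0] = W.[c 1].
  have [m0 /(_ m0 (leqnn _))] := RW 1%N;
    rewrite expr1 dvdpX0 hornerD hornerN !horner_comp.
  have [-> _] := XaE m0; have [-> _] := XbE m0.
  have eb : (0 < N %/ kb)%N by rewrite mulnK.
  rewrite !hornerD !hornerM !hornerC !hornerXn !expr0n !eqn0Ngt ea eb !mul0r !addr0.
  by rewrite subr_eq0 => /eqP.
suff RQ : RR Q.
  by have [Pt PtE] := Wgen _ RRP; have [Qt QtE] := Wgen _ RQ; exists Pt, Qt, W.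
apply: contrapT => /existsNP[j nj].
pose Dm m := (Q \Po Xb m) - (Q \Po Xa m).
have stepD m : 'X^(m.+1) %| Dm m.+1 - Dm m.
  have [d1 _] := XaX m; have [d2 _] := XbX m.
  rewrite /Dm (_ : _ - _ = ((Q \Po Xb m.+1) - (Q \Po Xb m)) - ((Q \Po Xa m.+1)
    - (Q \Po Xa m))); last by ring.
  by apply: dvdp_sub; [apply: dvdp_trans d2 _ | apply: dvdp_trans d1 _];
    exact: dvdp_comp_sub.
(* Coefficients below j no longer change from index j on, so the first disagreement n0 and its
   coefficient do not depend on m. *)
have stab m i : (j <= m)%N -> (i < j)%N -> (Dm m)`_i = (Dm j)`_i.
  move=> + ij; elim: m => [|m IH]; first by rewrite leqn0 => /eqP->.
  rewrite leq_eqVlt => /predU1P[->//|jm]; rewrite -IH //.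
  have /dvdp_XnP/(_ i) := stepD m; rewrite coefB => H.
  by apply/eqP; rewrite -subr_eq0 H // (leq_trans ij) // ltnW.
have exi : exists i, (i < j)%N && ((Dm j)`_i != 0).
  apply: contrapT => /forallNP H; apply: nj; exists j => m jm.
  rewrite (_ : _ - _ = - Dm m); last by rewrite /Dm; ring.
  rewrite dvdpNr; apply/dvdp_XnP => i ij; rewrite stab //.
  by apply/eqP; apply: contraT => n; case: (H i); rewrite ij.
case: (ex_minnP exi) => n0 /andP[n0j ccn0] n0min.
pose rho := Num.min rhoa rhob.
have rho0 : 0 < rho by rewrite lt_min ra0.
have ra : rho <= rhoa by rewrite ge_min lexx.
have rb : rho <= rhob by rewrite ge_min lexx orbT.
(* A Lipschitz constant of [Q] on a disc containing the path and its approximants near the ends; it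
   carries their geometric rate over to Q. *)
pose L := ((map_poly (@cm R) Q)^`()).[del].
have L0 : 0 <= L by apply: horner_deriv_map_ge0 => //; [exact: cm0 | exact: cm_ge0].
have Lip (x y : C) : cm x <= del -> cm y <= del -> cm (Q.[x] - Q.[y]) <= L * cm (x - y).
  move=> xd yd; apply: horner_lipschitz => //; [exact: cm0|exact: cm_ge0|exact: cmD|].
  by move=> u v; rewrite cmM.
pose C0 := L * (Ca + Cb) + 1.
have C00 : 0 < C0 by rewrite ltr_wpDl // mulr_ge0 // addr_ge0 // ltW.
have LC (x y : R) : 0 <= y -> x <= Ca + Cb -> L * (x / y) <= C0 / y.
  move=> y0 xC; rewrite mulrA ler_wpM2r ?invr_ge0 //.
  by rewrite /C0; have : L * x <= L * (Ca + Cb); [rewrite ler_wpM2l | lra].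
pose B := pn del Q + 1.
have B0 : 0 < B by rewrite ltr_wpDl // pn_ge0.
have QB (X : {poly C}) r (b : R) :
  0 <= r -> rho <= r -> pn r X <= b -> b <= del -> pn rho (Q \Po X) <= B.
  move=> r0 rr Xb' bd; apply: le_trans (pn_comp (ltW rho0) _ _) _.
  apply: le_trans (_ : pn del Q <= _); last by rewrite /B; lra.
  apply: pn_le; first by apply: pn_ge0; exact: ltW.
  apply: le_trans bd; apply: le_trans Xb'; apply: pn_le => //; exact: ltW.
have h0 : 0 <= (0 : R) <= 1 by lra.
have h1 : 0 <= (1 : R) <= 1 by lra.
have om0 : om 0 = 0.
  by have := omN 0 h0; rewrite g0 subrr => /eqP; rewrite expf_eq0 N0 => /eqP.
have om1 : om 1 = 0.
  by have := omN 1 h1; rewrite g1 subrr => /eqP; rewrite expf_eq0 N0 => /eqP.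
(* The estimate for the half-integer equation at radius e uses the norm at radius 2 e; e = rho/4
   keeps this within [rho]. *)
have rho4 : 0 < rho / 4 by rewrite divr_gt0.
have rho4le : rho / 4 <= rho by lra.
have mm0 : 0 < Num.min etaa etab by rewrite lt_min; case/andP: ea0 => ->;
  case/andP: eb0 => ->.
have [eta [eta0 etamm eta1 small]] := small_near_ends om_cont om0 om1 rho4 mm0.
move: etamm; rewrite le_min => /andP[etaa' etab'].
have eta_le1 : eta <= 1 by lra.
have eta_ge : 0 <= 1 - eta by lra.
have XBound (X : {poly C}) r (b : R) (s : R) :
  0 <= r -> rho <= r -> pn r X <= b -> b <= del ->
    cm (om s) <= rho / 4 -> cm X.[om s] <= del.
  move=> r0 rr Xb' bd oms; apply: le_trans bd; apply: le_trans Xb'.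
  by apply: cm_horner_le => //; exact: le_trans oms (le_trans rho4le rr).
have [ex [Mc [Mc0 c_der]]] := path_cder psc.
have pw (m : nat) : 0 <= (2 : R) ^+ m by rewrite exprn_ge0.
apply: (@localization R P Q c z0 ex Mc Mc0 c_cont c_der g0 g1 g_neq
  (moments_vanish_comp psc mom0) om N N0 Aom omN eta rho B C0
  (fun m => Q \Po Xa m) (fun m => Q \Po Xb m) eta0 eta1 rho0 B0 C00
  _ _ _ _ small n0 j _ ccn0 _ _ taus).
- by move=> m; apply: (QB _ rhoa Ba) => //; exact: ltW.
- by move=> m; apply: (QB _ rhob Bb) => //; exact: ltW.
- move=> m s /andP[s0 se]; have s01 : 0 <= s <= 1 by rewrite s0 (le_trans se).
  have oms : cm (om s) <= rho / 4 by apply: small => //; rewrite se.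
  rewrite horner_comp; apply: le_trans (Lip _ _ _ _) _.
  + exact: le_trans (KcP s s01) Kcd.
  + by apply: (XBound _ rhoa Ba) => //; exact: ltW.
  apply: le_trans (_ : L * (Ca / 2 ^+ m) <= _).
    by rewrite ler_wpM2l //; apply: Xac; rewrite s0 (le_trans se).
  by apply: LC => //; rewrite lerDl ltW.
- move=> m s /andP[es s1]; have s01 : 0 <= s <= 1 by rewrite s1 (le_trans eta_ge).
  have oms : cm (om s) <= rho / 4 by apply: small => //; rewrite es orbT.
  rewrite horner_comp; apply: le_trans (Lip _ _ _ _) _.
  + exact: le_trans (KcP s s01) Kcd.
  + by apply: (XBound _ rhob Bb) => //; exact: ltW.
  apply: le_trans (_ : L * (Cb / 2 ^+ m) <= _).
    rewrite ler_wpM2l //; have := Xbc m (1 - s); rewrite subKr; apply.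
    by rewrite subr_ge0 s1 (le_trans _ etab') // lerBlDr addrC -lerBlDr.
  by apply: LC => //; rewrite lerDr ltW.
- move=> m i jm ilt; rewrite -/(Dm m) stab //; last exact: ltn_trans ilt n0j.
  apply/eqP; apply: contraT => H; have := n0min i; rewrite H andbT (ltn_trans ilt n0j).
  by move=> /(_ isT); rewrite leqNgt ilt.
- by move=> m jm; rewrite -/(Dm m) stab.
Qed.
End Core.

(** * The straight segment as a path *)

Section Segment.
Variable R : realType.
Local Notation C := (cplx R).

Lemma cont_on_within a b (f : R -> C) : cont_on a b f ->
  {within `[a, b], continuous f}.
Proof.
move=> cf; apply/subspace_continuousP => s; rewrite /= in_itv /= => sab.
move=> P /nbhs_cm[e e0 eP]; have [d d0 dP] := cf s sab e e0.
apply/nbhs_dist; exists d => // t ts; rewrite /= in_itv /= => tab.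
by apply: eP; exact: dP.
Qed.

Lemma segment_path (a b : C) : path_joining (segment a b) a b.
Proof.
split; last 2 first.
- by rewrite /segment -/(rc 0) rc0 mul0r addr0.
- by rewrite /segment -[(1%:C)%C]/(1 : C) mul1r addrC subrK.
have cseg : cont_on 0 1 (segment a b).
  apply: cont_onD; first exact: cont_on_cst.
  apply: cont_onM; last exact: cont_on_cst.
  move=> s _ e e0; exists e => // t _ ts.
  by rewrite -[(t%:C)%C]/(rc t) -[(s%:C)%C]/(rc s) -rcB cm_rc.
split; first exact: cont_on_within.
exists [:: 1]; first by split => //=; rewrite ltr01.
have affine (f : R -> R) (u v : R) : (forall t, f t = u + t * v) -> C1_on f 0 1.
  move=> fE; exists (fun=> v); first by apply: continuous_subspaceT => x;
    exact: cvg_cst.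
  move=> x _; have -> : f = (fun t => u + t * v) by apply/funext.
  have H : is_derive x (1 : R) (cst u + (v \*: (id : R -> R))) (0 + v *: (1 : R)).
    by apply: is_deriveD; apply: is_deriveZ.
  rewrite add0r [v *: 1]mulr1 in H.
  suff <- : cst u + (v \*: (id : R -> R)) = (fun t => u + t * v) by [].
  by apply/funext => t; rewrite mulrC.
move=> [|//] _ /=; split.
  apply: (affine _ (complex.Re a) (complex.Re (b - a))) => t.
  by rewrite /segment; move: (b - a) {cseg} => w; case: a w => ? ? [? ?] /=; simpc.
apply: (affine _ (complex.Im a) (complex.Im (b - a))) => t.
by rewrite /segment; move: (b - a) {cseg} => w; case: a w => ? ? [? ?] /=; simpc.
Qed.
End Segment.

Theorem theorem5p2 (R : realType) (P : {poly cplx R}) (a b z0 : cplx R)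
    (Gamma : R -> cplx R) (D0 : set (cplx R))
    (hPa : P.[a] = z0) (hPb : P.[b] = z0)
    (hGamma : path_joining Gamma a b)
    (htrans : transversal_self_intersections (image_path P Gamma))
    (hsimple : simple_endpoint (image_path P Gamma) z0)
    (hD0 : unbounded_component (~` trace (image_path P Gamma)) D0)
    (hz0 : boundary D0 z0) :
  (forall Q : {poly cplx R},
     (forall k : nat, moment Gamma P Q k = 0) <->
     composition_condition P Q a b) /\
  definite P a b.
Proof.
have [psG G0 G1] := hGamma; have [_ _ neq] := hsimple.
have [[z Az DE] nbD] := hD0.
have Dsub : D0 `<=` ~` trace (image_path P Gamma).
  by rewrite DE; exact: connected_component_sub.
have Dc : connected D0 by rewrite DE; exact: component_connected.
have forward Q : (forall k, moment Gamma P Q k = 0) -> composition_condition P Q a b.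
  rewrite -G0 -G1; apply: (composition_of_vanishing_moments (z0 := z0) (D := D0)) => //.
  - by rewrite G0.
  - by rewrite G1.
  - by move=> s /andP[s0 s1]; apply/eqP; exact: neq.
  - move=> t /Dsub tD s s01; apply/eqP => E; apply: tD; by exists s.
  - move=> K; apply: contrapT => nK; apply: nbD.
    (* [bounded_set] asks for a bound in [C], which has to be a real element. *)
    exists (rc K); split; first by apply/complex_realP; exists K.
    move=> M KM t Dt /=; apply: le_trans (ltW KM).
    rewrite cmE /rc lecR leNgt; apply/negP => tK; apply: nK.
    by exists t => //; exact: ltW.
  - move=> e e0; have [cl _] := hz0.
    have [|t [Dt te]] := cl [set w | cm (w - z0) < e].
      by apply/nbhs_cm; exists e.
    by exists t.
split=> [Q|Q m0].
  split; first exact: forward.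
  by rewrite -G0 -G1 => cc k; exact: composition_moments.
(* The segment and [Gamma] have the same end points, so both moments are the difference T(b) - T(a)
   of one primitive. *)
have [psS S0 S1] := segment_path a b.
apply: forward => k; have [T TE] := antiderivative_exists (P ^+ k * Q * P^`()).
have := moment_antiderivative psS TE; rewrite S0 S1 m0 => E.
by rewrite (moment_antiderivative psG TE) G0 G1 -E.
Qed.
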